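(* The category of grading-restricted $\mathbb{R}\times\mathbb{R}$-graded full field algebras is isomorphic to the category of smooth $\widehat{K}$-algebras.
   Context: Powers: $\log z=\log|z|+i\,\mathrm{Arg}\,z$ with $0\le \mathrm{Arg}\,z<2\pi$; for $m,n\in\mathbb{R}$, $z^m=e^{m\log z}$, $\bar z^n=e^{n\overline{\log z}}$. **Full field algebras.** For a vector space $F=\coprod_{(p,q)\in\mathbb{R}\times\mathbb{R}}F_{(p,q)}$ write $\overline F=\prod F_{(p,q)}$, $F'=\coprod F_{(p,q)}^*$, $P_{p,q}$ for the projection onto $F_{(p,q)}$, and $\mathbf d^L,\mathbf d^R$ for the grading operators ($\mathbf d^Lu=pu$, $\mathbf d^Ru=qu$ for $u\in F_{(p,q)}$). A grading-restricted $\mathbb{R}\times\mathbb{R}$-graded full field algebra is $(F,m,\mathbf 1,\mathbf d^L,\mathbf d^R,D^L,D^R)$ with $\dim F_{(p,q)}<\infty$, $F_{(p,q)}=0$ if $p$ or $q$ is sufficiently negative, $\mathbf 1\in F$, $D^L,D^R\in\mathrm{End}\,F$, and for each $n\ge1$ a map $m_n(u_1,\dots,u_n;z_1,\bar z_1,\dots,z_n,\bar z_n)\in\overline F$ ($u_i\in F$, $z_i\in\mathbb{C}$ pairwise distinct), linear in each $u_i$ and smooth in the real and imaginary parts of the $z_i$ (after pairing with any element of $F'$), such that: (i) identity: $m_1(u;0,0)=u$ and $m_{n+1}(u_1,\dots,u_n,\mathbf 1;z_1,\bar z_1,\dots,z_{n+1},\bar z_{n+1})=m_n(u_1,\dots,u_n;z_1,\bar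 z_1,\dots,z_n,\bar z_n)$; (ii) convergence: when $|\zeta_s|<|z_i-z_j|$ for all $s$ and all $j\ne i$, the series $\sum_{p,q}m_k(u_1,\dots,u_{i-1},P_{p,q}m_l(v_1,\dots,v_l;\zeta_1,\bar\zeta_1,\dots,\zeta_l,\bar\zeta_l),u_{i+1},\dots,u_k;z_1,\bar z_1,\dots,z_k,\bar z_k)$ converges absolutely (paired with $F'$) to $m_{k+l-1}(u_1,\dots,u_{i-1},v_1,\dots,v_l,u_{i+1},\dots,u_k;\dots)$ with $v_s$ placed at $z_i+\zeta_s$ and $u_j$ at $z_j$; (iii) permutation: $m_n$ is unchanged when the pairs $(u_i,z_i)$ are permuted simultaneously; (iv) single-valuedness: $e^{2\pi i(\mathbf d^L-\mathbf d^R)}=I_F$; (v) with $\mathbb{Y}(u;z,\bar z)v:=m_2(u,v;z,\bar z,0,0)$: $[\mathbf d^L,\mathbb Y(u;z,\bar z)]=z\partial_z\mathbb Y(u;z,\bar z)+\mathbb Y(\mathbf d^Lu;z,\bar z)$, $[\mathbf d^R,\mathbb Y(u;z,\bar z)]=\bar z\partial_{\bar z}\mathbb Y(u;z,\bar z)+\mathbb Y(\mathbf d^Ru;z,\bar z)$; (vi) $[D^L,\mathbb Y(u;z,\bar z)]=\mathbb Y(D^Lu;z,\bar z)=\partial_z\mathbb Y(u;z,\bar z)$, $[D^R,\mathbb Y(u;z,\bar z)]=\mathbb Y(D^Ru;z,\bar z)=\partial_{\bar z}\mathbb Y(u;z,\bar z)$. Morphisms are grading-preserving linear maps compatible with all $m_n$,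 $\mathbf 1$, $D^L,D^R$. **The partial operad $\widehat K$.** $\widehat K(0)$ is one point $(\mathbf 0)$. For $n\ge1$, $\widehat K(n)$ is the set of $Q=(z_1,\dots,z_{n-1};A(a;1),(a_1,\mathbf 0),\dots,(a_n,\mathbf 0))$ with $z_i\in\mathbb{C}^\times$ pairwise distinct, $a\in\mathbb{C}$, $a_i\in\mathbb{C}^\times$. It represents the sphere $\mathbb{C}\cup\{\infty\}$ with a negatively oriented ($0$-th) puncture at $\infty$ with local coordinate $-1/(w-a)$ and positively oriented punctures at $z_1,\dots,z_{n-1},z_n:=0$ with local coordinates $a_i(w-z_i)$, up to conformal equivalence; a translation $w\mapsto w-t$ changes $z_i\mapsto z_i-t$, $a\mapsto a-t$, and is used to put the last puncture at $0$ (and, if there is no positively oriented puncture, to make $a=0$). Sewing: for $P=(z_i;A(a;1),(a_i,\mathbf 0))\in\widehat K(m)$ and $Q=(\xi_k;A(b;1),(b_k,\mathbf 0))\in\widehat K(n)$ (with $\xi_n=0$; and $b=0$ if $n=0$), $P\,{}_i\infty_0\,Q$ exists iff $\max_k|\xi_k-b|<|a_i|\min_{j\neq i}|z_j-z_i|$ (maximum over the empty set is $0$, minimum over the empty set is $+\infty$), and then it is the class with positive punctures in order $z_1,\dots,z_{i-1},z_i+\frac{\xi_1-b}{a_i},\dots,z_i+\frac{\xi_n-b}{a_i},z_{i+1},\dots,z_m$, with coordinate scalings $a_1,\dots,a_{i-1},a_ib_1,\dots,a_ib_n,a_{i+1},\dots,a_m$ and coordinate $-1/(w-a)$ at $\infty$.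 $S_n$ permutes the labels of the positive punctures; the identity is $I_K=(A(0;1),(1,\mathbf 0))$; the rescaling group is $\mathbb{C}^\times=\{(A(0;1),(c,\mathbf 0))\}\subset\widehat K(1)$. **Smooth $\widehat K$-algebras.** A $\widehat K$-algebra is $(F,W,\nu)$: $F=\coprod_M F_{(M)}$ a completely reducible $\mathbb{C}^\times$-module ($M$ running over classes of irreducible modules), $\dim F_{(M)}<\infty$; $W\subset F$ the submodule generated by the homogeneous components of $\nu_0(\widehat K(0))$; $\nu_n:\widehat K(n)\to\mathrm{Hom}(F^{\otimes n},\overline F)$ with image mapping $W^{\otimes n}$ into $\overline W$; $\nu_1(I_K)=I_F$; $\nu$ is $S_n$-equivariant; whenever $P\,{}_i\infty_0Q$ exists, the composition $\nu(P)\,{}_i*_0\,\nu(Q)=\sum_M\nu(P)(\dots,P_M\nu(Q)(\dots),\dots)$ ($\nu(Q)$ inserted in the $i$-th slot) converges absolutely when paired with $F'$ and equals $\nu(P\,{}_i\infty_0Q)$; and $\nu_1$ restricted to the rescaling group is the given representation. Irreducible $\mathbb{C}^\times$-modules are labelled by pairs $(m,n)\in\mathbb{C}^2$, $m-n\in\mathbb{Z}$, with $c\in\mathbb C^\times$ acting by $c^{-m}\bar c^{-n}$; $F_{(m,n)}$ denotes the corresponding isotypic part. It is smooth if $F_{(m,n)}=0$ when the real part of $m$ or $n$ is sufficiently small, and for all $w'\in F'$, $w_1,\dots,w_n\in F$ the function $Q\mapsto\langle w',\nu(Q)(w_1\otimes\cdots\otimes w_n)\rangle$ on $\widehat K(n)$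 is a finite sum $\sum_k g_k h_k$ with $g_k$ polynomial in $a,\bar a$ and a linear combination of $\prod_i a_i^{r_i}\bar a_i^{s_i}$ ($r_i,s_i\in\mathbb{R}$), and $h_k$ a smooth function of $z_1,\dots,z_{n-1}$. Morphisms are $\mathbb{C}^\times$-equivariant linear maps intertwining all $\nu_n$. *)

(* Defs.v *)
(* The real numbers are an arbitrary R : realType (MathComp-Analysis) and the   *)
(* complex numbers are R[i].                                                    *)
From mathcomp Require Import all_boot all_order all_algebra all_fingroup.
From mathcomp Require Import finmap.
From mathcomp Require Import all_classical all_reals all_analysis.
From mathcomp Require Import complex zify.

Set Implicit Arguments.
Unset Strict Implicit.
Unset Printing Implicit Defensive.

Import Order.TTheory GRing.Theory Num.Theory.
Import numFieldNormedType.Exports.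
Import Normc.

(* The projections R[i] -> R, not the operators 'Re and 'Im : R[i] -> R[i]. *)
Local Notation Re := complex.Re.
Local Notation Im := complex.Im.

Local Open Scope classical_set_scope.
Local Open Scope ring_scope.

Record category := Category {
  Ob : Type;
  Hom : Ob -> Ob -> Type;
  idm : forall A, Hom A A;
  comp : forall A B C, Hom B C -> Hom A B -> Hom A C;
  comp1m : forall A B (f : Hom A B), comp (idm B) f = f;
  compm1 : forall A B (f : Hom A B), comp f (idm A) = f;
  compA : forall A B C D (h : Hom C D) (g : Hom B C) (f : Hom A B),
    comp h (comp g f) = comp (comp h g) f }.

Record functor (C D : category) := Functor {
  fobj : Ob C -> Ob D;
  fhom : forall A B, Hom A B -> Hom (fobj A) (fobj B);
  fhom_id : forall A, fhom (idm A) = idm (fobj A);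
  fhom_comp : forall A B E (g : Hom B E) (f : Hom A B),
    fhom (comp g f) = comp (fhom g) (fhom f) }.

Definition arrow (C : category) := {A : Ob C & {B : Ob C & Hom A B}}.

Definition farrow (C D : category) (T : functor C D) (f : arrow C) : arrow D :=
  existT _ (fobj T (projT1 f))
    (existT _ (fobj T (projT1 (projT2 f))) (fhom T (projT2 (projT2 f)))).

(* Isomorphism, not merely equivalence: S T and T S are the identity on objects *)
(* and on arrows.  Passing to the total type of arrows avoids transporting      *)
(* S (T f) along the equalities between objects.                                *)
Definition isomorphic_categories (C D : category) : Prop :=
  exists (T : functor C D) (S : functor D C),
    [/\ cancel (fobj T) (fobj S), cancel (fobj S) (fobj T),
        cancel (farrow T) (farrow S) & cancel (farrow S) (farrow T)].

Section Tuples.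
Variable T : Type.

Definition upd n (u : n.-tuple T) (i : 'I_n) (x : T) : n.-tuple T :=
  [tuple if j == i then x else tnth u j | j < n].

Definition permute n (s : 'S_n) (u : n.-tuple T) : n.-tuple T :=
  [tuple tnth u (s j) | j < n].

Definition splice (i : nat) (s t : seq T) := take i s ++ t ++ drop i.+1 s.

Lemma size_splice k l (i : 'I_k) (s : k.-tuple T) (t : l.-tuple T) :
  size (splice i s t) == (k + l).-1.
Proof.
rewrite /splice !size_cat size_take size_drop !size_tuple ltn_ord.
case: k i s => [[]//|k] i s; rewrite subSS addnCA subnKC; last exact: leq_ord.
by rewrite addnC.
Qed.

(* (u_1, .., u_(i-1), v_1, .., v_l, u_(i+1), .., u_k) *)
Definition splice_tuple k l (i : 'I_k) (s : k.-tuple T) (t : l.-tuple T) :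
  (k + l).-1.-tuple T := Tuple (size_splice i s t).

End Tuples.

Section Graded.
Variables (K : fieldType) (V : lmodType K) (I : choiceType) (G : I -> set V).

Definition subspace (S : set V) : Prop :=
  S 0 /\ forall a u v, S u -> S v -> S (a *: u + v).

Definition findim (S : set V) : Prop :=
  exists n (b : 'I_n -> V), (forall j, S (b j)) /\
    forall u, S u -> exists c : 'I_n -> K, u = \sum_j c j *: b j.

(* An element of the algebraic completion \prod_i G i is a function x : I -> V  *)
(* such that G i (x i) for all i; embeds x u says that x is the image in the    *)
(* completion of the vector u, i.e. x i is the component of u in G i.           *)
Definition embeds (x : I -> V) (u : V) : Prop :=
  (forall i, G i (x i)) /\
  exists s : {fset I},
    (forall i, i \notin s -> x i = 0) /\ u = \sum_(i <- s) x i.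

Definition direct_sum : Prop :=
  (forall i, subspace (G i)) /\ forall u, exists! x, embeds x u.

(* The restricted dual \coprod_i (G i)^*, as the linear forms on V that vanish  *)
(* on all but finitely many G i.                                                *)
Record rdual := RDual {
  rdual_form :> {scalar V};
  rdual_supp : {fset I};
  rdual_out : forall i u, i \notin rdual_supp -> G i u -> rdual_form u = 0 }.

Definition pairing (w : rdual) (x : I -> V) : K :=
  \sum_(i <- rdual_supp w) w (x i).

Definition multilinear n (f : n.-tuple V -> I -> V) : Prop :=
  forall (u : n.-tuple V) (j : 'I_n) a x y i,
    f (upd u j (a *: x + y)) i = a *: f (upd u j x) i + f (upd u j y) i.

End Graded.

Section ComplexAnalysis.
Variable R : realType.
Local Notation C := R[i].

Definition cexp (z : C) : C :=
  (expR (Re z))%:C%C * (cos (Im z) +i* sin (Im z))%C.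

(* The argument in [0, 2 pi[ of z != 0. *)
Definition Arg (z : C) : R :=
  if 0 <= Im z then acos (Re z / normc z) else 2 * pi - acos (Re z / normc z).

Definition clog (z : C) : C := (ln (normc z) +i* Arg z)%C.

Definition cpow (z m : C) : C := cexp (m * clog z).

(* \bar z ^ n; not the same as cpow applied to the conjugate of z. *)
Definition cpowbar (z n : C) : C := cexp (n * conjc (clog z)).

Definition sums_absolutely (I : choiceType) (f : I -> C) (s : C) : Prop :=
  summable [set: I] (fun i => (normc (f i))%:E) /\
  forall e : R, 0 < e -> exists A : {fset I}, forall B : {fset I},
    (A `<=` B)%fset -> normc (\sum_(i <- B) f i - s) < e.

(* The Wirtinger derivatives d/dz and d/d(bar z). *)
Definition ddx (f : C -> C) (z : C) : C :=
  (derive1 (fun t : R => Re (f (z + (t +i* 0)%C))) 0 +i*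
   derive1 (fun t : R => Im (f (z + (t +i* 0)%C))) 0)%C.

Definition ddy (f : C -> C) (z : C) : C :=
  (derive1 (fun t : R => Re (f (z + (0 +i* t)%C))) 0 +i*
   derive1 (fun t : R => Im (f (z + (0 +i* t)%C))) 0)%C.

Definition ddz (f : C -> C) (z : C) : C := (ddx f z - 'i%C * ddy f z) / 2.

Definition ddzbar (f : C -> C) (z : C) : C := (ddx f z + 'i%C * ddy f z) / 2.

(* The class C^k on a set U, meant for open U. *)
Fixpoint Ck (m k : nat) (U : set 'rV[R]_m) (g : 'rV[R]_m -> R) : Prop :=
  match k with
  | 0 => forall x, U x -> {for x, continuous g}
  | k'.+1 => (forall x, U x -> differentiable g x) /\
             forall v : 'rV[R]_m, Ck k' U (fun x => 'D_v g x)
  end.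

Definition of_coords n (x : 'rV[R]_(n + n)) : n.-tuple C :=
  [tuple (x 0 (lshift n j) +i* x 0 (rshift n j))%C | j < n].

(* Smoothness of f on the open set D in the real and imaginary parts of its     *)
(* n complex variables.                                                         *)
Definition smooth_on n (D : set (n.-tuple C)) (f : n.-tuple C -> C) : Prop :=
  forall k,
    Ck k [set x | D (of_coords x)] (fun x => Re (f (of_coords x))) /\
    Ck k [set x | D (of_coords x)] (fun x => Im (f (of_coords x))).

End ComplexAnalysis.

Section FullFieldAlgebras.
Variable R : realType.
Local Notation C := R[i].

(* n-tuples of distinct points; empty for n = 0, so that the family of maps m_n *)
(* below, written with n : nat, carries data for n >= 1 only.                   *)
Definition conf (n : nat) := {z : n.-tuple C | (0 < n)%N && uniq z}.

Record ffa_data := FFAData {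
  ffa_carrier :> lmodType C;
  ffa_gr : R * R -> set ffa_carrier;
  ffa_m : forall n, n.-tuple ffa_carrier -> conf n -> R * R -> ffa_carrier;
  ffa_one : ffa_carrier;
  ffa_dL : ffa_carrier -> ffa_carrier;
  ffa_dR : ffa_carrier -> ffa_carrier;
  ffa_DL : ffa_carrier -> ffa_carrier;
  ffa_DR : ffa_carrier -> ffa_carrier }.

(* < w, m_n(u; z) > as a total function of z, extended by 0. *)
Definition ffa_corr (F : ffa_data) (w : rdual (@ffa_gr F)) n (u : n.-tuple F)
    (z : n.-tuple C) : C :=
  oapp (fun c : conf n => pairing w (ffa_m u c)) 0 (insub z).

(* < w, Y(u; z) v > *)
Definition ffa_Y (F : ffa_data) (w : rdual (@ffa_gr F)) (u v : F) (z : C) : C :=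
  ffa_corr w [tuple u; v] [tuple z; 0].

(* In d_bracketL/R the operator d acts on the completion componentwise.         *)
(* In D_bracketL/R nothing is assumed on how D meets the grading, and           *)
(* < w, D x > for x in the completion is the sum over (p, q) of                 *)
(* < w, D (x (p, q)) >, which is required to converge absolutely.               *)
Record is_ffa (F : ffa_data) : Prop := IsFFA {
  ffa_grading : direct_sum (@ffa_gr F);
  ffa_findim : forall pq, findim (@ffa_gr F pq);
  ffa_lower : exists N : R, forall p q, p < N \/ q < N ->
    forall u, @ffa_gr F (p, q) u -> u = 0;
  ffa_dL_linear : linear (@ffa_dL F);
  ffa_dR_linear : linear (@ffa_dR F);
  ffa_dLE : forall p q u, @ffa_gr F (p, q) u -> ffa_dL u = p%:C%C *: u;
  ffa_dRE : forall p q u, @ffa_gr F (p, q) u -> ffa_dR u = q%:C%C *: u;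
  ffa_DL_linear : linear (@ffa_DL F);
  ffa_DR_linear : linear (@ffa_DR F);
  ffa_m_homogeneous : forall n (u : n.-tuple F) z pq, ffa_gr pq (ffa_m u z pq);
  ffa_m_multilinear : forall n (z : conf n),
    multilinear (fun u : n.-tuple F => ffa_m u z);
  ffa_m_smooth : forall n (u : n.-tuple F) (w : rdual (@ffa_gr F)),
    smooth_on [set z : n.-tuple C | (0 < n)%N && uniq z] (ffa_corr w u);
  ffa_identity1 : forall (u : F) (z : conf 1), val z = [tuple 0] ->
    embeds (@ffa_gr F) (ffa_m [tuple u] z) u;
  ffa_identity : forall n (u : n.-tuple F) (z : conf n) (z' : conf n.+1) zn,
    val z' = [tuple of rcons (val z) zn] ->
    ffa_m [tuple of rcons u (@ffa_one F)] z' = ffa_m u z;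
  ffa_convergence : forall k l (i : 'I_k) (u : k.-tuple F) (v : l.-tuple F)
      (z : conf k) (zeta : conf l) (z' : conf (k + l).-1),
    let zi := tnth (val z) i in
    (forall (s : 'I_l) (j : 'I_k), j != i ->
      `|tnth (val zeta) s| < `|zi - tnth (val z) j|) ->
    val z' = splice_tuple i (val z) (map_tuple (fun x => zi + x) (val zeta)) ->
    forall w : rdual (@ffa_gr F),
    sums_absolutely
      (fun pq : R * R => pairing w (ffa_m (upd u i (ffa_m v zeta pq)) z))
      (pairing w (ffa_m (splice_tuple i u v) z'));
  ffa_permutation : forall n (s : 'S_n) (u : n.-tuple F) (z z' : conf n),
    val z' = permute s (val z) -> ffa_m (permute s u) z' = ffa_m u z;
  ffa_single_valued : forall p q u, @ffa_gr F (p, q) u ->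
    cexp ('i%C * (2 * pi * (p - q))%:C%C) *: u = u;
  ffa_d_bracketL : forall (w : rdual (@ffa_gr F)) u v (z : C) (c : conf 2),
    val c = [tuple z; 0] ->
    pairing w (fun pq => ffa_dL (ffa_m [tuple u; v] c pq))
      - pairing w (ffa_m [tuple u; ffa_dL v] c)
    = z * ddz (ffa_Y w u v) z + pairing w (ffa_m [tuple ffa_dL u; v] c);
  ffa_d_bracketR : forall (w : rdual (@ffa_gr F)) u v (z : C) (c : conf 2),
    val c = [tuple z; 0] ->
    pairing w (fun pq => ffa_dR (ffa_m [tuple u; v] c pq))
      - pairing w (ffa_m [tuple u; ffa_dR v] c)
    = conjc z * ddzbar (ffa_Y w u v) z + pairing w (ffa_m [tuple ffa_dR u; v] c);
  ffa_D_bracketL : forall (w : rdual (@ffa_gr F)) u v (z : C) (c : conf 2),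
    val c = [tuple z; 0] ->
    sums_absolutely (fun pq : R * R => w (ffa_DL (ffa_m [tuple u; v] c pq)))
      (pairing w (ffa_m [tuple u; ffa_DL v] c)
        + pairing w (ffa_m [tuple ffa_DL u; v] c));
  ffa_D_bracketR : forall (w : rdual (@ffa_gr F)) u v (z : C) (c : conf 2),
    val c = [tuple z; 0] ->
    sums_absolutely (fun pq : R * R => w (ffa_DR (ffa_m [tuple u; v] c pq)))
      (pairing w (ffa_m [tuple u; ffa_DR v] c)
        + pairing w (ffa_m [tuple ffa_DR u; v] c));
  ffa_D_derivL : forall (w : rdual (@ffa_gr F)) u v (z : C) (c : conf 2),
    val c = [tuple z; 0] ->
    pairing w (ffa_m [tuple ffa_DL u; v] c) = ddz (ffa_Y w u v) z;
  ffa_D_derivR : forall (w : rdual (@ffa_gr F)) u v (z : C) (c : conf 2),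
    val c = [tuple z; 0] ->
    pairing w (ffa_m [tuple ffa_DR u; v] c) = ddzbar (ffa_Y w u v) z }.

Record ffa := FFA { ffa_dat :> ffa_data; ffa_axioms : is_ffa ffa_dat }.

Record is_ffa_morphism (F1 F2 : ffa) (f : F1 -> F2) : Prop := IsFFAMorphism {
  ffam_linear : linear f;
  ffam_grading : forall pq u, ffa_gr pq u -> ffa_gr pq (f u);
  ffam_m : forall n (u : n.-tuple F1) (z : conf n) pq,
    f (ffa_m u z pq) = ffa_m (map_tuple f u) z pq;
  ffam_one : f (ffa_one F1) = ffa_one F2;
  ffam_DL : forall u, f (ffa_DL u) = ffa_DL (f u);
  ffam_DR : forall u, f (ffa_DR u) = ffa_DR (f u) }.

Definition ffa_hom (F1 F2 : ffa) := {f : F1 -> F2 | is_ffa_morphism f}.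

Lemma ffa_id_proof (F : ffa) : is_ffa_morphism (fun u : F => u).
Proof.
split=> //; move=> n u z pq; congr (ffa_m _ z pq).
by apply: val_inj; rewrite /= map_id.
Qed.

Definition ffa_id (F : ffa) : ffa_hom F F := exist _ _ (ffa_id_proof F).

Lemma ffa_comp_proof (F1 F2 F3 : ffa) (g : ffa_hom F2 F3) (f : ffa_hom F1 F2) :
  is_ffa_morphism (fun u => proj1_sig g (proj1_sig f u)).
Proof.
case: f g => f [f1 f2 f3 f4 f5 f6] [g [g1 g2 g3 g4 g5 g6]] /=; split=> /=.
- by move=> a u v; rewrite f1 g1.
- by move=> pq u /f2/g2.
- move=> n u z pq; rewrite f3 g3; congr (ffa_m _ z pq).
  by apply: val_inj; rewrite /= -map_comp.
- by rewrite f4 g4.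
- by move=> u; rewrite f5 g5.
- by move=> u; rewrite f6 g6.
Qed.

Definition ffa_comp (F1 F2 F3 : ffa) (g : ffa_hom F2 F3) (f : ffa_hom F1 F2) :
  ffa_hom F1 F3 := exist _ _ (ffa_comp_proof g f).

Lemma ffa_hom_eq (F1 F2 : ffa) (f g : ffa_hom F1 F2) :
  proj1_sig f = proj1_sig g -> f = g.
Proof. by case: f g => [f pf] [g pg] /= fg; exact: eq_exist. Qed.

Definition ffa_category : category.
Proof.
refine (@Category ffa ffa_hom ffa_id ffa_comp _ _ _).
- by move=> A B f; exact: ffa_hom_eq.
- by move=> A B f; exact: ffa_hom_eq.
- by move=> A B D E h g f; exact: ffa_hom_eq.
Defined.

End FullFieldAlgebras.

Section PartialOperad.
Variable R : realType.
Local Notation C := R[i].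

(* (z_1, .., z_(n-1); A(a; 1), (a_1, 0), .., (a_n, 0)); the points z_i are      *)
(* nonzero and distinct because rcons kz 0 has no repetition.  For n = 0 the    *)
(* last condition leaves a single point.                                        *)
Record Khat (n : nat) := MkKhat {
  kz : n.-1.-tuple C;
  ka : C;
  ks : n.-tuple C;
  khatP : [&& uniq (rcons kz 0), 0 \notin ks & (n == 0%N) ==> (ka == 0)] }.

(* All n punctures (z_1, .., z_n); the default value of nth provides z_n = 0. *)
Definition kpts n (Q : Khat n) : n.-tuple C := [tuple nth 0 (kz Q) j | j < n].

(* Q is the normal form, reached by a translation, of the sphere with positive  *)
(* punctures p, scalings s, and coordinate -1 / (w - a) at infinity.            *)
Definition represents n (Q : Khat n) (p : n.-tuple C) (a : C) (s : n.-tuple C) :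
    Prop :=
  let t := if n is 0 then a else last 0 p in
  [/\ kpts Q = map_tuple (fun x => x - t) p, ka Q = a - t & ks Q = s].

(* max_k |xi_k - b| < |a_i| min_(j != i) |z_j - z_i|, with the max of the empty *)
(* set equal to 0 and its min equal to +oo.                                     *)
Definition sewable m n (P : Khat m) (i : 'I_m) (Q : Khat n) : Prop :=
  forall (k : 'I_n) (j : 'I_m), j != i ->
    `|tnth (kpts Q) k - ka Q| <
    `|tnth (ks P) i| * `|tnth (kpts P) j - tnth (kpts P) i|.

(* S is the result of sewing the 0-th puncture of Q to the i-th one of P. *)
Definition is_sewing m n (P : Khat m) (i : 'I_m) (Q : Khat n)
    (S : Khat (m + n).-1) : Prop :=
  let zi := tnth (kpts P) i in
  let ai := tnth (ks P) i in
  represents S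
    (splice_tuple i (kpts P)
      (map_tuple (fun xi => zi + (xi - ka Q) / ai) (kpts Q)))
    (ka P)
    (splice_tuple i (ks P) (map_tuple (fun b => ai * b) (ks Q))).

Definition Cx := {c : C | c != 0}.

Definition Cx1 : Cx := exist _ 1 (oner_neq0 _).

Definition Cx_mul (c d : Cx) : Cx :=
  exist _ (val c * val d) (mulf_neq0 (valP c) (valP d)).

Lemma rescaling_proof (c : Cx) :
  [&& uniq (rcons [tuple] (0 : C)), 0 \notin [tuple val c]
    & (1 == 0)%N ==> ((0 : C) == 0)].
Proof. by rewrite /= inE eq_sym (valP c). Qed.

Definition rescaling (c : Cx) : Khat 1 := @MkKhat 1 _ _ _ (rescaling_proof c).

Definition Khat_id : Khat 1 := rescaling Cx1.

(* Consistency of the encoding: the sewing of P and Q is a well-defined point   *)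
(* as soon as it exists.                                                        *)

Lemma kpts_inj n (Q Q' : Khat n) :
  kpts Q = kpts Q' -> ka Q = ka Q' -> ks Q = ks Q' -> Q = Q'.
Proof.
case: Q Q' => z a s p [z' a' s' p'] /= e ea es.
have ez : z = z'.
  apply: val_inj; apply: (@eq_from_nth _ 0); rewrite !size_tuple// => j jn.
  have jn' : (j < n)%N by case: n jn {e z a s p z' a' s' p' ea es}=> //= n /ltnW.
  by move: (congr1 (fun s => tnth s (Ordinal jn')) e); rewrite !tnth_mktuple.
by subst; congr MkKhat; exact: bool_irrelevance.
Qed.

Lemma represents_uniq n (Q Q' : Khat n) p a s :
  represents Q p a s -> represents Q' p a s -> Q = Q'.
Proof.
by move=> [e1 e2 e3] [e1' e2' e3']; apply: kpts_inj; congruence.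
Qed.

Lemma represents_ex n (p : n.-tuple C) (a : C) (s : n.-tuple C) :
  uniq p -> 0 \notin s -> exists Q : Khat n, represents Q p a s.
Proof.
case: n p s => [|n] p s up s0.
  have H : [&& uniq (rcons [tuple] (0 : C)), 0 \notin [tuple of ([::] : seq C)]
    & (0 == 0)%N ==> ((0 : C) == 0)] by rewrite /= eqxx.
  exists (@MkKhat 0 _ _ _ H); split; last by rewrite tuple0 [RHS]tuple0.
    by rewrite tuple0 [RHS]tuple0.
  by rewrite subrr.
pose t := last 0 p.
pose q := [seq x - t | x <- p].
have sq : size q = n.+1 by rewrite size_map size_tuple.
have sz : size (belast (head 0 q) (behead q)) == n.
  by rewrite size_belast size_behead sq.
have qE : q = rcons (belast (head 0 q) (behead q)) 0.
  case E : q sq => [//|x q'] _ /=.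
  rewrite [LHS]lastI; congr rcons.
  have <- : last (0 - t) q = last x q' by rewrite E.
  by rewrite /q (last_map (fun x => x - t)) subrr.
have uq : uniq q by rewrite map_inj_uniq//; exact: addIr.
have H : [&& uniq (rcons (Tuple sz) 0), 0 \notin s
    & (n.+1 == 0%N) ==> (a - t == 0)] by rewrite /= -qE uq s0.
exists (@MkKhat n.+1 _ _ _ H); split => //.
apply: eq_from_tnth => j; rewrite tnth_mktuple /= (tnth_nth 0) /= -/q.
have := ltn_ord j; set j' : nat := j => jn.
rewrite [in RHS]qE nth_rcons (eqP sz).
case: ltngtP => // jn'.
  by move: jn; rewrite ltnS leqNgt jn'.
by rewrite nth_default// (eqP sz) jn'.
Qed.

Lemma kpts_uniq n (Q : Khat n) : uniq (kpts Q).
Proof.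
case: n Q => [|n] Q; first by rewrite (tuple0 (kpts Q)).
have /and3P[uz _ _] := khatP Q.
suff -> : (kpts Q : seq C) = rcons (kz Q) 0 by [].
have -> : rcons (kz Q) 0 = [tuple of rcons (kz Q) 0] :> seq C by [].
congr val; apply: eq_from_tnth => j; rewrite tnth_mktuple (tnth_nth 0) /=.
rewrite nth_rcons size_tuple /=; case: ltngtP => // nj.
  by rewrite nth_default// size_tuple ltnW.
by rewrite nth_default// size_tuple nj.
Qed.

Lemma splice_uniq (T : eqType) (x0 : T) i (s t : seq T) : uniq s -> uniq t ->
  (forall x j, x \in t -> (j < size s)%N -> j != i -> x != nth x0 s j) ->
  uniq (splice i s t).
Proof.
move=> us ut H; rewrite /splice uniq_catCA cat_uniq ut /=; apply/andP; split.
  apply/hasPn => y; rewrite mem_cat => /orP[] /(nthP x0)[j js <-]; apply/negP.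
    have ji : (j < i)%N by move: js; rewrite size_take; case: ifP => //; lia.
    have {}js : (j < size s)%N by move: js; rewrite size_take; case: ifP => //; lia.
    rewrite nth_take// => yt; have := H _ _ yt js; rewrite eqxx.
    by rewrite neq_ltn ji => /(_ isT).
  move: js; rewrite size_drop => js.
  have {}js : (i.+1 + j < size s)%N by lia.
  rewrite nth_drop => yt; have := H _ _ yt js; rewrite eqxx => H'.
  suff /H' : (i.+1 + j)%N != i by [].
  lia.
apply: (subseq_uniq _ us); rewrite -[X in subseq _ X](cat_take_drop i s).
apply: cat_subseq => //; rewrite -addn1 addnC -drop_drop.
exact: drop_subseq.
Qed.

Lemma sewing_exists m n (P : Khat m) (i : 'I_m) (Q : Khat n) :
  sewable P i Q -> exists! S, is_sewing P i Q S.
Proof.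
move=> PQ; have /and3P[_ P0 _] := khatP P; have /and3P[_ Q0 _] := khatP Q.
have ai0 : tnth (ks P) i != 0.
  by apply: contra P0 => /eqP <-; exact: mem_tnth.
have [||S HS] := @represents_ex _ (splice_tuple i (kpts P)
      (map_tuple (fun xi => tnth (kpts P) i + (xi - ka Q) / tnth (ks P) i)
        (kpts Q))) (ka P)
    (splice_tuple i (ks P) (map_tuple (fun b => tnth (ks P) i * b) (ks Q))).
- apply: (@splice_uniq _ 0); first exact: kpts_uniq.
    rewrite map_inj_uniq ?kpts_uniq// => x y /addrI /(mulIf _) xy.
    by apply: addIr (xy _); rewrite invr_eq0.
  move=> x j /mapP[xi /tnthP[k ->] ->]; rewrite size_tuple => jm ji.
  have := PQ k (Ordinal jm) ji; rewrite [tnth _ (Ordinal jm)](tnth_nth 0) => lt.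
  apply: contraTneq lt => <-; rewrite addrAC subrr add0r normrM normfV.
  by rewrite mulrCA divff ?normr_eq0// mulr1 ltxx.
- rewrite /= /splice !mem_cat !negb_or; apply/and3P; split.
  + by apply: contra P0; exact: mem_take.
  + apply/negP => /mapP[b bQ /esym/eqP]; rewrite mulf_eq0 (negPf ai0)/=.
    by move=> /eqP b0; rewrite b0 in bQ; rewrite bQ in Q0.
  + by apply: contra P0; exact: mem_drop.
by exists S; split=> // S'; exact: represents_uniq.
Qed.

End PartialOperad.

Section SmoothKhatAlgebras.
Variable R : realType.
Local Notation C := R[i].

(* The labels of the irreducible C^x-modules *)
Definition weight :=
  {mn : C * C | `[< exists k : int, mn.1 - mn.2 = k%:~R >]}.

(* The submodule W of a Khat-algebra is determined by nu: see kalg_W. *)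
Record kalg_data := KAlgData {
  kalg_carrier :> lmodType C;
  kalg_act : Cx R -> kalg_carrier -> kalg_carrier;
  kalg_nu : forall n, Khat R n -> n.-tuple kalg_carrier -> weight ->
    kalg_carrier }.

Section Defs.
Variable F : kalg_data.

Definition isotypic (M : weight) : set F := [set u : F | forall c : Cx R,
  kalg_act c u = (cpow (val c) (- (val M).1) * cpowbar (val c) (- (val M).2)) *: u].

(* The C^x-submodule generated by the homogeneous components of nu_0 *)
Definition kalg_W : set F := [set u : F | forall S : set F,
  subspace S -> (forall c v, S v -> S (kalg_act c v)) ->
  (forall (Q : Khat R 0) M, S (kalg_nu Q [tuple] M)) -> S u].

Record is_kalg : Prop := IsKAlg {
  kalg_act_linear : forall c, linear (@kalg_act F c);
  kalg_act1 : forall u : F, kalg_act (Cx1 R) u = u;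
  kalg_actM : forall c d (u : F),
    kalg_act (Cx_mul c d) u = kalg_act c (kalg_act d u);
  kalg_reducible : direct_sum isotypic;
  kalg_findim : forall M, findim (isotypic M);
  kalg_nu_homogeneous : forall n (Q : Khat R n) (u : n.-tuple F) M,
    isotypic M (kalg_nu Q u M);
  kalg_nu_multilinear : forall n (Q : Khat R n),
    multilinear (fun u : n.-tuple F => kalg_nu Q u);
  kalg_nu_W : forall n (Q : Khat R n) (u : n.-tuple F),
    (forall j, kalg_W (tnth u j)) -> forall M, kalg_W (kalg_nu Q u M);
  kalg_nu_id : forall u : F, embeds isotypic (kalg_nu (Khat_id R) [tuple u]) u;
  kalg_nu_equivariant : forall n (s : 'S_n) (Q Q' : Khat R n) (u : n.-tuple F),
    represents Q' (permute s (kpts Q)) (ka Q) (permute s (ks Q)) ->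
    kalg_nu Q' (permute s u) = kalg_nu Q u;
  kalg_nu_sewing : forall m n (P : Khat R m) (i : 'I_m) (Q : Khat R n)
      (S : Khat R (m + n).-1),
    sewable P i Q -> is_sewing P i Q S ->
    forall (u : m.-tuple F) (v : n.-tuple F) (w : rdual isotypic),
    sums_absolutely
      (fun M : weight => pairing w (kalg_nu P (upd u i (kalg_nu Q v M))))
      (pairing w (kalg_nu S (splice_tuple i u v)));
  kalg_nu_rescaling : forall c (u : F),
    embeds isotypic (kalg_nu (rescaling c) [tuple u]) (kalg_act c u) }.

(* The functions g of a and (a_1, .., a_n) that are polynomial in a and \bar a  *)
(* and linear combinations of \prod_j a_j ^ (r_j) * \bar a_j ^ (t_j) with real  *)
(* exponents.                                                                   *)
Definition elementary n (g : C -> n.-tuple C -> C) : Prop :=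
  exists (L : nat) (c : 'I_L -> C) (alpha beta : 'I_L -> nat)
         (r t : 'I_L -> 'I_n -> R),
  forall a (s : n.-tuple C), 0 \notin s ->
    g a s = \sum_(l < L) c l * a ^+ alpha l * conjc a ^+ beta l *
      \prod_(j < n) (cpow (tnth s j) (r l j)%:C%C *
                     cpowbar (tnth s j) (t l j)%:C%C).

Record is_smooth_kalg : Prop := IsSmoothKAlg {
  skalg_lower : exists N : R, forall M : weight,
    Re (val M).1 < N \/ Re (val M).2 < N -> forall u, isotypic M u -> u = 0;
  skalg_smooth : forall n (u : n.-tuple F) (w : rdual isotypic),
    exists (L : nat) (g : 'I_L -> C -> n.-tuple C -> C)
           (h : 'I_L -> n.-1.-tuple C -> C),
    [/\ forall l, elementary (g l),
        forall l, smooth_on [set z : n.-1.-tuple C | uniq (rcons z 0)] (h l)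
      & forall Q : Khat R n,
        pairing w (kalg_nu Q u) = \sum_(l < L) g l (ka Q) (ks Q) * h l (kz Q)] }.

End Defs.

Record skalg := SKAlg {
  skalg_dat :> kalg_data;
  skalg_axioms : is_kalg skalg_dat;
  skalg_smooth_axioms : is_smooth_kalg skalg_dat }.

Record is_skalg_morphism (F1 F2 : skalg) (f : F1 -> F2) : Prop :=
  IsSKAlgMorphism {
  skalgm_linear : linear f;
  skalgm_act : forall c u, f (kalg_act c u) = kalg_act c (f u);
  skalgm_nu : forall n (Q : Khat R n) (u : n.-tuple F1) M,
    f (kalg_nu Q u M) = kalg_nu Q (map_tuple f u) M }.

Definition skalg_hom (F1 F2 : skalg) := {f : F1 -> F2 | is_skalg_morphism f}.

Lemma skalg_id_proof (F : skalg) : is_skalg_morphism (fun u : F => u).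
Proof.
split=> //; move=> n Q u M; congr (kalg_nu Q _ M).
by apply: val_inj; rewrite /= map_id.
Qed.

Definition skalg_id (F : skalg) : skalg_hom F F := exist _ _ (skalg_id_proof F).

Lemma skalg_comp_proof (F1 F2 F3 : skalg) (g : skalg_hom F2 F3)
    (f : skalg_hom F1 F2) :
  is_skalg_morphism (fun u => proj1_sig g (proj1_sig f u)).
Proof.
case: f g => f [f1 f2 f3] [g [g1 g2 g3]] /=; split=> /=.
- by move=> a u v; rewrite f1 g1.
- by move=> c u; rewrite f2 g2.
- move=> n Q u M; rewrite f3 g3; congr (kalg_nu Q _ M).
  by apply: val_inj; rewrite /= -map_comp.
Qed.

Definition skalg_comp (F1 F2 F3 : skalg) (g : skalg_hom F2 F3)
    (f : skalg_hom F1 F2) : skalg_hom F1 F3 := exist _ _ (skalg_comp_proof g f).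

Lemma skalg_hom_eq (F1 F2 : skalg) (f g : skalg_hom F1 F2) :
  proj1_sig f = proj1_sig g -> f = g.
Proof. by case: f g => [f pf] [g pg] /= fg; exact: eq_exist. Qed.

Definition skalg_category : category.
Proof.
refine (@Category skalg skalg_hom skalg_id skalg_comp _ _ _).
- by move=> A B f; exact: skalg_hom_eq.
- by move=> A B f; exact: skalg_hom_eq.
- by move=> A B D E h g f; exact: skalg_hom_eq.
Defined.

End SmoothKhatAlgebras.

(* Main.v *)
(* Both structures are equivalent to one and the same core: a grading together with correlators
   m_n that satisfy the identity, convergence and permutation axioms, are covariant under the
   rescaling c . m_n(u; z) = m_n(c . u; z / c), and for which m_1(u; z) is a polynomial in z
   and \bar z whose components lie in degrees (p + i, q + j) for u of degree (p, q).

   For a full field algebra, the brackets with d^L and d^R are Euler's equations; integrated,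
   they give the covariance of m_2, hence of m_1.  For n >= 3 one translates the points until
   one of them is strictly farther from 0 than the others and expands m_n as m_2 with m_(n-1)
   inserted.  Since D^L multiplies the homogeneous function m_1(u; z) by (exponent / z),
   continuity at 0 forces the exponents to be natural numbers.  Conversely D^L and D^R are
   the first-order coefficients of m_1, and the axioms about them come from the first-order
   terms of convergent expansions.

   The Khat-algebra of a core is nu(z; a; a_i)(u) = m_n(a_1 . u_1, .., a_n . u_n; z - a).
   It is polynomial in a because translating all the points amounts to applying m_1.
   Conversely m_n(u; z) = nu(z; 0; 1)(u).  Smoothness makes positive dilations act by linear
   combinations of real powers, which forces the weights to be real, and polynomiality in a
   gives the polynomiality of m_1. *)

From HB Require Import structures.
From mathcomp Require Import all_boot all_order all_algebra all_fingroup.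
From mathcomp Require Import finmap.
From mathcomp Require Import all_classical all_reals all_analysis.
From mathcomp Require Import complex zify ring lra.
Require Import Defs.

Set Implicit Arguments.
Unset Strict Implicit.
Unset Printing Implicit Defensive.

Import Order.TTheory GRing.Theory Num.Theory.
Import numFieldNormedType.Exports.
Import Normc.

Local Notation Re := complex.Re.
Local Notation Im := complex.Im.

Local Open Scope classical_set_scope.
Local Open Scope ring_scope.

(** * Complex exponentials and characters of the multiplicative group *)

Section ComplexPowers.
Variable R : realType.
Local Notation C := R[i].

(** Isomorphism of categories, unlike equivalence, asks for equalities of records: neither
    construction may change the carrier, and each round trip must return every field. Hence the
    operators are shown to be determined by the other data, d^L and d^R by the grading, D^L and D^R
    by m_1 at the point 1. The two gradings have different index sets: a real pair with non-integral
    difference is not a weight, and a weight need not be real. Both excess parts turn out to carry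
    the zero space, so a partial bijection of indices transports components, restricted duals and
    sums. Integrality of p - q also makes the rescaling action multiplicative: with a fixed branch
    of the logarithm, a general power is not a homomorphism. Correlators are accessible only through
    absolutely convergent expansions, so an identity between them is proved by expanding both sides
    into equal terms. Finiteness in the smoothness axiom is exploited along the powers of one
    rescaling: both sides become finite sums of geometric progressions, and an annihilating
    polynomial of the right side finds the ratio of the left side among those of the right. *)

Lemma normc_ge0 (x : C) : 0 <= normc x.
Proof. by case: x => a b; exact: sqrtr_ge0. Qed.

Lemma normc_eq0 (x : C) : (normc x == 0) = (x == 0).
Proof. by apply/eqP/eqP => [/eq0_normc|->] //; exact: normc0. Qed.

Lemma normc_gt0 (x : C) : (0 < normc x) = (x != 0).
Proof. by rewrite lt_neqAle normc_ge0 andbT eq_sym normc_eq0. Qed.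

Lemma normcM' (x y : C) : normc (x * y) = normc x * normc y.
Proof. exact: normcM. Qed.

Lemma normcD_le (x y : C) : normc (x + y) <= normc x + normc y.
Proof. exact: le_normcD. Qed.

Lemma normcN' (x : C) : normc (- x) = normc x.
Proof. exact: normcN. Qed.

Lemma normcB (x y : C) : normc (x - y) = normc (y - x).
Proof. by rewrite -normcN' opprB. Qed.

Lemma normcJ' (x : C) : normc (conjc x) = normc x.
Proof. by case: x => a b /=; rewrite sqrrN. Qed.

Lemma normcR (x : R) : normc x%:C%C = `|x|.
Proof. by rewrite /= expr0n addr0 sqrtr_sqr. Qed.

Lemma normc0' : normc (0 : C) = 0.
Proof. by apply/eqP; rewrite normc_eq0. Qed.

Lemma normc1' : normc (1 : C) = 1.
Proof. exact: normc1. Qed.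

Lemma normcX (x : C) k : normc (x ^+ k) = normc x ^+ k.
Proof. by elim: k => [|k IH]; rewrite ?expr0 ?normc1' // !exprS normcM' IH. Qed.

Lemma normcV' (x : C) : normc x^-1 = (normc x)^-1.
Proof. exact: normcV. Qed.

Lemma normc_sum (I : Type) (r : seq I) (P : pred I) (f : I -> C) :
  normc (\sum_(i <- r | P i) f i) <= \sum_(i <- r | P i) normc (f i).
Proof.
elim/big_ind2: _ => [|x1 x2 y1 y2 h1 h2|//]; first by rewrite normc0'.
by rewrite (le_trans (normcD_le _ _)) // lerD.
Qed.

Lemma normc_Re (x : C) : `|Re x| <= normc x.
Proof. by case: x => a b /=; rewrite -sqrtr_sqr ler_wsqrtr // lerDl sqr_ge0. Qed.

Lemma normc_Im (x : C) : `|Im x| <= normc x.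
Proof. by case: x => a b /=; rewrite -sqrtr_sqr ler_wsqrtr // lerDr sqr_ge0. Qed.

Lemma normc_le_ReIm (x : C) : normc x <= `|Re x| + `|Im x|.
Proof.
have -> : x = (Re x)%:C%C + 'i%C * (Im x)%:C%C by case: x => a b; simpc.
rewrite (le_trans (normcD_le _ _)) // normcM' !normcR.
have -> : normc ('i%C : C) = 1 by rewrite /= expr0n add0r expr1n sqrtr1.
by rewrite mul1r; case: x => a b /=; rewrite !(mul0r,mul1r,mulr0,addr0,add0r,subr0).
Qed.

Lemma ltcE_normc (x y : C) : (`|x| < `|y|) = (normc x < normc y).
Proof. by rewrite ltcR. Qed.

Lemma cexpD (x y : C) : cexp (x + y) = cexp x * cexp y.
Proof.
case: x y => [a b] [c d]; rewrite /cexp /= expRD cosD sinD.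
by simpc; congr (_ +i* _)%C; ring.
Qed.

Lemma cexp0 : cexp (0 : C) = 1.
Proof. by rewrite /cexp /= expR0 cos0 sin0; simpc. Qed.

Lemma cexp_neq0 (x : C) : cexp x != 0.
Proof.
apply/eqP => h; have := cexp0.
by rewrite -(subrr x) cexpD h mul0r => /eqP; rewrite eq_sym oner_eq0.
Qed.

Lemma cexpN (x : C) : cexp (- x) = (cexp x)^-1.
Proof.
apply: (mulfI (cexp_neq0 x)); rewrite -cexpD subrr cexp0 divff //.
exact: cexp_neq0.
Qed.

Lemma cexp_conj (x : C) : cexp (conjc x) = conjc (cexp x).
Proof. by case: x => a b; rewrite /cexp /= cosN sinN; simpc. Qed.

Lemma normc_cexp (x : C) : normc (cexp x) = expR (Re x).
Proof.
rewrite /cexp normcM' normcR /normc cos2Dsin2 sqrtr1 mulr1.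
by rewrite ger0_norm // expR_ge0.
Qed.

Lemma cexpMn (x : C) k : cexp (k%:R * x) = cexp x ^+ k.
Proof.
elim: k => [|k IH]; first by rewrite mul0r cexp0.
by rewrite exprS -IH -cexpD -nat1r mulrDl mul1r.
Qed.

Lemma cexpMz (x : C) (k : int) : cexp (k%:~R * x) = cexp x ^ k.
Proof.
case: k => k; first by rewrite -[_%:~R]/(k%:R) cexpMn.
by rewrite NegzE mulrNz mulNr cexpN -[_%:~R]/(k.+1%:R) cexpMn.
Qed.

Lemma clogK (c : C) : c != 0 -> cexp (clog c) = c.
Proof.
move=> c0; have n0 : 0 < normc c by rewrite normc_gt0.
rewrite /cexp /clog /= lnK ?posrE //.
have h : (Re c / normc c) ^+ 2 + (Im c / normc c) ^+ 2 = 1.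
  rewrite !expr_div_n -mulrDl; apply/eqP; rewrite -subr_eq0.
  have -> : normc c ^+ 2 = Re c ^+ 2 + Im c ^+ 2.
    by case: {n0} c {c0} => a b /=; rewrite sqr_sqrtr // addr_ge0 ?sqr_ge0.
  rewrite divff ?subrr //; move: n0.
  by rewrite lt0r => /andP[+ _]; case: c {c0} => a b /=; rewrite sqrtr_eq0 -ltNge lt0r => /andP[].
have h1 : -1 <= Re c / normc c <= 1.
  rewrite -ler_norml normrM normfV (ger0_norm (ltW n0)) ler_pdivrMr // mul1r.
  exact: normc_Re.
have [hc hs] : cos (Arg c) = Re c / normc c /\ sin (Arg c) = Im c / normc c.
  have e : 1 - (Re c / normc c) ^+ 2 = (Im c / normc c) ^+ 2 by rewrite -h; ring.
  rewrite /Arg; case: ifP => hi.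
    rewrite acosK ?in_itv //= sin_acos // e sqrtr_sqr ger0_norm //.
    by rewrite divr_ge0 // ltW.
  rewrite mulr_natl addrC cosD2pi sinD2pi cosN sinN acosK ?in_itv //= sin_acos //.
  rewrite e sqrtr_sqr ler0_norm ?opprK //.
  by rewrite mulr_le0_ge0 ?invr_ge0 ?normc_ge0 // leNgt; apply/negP => /ltW; rewrite hi.
rewrite hc hs; simpc.
by rewrite ![normc c * _]mulrC !divfK ?lt0r_neq0 //; case: (c).
Qed.

Lemma cexp_real (x : R) : cexp x%:C%C = (expR x)%:C%C.
Proof. by rewrite /cexp /= cos0 sin0; simpc. Qed.

(* The character by which c acts on the weights (-m, -n). *)
Definition chi (m n c : C) : C := cpow c m * cpowbar c n.

Lemma chiD (m n m' n' c : C) : chi (m + m') (n + n') c = chi m n c * chi m' n' c.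
Proof.
rewrite /chi /cpow /cpowbar -!cexpD; congr cexp; ring.
Qed.

Lemma chi0 (c : C) : chi 0 0 c = 1.
Proof. by rewrite /chi /cpow /cpowbar -!cexpD !mul0r addr0 cexp0. Qed.

Lemma chi_neq0 (m n c : C) : chi m n c != 0.
Proof. by rewrite mulf_neq0 // cexp_neq0. Qed.

Lemma chiN (m n c : C) : chi (- m) (- n) c = (chi m n c)^-1.
Proof.
apply: (mulfI (chi_neq0 m n c)).
by rewrite -chiD !subrr chi0 divff // chi_neq0.
Qed.

(* For m - n an integer the branch of the logarithm is immaterial. *)
Lemma chiE (m n c : C) (k : int) : c != 0 -> m - n = k%:~R ->
  chi m n c = cexp (n * (2 * ln (normc c))%:C%C) * c ^ k.
Proof.
move=> c0 mn; rewrite /chi /cpow /cpowbar -cexpD.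
rewrite -{4}(clogK c0) -cexpMz -mn -cexpD; congr cexp.
have -> : (2 * ln (normc c))%:C%C = clog c + conjc (clog c).
  by rewrite /clog; simpc; rewrite mulr_natl mulr2n.
ring.
Qed.

(** Any logarithm [t] may be used, not only the principal one: a change of [t] by 2 pi i l changes
    the exponent by 2 pi i l (m - n). Multiplicativity of [chi] is then that of [cexp]. *)
Lemma chi_cexp (m n t : C) (k : int) : m - n = k%:~R ->
  chi m n (cexp t) = cexp (m * t + n * conjc t).
Proof.
move=> mn; rewrite (chiE (cexp_neq0 t) mn) normc_cexp expRK -cexpMz -mn -cexpD.
congr cexp; have -> : (2 * Re t)%:C%C = t + conjc t.
  by case: t => a b; simpc; rewrite mulr_natl mulr2n.
ring.
Qed.

Lemma chiM (m n c d : C) (k : int) : c != 0 -> d != 0 -> m - n = k%:~R ->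
  chi m n (c * d) = chi m n c * chi m n d.
Proof.
move=> c0 d0 mn; rewrite -{1}(clogK c0) -{1}(clogK d0) -cexpD (chi_cexp _ mn).
rewrite -{3}(clogK c0) -{3}(clogK d0) !(chi_cexp _ mn) -cexpD rmorphD /=.
by congr cexp; ring.
Qed.

Lemma chi1 (m n : C) : chi m n 1 = 1.
Proof.
have -> : 1 = (1%:C : C)%C by [].
rewrite /chi /cpow /cpowbar -cexpD.
have -> : clog (1%:C : C)%C = 0.
  by rewrite /clog normcR normr1 ln1 /Arg /= lexx expr1n expr0n addr0 sqrtr1 divr1 acos1.
by rewrite rmorph0 !mulr0 addr0 cexp0.
Qed.

Lemma chiV (m n c : C) (k : int) : c != 0 -> m - n = k%:~R ->
  chi m n c^-1 = (chi m n c)^-1.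
Proof.
move=> c0 mn; apply: (mulfI (chi_neq0 m n c)).
by rewrite -(chiM _ _ mn) ?invr_neq0 // !divff ?chi1 // chi_neq0.
Qed.

Lemma chi_nat (i j : nat) (c : C) : c != 0 ->
  chi i%:R j%:R c = c ^+ i * conjc c ^+ j.
Proof.
by move=> c0; rewrite /chi /cpow /cpowbar !cexpMn cexp_conj clogK.
Qed.

(** The modulus at [t = 1] makes [l] imaginary; for [l = i b] with [b] nonzero, [t = pi / b] would
    give -1. *)
Lemma cexp_line_trivial (l : C) : (forall t : R, cexp (l * t%:C%C) = 1) -> l = 0.
Proof.
case: l => a b h.
have /eqP : a = 0.
  have := congr1 (@normc R) (h 1); rewrite normc_cexp normc1'; simpc.
  by rewrite -[X in _ = X]expR0 => /expR_inj.
move=> /eqP a0; subst a; congr (_ +i* _)%C; apply/eqP; apply: contraT => b0.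
have := h (pi / b); rewrite /cexp; simpc.
rewrite /= [b * _]mulrC divfK // cospi expR0.
by move=> [e _]; exfalso; move: e; lra.
Qed.

(** At [c = cexp t], real [t] sees only m + n and imaginary [t] only m - n. *)
Lemma chi_inj (m n m' n' : C) (k k' : int) : m - n = k%:~R -> m' - n' = k'%:~R ->
  (forall c, c != 0 -> chi m n c = chi m' n' c) -> (m, n) = (m', n').
Proof.
move=> mn mn' h.
have key t : cexp ((m - m') * t + (n - n') * conjc t) = 1.
  have := h (cexp t) (cexp_neq0 _); rewrite (chi_cexp _ mn) (chi_cexp _ mn').
  move=> e; have -> : (m - m') * t + (n - n') * conjc t = (m * t + n * conjc t) - (m' * t + n' *
    conjc t) by ring.
  by rewrite cexpD cexpN e divff // cexp_neq0.
have h1 : (m - m') + (n - n') = 0.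
  apply: cexp_line_trivial => t; rewrite mulrDl -[RHS](key t%:C%C); congr cexp.
  by rewrite conjc_real.
have h2 : ((m - m') - (n - n')) * 'i%C = 0.
  apply: cexp_line_trivial => t; rewrite -[RHS](key ('i%C * t%:C%C)); congr cexp.
  have -> : conjc ('i%C * t%:C%C) = - ('i%C * t%:C%C) :> C.
    by simpc.
  ring.
have i0 : ('i%C : C) != 0 by rewrite eq_complex /= oner_eq0 andbF.
move: h2 => /eqP; rewrite mulf_eq0 (negPf i0) orbF => /eqP h2.
have e : m = m'.
  apply/eqP; rewrite -subr_eq0.
  have : (m - m') * 2 = 0 by rewrite -[RHS]addr0 -{1}h1 -h2; ring.
  by move=> /eqP; rewrite mulf_eq0 pnatr_eq0 orbF.
by subst m'; congr pair; move: h1; rewrite subrr add0r => /eqP; rewrite subr_eq0 => /eqP.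
Qed.

(* Evaluate the polynomial with roots mu_l along k |-> nu ^ k. *)
Lemma power_sum_root (L : nat) (a : C) (c : 'I_L -> C) (nu : C) (mu : 'I_L -> C) :
  a != 0 -> (forall k : nat, a * nu ^+ k = \sum_l c l * mu l ^+ k) ->
  exists l, nu = mu l.
Proof.
move=> a0 h; pose P := \prod_(l < L) ('X - (mu l)%:P).
have hP : a * P.[nu] = \sum_l c l * P.[mu l].
  rewrite horner_coef mulr_sumr.
  under eq_bigr => i _ do rewrite mulrCA h mulr_sumr.
  rewrite exchange_big /=; apply: eq_bigr => l _; rewrite horner_coef mulr_sumr.
  by apply: eq_bigr => i _; ring.
have : P.[nu] == 0.
  rewrite -(mulrI_eq0 _ (lregP a0)) hP big1 // => l _.
  by rewrite horner_prod (bigD1 l) //= hornerXsubC subrr mul0r mulr0.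
rewrite horner_prod => /prodf_eq0 [l _]; rewrite hornerXsubC subr_eq0 => /eqP ->.
by exists l.
Qed.

(** Positive values leave no rotation: for [b = Im l] nonzero, [t = pi / b] would give a negative
    value. *)
Lemma cexp_ge0_real (l : C) : (forall t : R, exists x : R, 0 < x /\ cexp (l * t%:C%C) = x%:C%C) ->
  Im l = 0.
Proof.
case: l => a b h /=; apply/eqP; apply: contraT => b0.
have [x [x0]] := h (pi / b); rewrite /cexp; simpc.
rewrite /= [b * _]mulrC divfK // cospi mulrN1.
move=> [e _]; move: x0; rewrite -e oppr_gt0 ltNge; apply: contraR => _.
exact: expR_ge0.
Qed.

End ComplexPowers.

(** * Absolutely convergent sums *)

Section AbsoluteSums.
Variable R : realType.
Local Notation C := R[i].

Lemma summable_normcP (I : choiceType) (f : I -> C) :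
  summable [set: I] (fun i => (normc (f i))%:E) <->
  exists B : R, forall A : {fset I}, \sum_(i <- A) normc (f i) <= B.
Proof.
have e A : finite_set A ->
   (\sum_(i \in A) `|(normc (f i))%:E| = (\sum_(i <- fset_set A) normc (f i))%:E)%E.
  move=> fA; rewrite fsbig_finite //= -sumEFin; apply: eq_bigr => i _.
  by rewrite ger0_norm // normc_ge0.
split=> [|[B hB]].
  rewrite summableE => /fineK h; exists (fine (\esum_(x in [set: I]) `|(normc (f x))%:E|)%E).
  move=> A; rewrite -lee_fin h; apply: esum_ge; exists [set` A] => //.
  by rewrite e ?finite_fset // set_fsetK.
rewrite /summable (@le_lt_trans _ _ B%:E) ?ltry //.
apply: ge_ereal_sup => _ [A [fA _] <-]; rewrite e // lee_fin; exact: hB.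
Qed.

Lemma sums_unique (I : choiceType) (f : I -> C) s s' :
  sums_absolutely f s -> sums_absolutely f s' -> s = s'.
Proof.
move=> [_ h] [_ h']; apply/eqP; rewrite -subr_eq0 -normc_eq0; apply: contraT => n0.
have e0 : 0 < normc (s - s') / 2 by rewrite divr_gt0 // lt0r n0 normc_ge0.
have [A hA] := h _ e0; have [A' hA'] := h' _ e0.
have := normcD_le (s - \sum_(i <- (A `|` A')%fset) f i) (\sum_(i <- (A `|` A')%fset) f i - s').
rewrite addrA subrK normcB => hh.
have := hA (A `|` A')%fset (fsubsetUl _ _); have := hA' (A `|` A')%fset (fsubsetUr _ _).
move: hh; rewrite normcB; lra.
Qed.

Lemma eq_sums (I : choiceType) (f g : I -> C) s :
  f =1 g -> sums_absolutely f s -> sums_absolutely g s.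
Proof. by move=> /funext ->. Qed.

Lemma sum_fset_sub (I : choiceType) (V : nmodType) (f : I -> V) (A B : {fset I}) :
  (A `<=` B)%fset -> (forall i, i \in B -> i \notin A -> f i = 0) ->
  \sum_(i <- B) f i = \sum_(i <- A) f i.
Proof.
move=> AB h; rewrite (big_fsetID _ (mem A)) /= [X in _ + X]big1_seq ?addr0.
  congr (bigop _ _ _); congr (enum_fset _); apply/fsetP => i; rewrite !inE /=.
  by apply/andP/idP => [[]|iA] //; split=> //; exact: (fsubsetP AB).
by move=> i /=; rewrite !inE /= => /andP[iB iA]; exact: h.
Qed.

Lemma sums_finite (I : choiceType) (f : I -> C) (A : {fset I}) :
  (forall i, i \notin A -> f i = 0) -> sums_absolutely f (\sum_(i <- A) f i).
Proof.
move=> h; split.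
  apply/summable_normcP; exists (\sum_(i <- A) normc (f i)) => B.
  rewrite -(@sum_fset_sub _ _ _ A (A `|` B)%fset) ?fsubsetUl //; last first.
    by move=> i _ /h ->; rewrite normc0'.
  apply: (@le_trans _ _ (\sum_(i <- (A `|` B)%fset | i \in B) normc (f i))).
    rewrite -[X in _ <= X]big_filter le_eqVlt; apply/orP; left; apply/eqP.
    apply: perm_big; apply: uniq_perm; rewrite ?filter_uniq ?fset_uniq // => i.
    by rewrite mem_filter inE; case: (i \in B); rewrite ?orbT.
  rewrite [X in _ <= X](bigID (fun i => i \in B)) /= lerDl.
  by apply: sumr_ge0 => i _; exact: normc_ge0.
move=> e e0; exists A => B AB.
rewrite (sum_fset_sub AB) ?subrr ?normc0' // => i _; exact: h.
Qed.

Lemma sums_finite_eq (I : choiceType) (f : I -> C) (A : {fset I}) s :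
  (forall i, i \notin A -> f i = 0) -> sums_absolutely f s -> s = \sum_(i <- A) f i.
Proof. by move=> h hs; apply: sums_unique hs _; exact: sums_finite. Qed.

Lemma sums_scale (I : choiceType) (f : I -> C) s a :
  sums_absolutely f s -> sums_absolutely (fun i => a * f i) (a * s).
Proof.
move=> [/summable_normcP [B hB] h]; split.
  apply/summable_normcP; exists (normc a * B) => A.
  under eq_bigr do rewrite normcM'.
  by rewrite -mulr_sumr ler_wpM2l ?normc_ge0.
move=> e e0; have a1 : 0 < normc a + 1 by rewrite ltr_wpDl // normc_ge0.
have [A hA] := h _ (divr_gt0 e0 a1); exists A => A' /hA.
rewrite -mulr_sumr -mulrBr normcM' ltr_pdivlMr // => hh.
by apply: le_lt_trans hh; rewrite mulrC ler_wpM2l ?normc_ge0 // lerDl.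
Qed.

(** An index without partner contributes 0, so only the matched indices survive in [A']. *)
Lemma sum_pbij (I J : choiceType) (a : J -> option I) (b : I -> option J)
    (V : nmodType) (g : I -> V) (A : {fset J}) :
  (forall j i, a j = Some i <-> b i = Some j) ->
  exists A' : {fset I}, \sum_(j <- A) oapp g 0 (a j) = \sum_(i <- A') g i /\
    forall i, i \in A' <-> exists2 j, j \in A & a j = Some i.
Proof.
move=> ab; exists (seq_fset tt (pmap a A)); split; last first.
  move=> i; rewrite seq_fsetE mem_pmap; split=> [/mapP[j jA ->]|[j jA e]]; first by exists j.
  by apply/mapP; exists j.
have u : uniq (pmap a A).
  elim: (enum_fset A) (fset_uniq A) => //= j l IH /andP[jl /IH ul].
  case E : (a j) => [i|] //=; rewrite ul andbT; apply: contra jl.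
  rewrite mem_pmap => /mapP[j' j'l e']; suff -> : j = j' by [].
  by move/ab: E => E; move/esym/ab: e'; rewrite E => -[].
rewrite (perm_big _ (seq_fset_perm _ _)) (undup_id u).
elim: (enum_fset A) => [|j l IH]; first by rewrite !big_nil.
by rewrite big_cons /= IH; case: (a j) => [i|]; rewrite /= ?big_cons ?add0r.
Qed.

Lemma sums_pbij (I J : choiceType) (a : J -> option I) (b : I -> option J)
    (f : I -> C) s :
  (forall j i, a j = Some i <-> b i = Some j) -> (forall i, b i = None -> f i = 0) ->
  sums_absolutely f s -> sums_absolutely (fun j => oapp f 0 (a j)) s.
Proof.
move=> ab f0 [/summable_normcP [B hB] h].
have push (V : nmodType) (g : I -> V) (A : {fset J}) := @sum_pbij _ _ _ _ V g A ab.
split.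
  apply/summable_normcP; exists B => A; have [A' [e _]] := push _ (fun i => normc (f i)) A.
  apply: le_trans (hB A'); rewrite -e le_eqVlt; apply/orP; left; apply/eqP.
  by apply: eq_bigr => j _; case: (a j) => [i|]; [by []|exact: normc0'].
move=> e e0; have [A hA] := h _ e0; exists (seq_fset tt (pmap b A)) => D AD.
have [A' [-> hA']] := push _ f D.
rewrite -(@sum_fset_sub _ _ _ A' (A `|` A')%fset) ?fsubsetUr //.
  by apply: hA; exact: fsubsetUl.
move=> i; rewrite inE; case: (boolP (i \in A')) => // + /orP[] // iA.
case E : (b i) => [j|] => [iA'|_ _]; last by rewrite f0.
case/negP: iA'; apply/hA'; exists j; last exact/ab.
by apply: (fsubsetP AD); rewrite seq_fsetE mem_pmap; apply/mapP; exists i.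
Qed.
End AbsoluteSums.

(** * Graded spaces and their restricted duals *)

Section GradedSpaces.
Variables (K : fieldType) (V : lmodType K) (I : choiceType) (G : I -> set V).

(** Total in [G], with default 0: data built from it, such as [act] or [gradeL], can be formed
    before the grading is known to be a direct sum. *)
Definition component (u : V) : I -> V :=
  if pselect (exists x, embeds G x u) is left e then projT1 (cid e) else fun=> 0.

Definition gmap (T : I -> V -> V) (u : V) : V :=
  \sum_(i \in [set: I]) T i (component u i).

Lemma linear0 (W : lmodType K) (T : V -> W) : linear T -> T 0 = 0.
Proof. by move=> lT; have := lT (-1) 0 0; rewrite !scaleN1r oppr0 addr0 addNr. Qed.

Lemma linear_scal (W : lmodType K) (T : V -> W) a u : linear T -> T (a *: u) = a *: T u.
Proof. by move=> lT; rewrite -[a *: u]addr0 lT linear0 // addr0. Qed.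

Lemma subspace_sum (S : set V) (J : Type) (r : seq J) (x : J -> V) :
  subspace S -> (forall j, S (x j)) -> S (\sum_(j <- r) x j).
Proof.
move=> [S0 Sl] h; elim: r => [|j r IH]; first by rewrite big_nil.
by rewrite big_cons -[x j]scale1r; exact: Sl.
Qed.

Lemma subspace_scal (S : set V) a u : subspace S -> S u -> S (a *: u).
Proof. by move=> [S0 Sl] Su; rewrite -[a *: u]addr0; exact: Sl. Qed.

Lemma subspace_sub (S : set V) u v : subspace S -> S u -> S v -> S (u - v).
Proof. by move=> [S0 Sl] Su Sv; rewrite addrC -scaleN1r; exact: Sl. Qed.

Lemma embeds_linear a x y u v : (forall i, subspace (G i)) ->
  embeds G x u -> embeds G y v -> embeds G (fun i => a *: x i + y i) (a *: u + v).
Proof.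
move=> sG [hx [s [sx ->]]] [hy [t [ty ->]]]; split=> [i|].
  by have [_] := sG i; apply.
exists (s `|` t)%fset; split=> [i|].
  by rewrite inE negb_or => /andP[/sx -> /ty ->]; rewrite scaler0 addr0.
rewrite big_split /= -scaler_sumr; congr (_ *: _ + _).
  by rewrite (sum_fset_sub (fsubsetUl s t)) // => i _; exact: sx.
by rewrite (sum_fset_sub (fsubsetUr s t)) // => i _; exact: ty.
Qed.

Lemma embeds_homog i u : (forall j, subspace (G j)) -> G i u ->
  embeds G (fun j => if j == i then u else 0) u.
Proof.
move=> sG Gu; split=> [j|]; first by case: eqP => [->|_] //; have [] := sG j.
exists [fset i]%fset; split=> [j|]; first by rewrite inE => /negPf ->.
by rewrite big_seq_fset1 eqxx.
Qed.

Hypothesis dG : direct_sum G.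

Let sG i : subspace (G i). Proof. by have [] := dG. Qed.

Lemma homog0 i : G i 0. Proof. by have [] := sG i. Qed.

Lemma embeds_component u : embeds G (component u) u.
Proof.
rewrite /component; case: pselect => [e|[]]; first by case: cid.
by have [_ /(_ u) [x [hx _]]] := dG; exists x.
Qed.

Lemma embeds_unique x y u : embeds G x u -> embeds G y u -> x = y.
Proof. by move=> hx hy; have [_ /(_ u) [z [_ hz]]] := dG; rewrite -(hz _ hx) -(hz _ hy). Qed.

Lemma component_eq x u : embeds G x u -> component u = x.
Proof. by move=> h; exact: embeds_unique (embeds_component u) h. Qed.

Lemma component_in u i : G i (component u i).
Proof. by have [+ _] := embeds_component u. Qed.

Lemma component_linear a u v i :
  component (a *: u + v) i = a *: component u i + component v i.
Proof.
by rewrite (component_eq (embeds_linear a sG (embeds_component u) (embeds_component v))).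
Qed.

Lemma component_scal a u i : component (a *: u) i = a *: component u i.
Proof.
have z : component 0 i = 0.
  rewrite (component_eq (embeds_homog sG (homog0 i))).
  by rewrite eqxx.
by rewrite -[a *: u]addr0 component_linear z addr0.
Qed.

Lemma component_homog i u j : G i u -> component u j = if j == i then u else 0.
Proof. by move=> h; rewrite (component_eq (embeds_homog sG h)). Qed.

Lemma component_supp u : exists s : {fset I},
  (forall i, i \notin s -> component u i = 0) /\ u = \sum_(i <- s) component u i.
Proof. by have [_] := embeds_component u. Qed.

Lemma component_inj u v : component u = component v -> u = v.
Proof.
have [s [hs es]] := component_supp u; have [t [ht et]] := component_supp v => e.
rewrite es et -(sum_fset_sub (fsubsetUl s t)); last by move=> i _; exact: hs.
by rewrite -(sum_fset_sub (fsubsetUr s t)) ?e // => i _; exact: ht.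
Qed.

Lemma gmapE (T : I -> V -> V) u (s : {fset I}) : (forall i, T i 0 = 0) ->
  (forall i, i \notin s -> component u i = 0) ->
  gmap T u = \sum_(i <- s) T i (component u i).
Proof. by move=> T0 h; rewrite /gmap (fsbigTE s) // => i /h ->. Qed.

Lemma gmap_linear (T : I -> V -> V) : (forall i, linear (T i)) -> linear (gmap T).
Proof.
move=> lT a u v; have T0 i : T i 0 = 0 by exact: linear0.
have [s [hs _]] := component_supp u; have [t [ht _]] := component_supp v.
rewrite (@gmapE _ _ (s `|` t)%fset) //; last first.
  by move=> i; rewrite inE negb_or component_linear => /andP[/hs -> /ht ->]; rewrite scaler0 addr0.
rewrite (@gmapE _ u (s `|` t)%fset) //; last by move=> i; rewrite inE negb_or => /andP[/hs].
rewrite (@gmapE _ v (s `|` t)%fset) //; last by move=> i; rewrite inE negb_or => /andP[_ /ht].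
rewrite scaler_sumr -big_split /=; apply: eq_bigr => i _.
by rewrite component_linear lT.
Qed.

Lemma gmap_homog (T : I -> V -> V) i u : (forall i, T i 0 = 0) -> G i u -> gmap T u = T i u.
Proof.
move=> T0 h; rewrite (@gmapE _ _ [fset i]%fset) //.
  by rewrite big_seq_fset1 (component_homog i h) eqxx.
by move=> j; rewrite inE (component_homog j h) => /negPf ->.
Qed.

Lemma linear_ext (W : lmodType K) (S T : V -> W) : linear S -> linear T ->
  (forall i u, G i u -> S u = T u) -> S =1 T.
Proof.
move=> lS lT h u; have [s [_ ->]] := component_supp u.
elim: (enum_fset s) => [|i l IH].
  rewrite big_nil; have := lS (-1) 0 0; have := lT (-1) 0 0.
  by rewrite !scaleN1r oppr0 addr0 !addNr => -> ->.
rewrite big_cons -[component u i]scale1r lS lT IH; congr (_ *: _ + _).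
exact: h (component_in u i).
Qed.

Lemma gmap_unique (T : I -> V -> V) (L : V -> V) : (forall i, linear (T i)) -> linear L ->
  (forall i u, G i u -> L u = T i u) -> L =1 gmap T.
Proof.
move=> lT lL h; apply: linear_ext => //; first exact: gmap_linear.
by move=> i u Gu; rewrite (gmap_homog _ Gu) ?(h i) // => j; exact: linear0.
Qed.

Lemma component_gmap (T : I -> V -> V) u i : (forall i, linear (T i)) ->
  (forall i u, G i u -> G i (T i u)) -> component (gmap T u) i = T i (component u i).
Proof.
move=> lT hT; apply: (linear_ext (S := fun u => component (gmap T u) i)
  (T := fun u => T i (component u i))).
- by move=> a x y; rewrite (gmap_linear lT) component_linear.
- by move=> a x y; rewrite component_linear lT.
move=> j x Gx; rewrite (gmap_homog _ Gx); last by move=> k; exact: linear0.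
rewrite (component_homog _ (hT _ _ Gx)) (component_homog _ Gx).
by case: eqP => [->|_] //; rewrite linear0.
Qed.

Lemma component_ind (i0 : I) (P : V -> Prop) : (forall i u, G i u -> P u) ->
  (forall a u v, P u -> P v -> P (a *: u + v)) -> forall u, P u.
Proof.
move=> hh hl u; have [s [_ ->]] := component_supp u.
elim: (enum_fset s) => [|i r IH]; first by rewrite big_nil; exact: hh (homog0 i0).
by rewrite big_cons -[component u i]scale1r; apply: hl => //; exact: hh (component_in u i).
Qed.

(** Reduces a multilinear statement about lists to lists of homogeneous vectors. A prefix of entries
    already known to be homogeneous carries the induction. *)
Lemma homog_ind (i0 : I) (Q : seq V -> Prop) :
  (forall s, (forall u, u \in s -> exists i, G i u) -> Q s) ->
  (forall s t a x y, Q (s ++ x :: t) -> Q (s ++ y :: t) -> Q (s ++ (a *: x + y) :: t)) ->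
  forall s, Q s.
Proof.
move=> Qh Ql s; rewrite -[s]cat0s.
have : forall u, u \in [::] -> exists i, G i u by [].
elim: s [::] => [|x t IH] s hs; first by rewrite cats0; exact: Qh.
have h1 y i : G i y -> Q (s ++ y :: t).
  move=> Gy; rewrite -cat_rcons; apply: IH => u; rewrite mem_rcons inE => /orP[/eqP ->|/hs //].
  by exists i.
have [f [_ ->]] := component_supp x; elim: (enum_fset f) => [|i l IHl].
  by rewrite big_nil; apply: h1 (homog0 i0).
rewrite big_cons -[component x i]scale1r; apply: Ql => //; exact: h1 (component_in x i).
Qed.

Lemma rdual_ex (f : V -> K) (s : {fset I}) : scalar f ->
  (forall i u, i \notin s -> G i u -> f u = 0) ->
  exists w : rdual G, (forall u, w u = f u) /\ rdual_supp w = s.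
Proof.
move=> lf h; pose F : {scalar V} := HB.pack f (GRing.isLinear.Build K V K *%R f lf).
by exists (@RDual _ _ _ G F s h).
Qed.

(** The recorded support of a form is not canonical; the pairing can be computed over any finite set
    outside which the form vanishes. *)
Lemma pairing_fset (w : rdual G) x (s : {fset I}) : (forall i, G i (x i)) ->
  (forall i u, i \notin s -> G i u -> w u = 0) ->
  pairing w x = \sum_(i <- s) w (x i).
Proof.
move=> hx h; rewrite /pairing.
rewrite -(sum_fset_sub (fsubsetUl (rdual_supp w) s)); last first.
  by move=> i _ hi; exact: rdual_out hi (hx i).
by rewrite (sum_fset_sub (fsubsetUr (rdual_supp w) s)) // => i _ hi; exact: h hi (hx i).
Qed.

Lemma pairing_embeds (w : rdual G) x u : embeds G x u -> pairing w x = w u.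
Proof.
move=> [hx [s [hs ->]]]; rewrite linear_sum /pairing.
rewrite -(sum_fset_sub (fsubsetUl (rdual_supp w) s)); last first.
  by move=> i _ hi; exact: rdual_out hi (hx i).
by rewrite (sum_fset_sub (fsubsetUr (rdual_supp w) s)) // => i _ /hs ->; rewrite raddf0.
Qed.

Lemma rdual_at (f : V -> K) i : scalar f ->
  exists w : rdual G, (forall u, w u = f (component u i)) /\ rdual_supp w = [fset i]%fset.
Proof.
move=> lf; apply: rdual_ex.
  by move=> a x y; rewrite component_linear lf.
move=> j u; rewrite inE => ji Gu; rewrite (component_homog i Gu) eq_sym (negPf ji).
by have := lf (-1) 0 0; rewrite scaler0 add0r mulN1r addNr.
Qed.

Lemma pairing_at (w : rdual G) i x : rdual_supp w = [fset i]%fset -> pairing w x = w (x i).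
Proof. by rewrite /pairing => ->; rewrite big_seq_fset1. Qed.

(** [findim] only provides a spanning family. One of minimal length is free, so it has coordinate
    functions; one that does not vanish at [u] is extended by 0 to the other degrees. *)
Lemma findim_functional i u : findim (G i) -> G i u -> u != 0 ->
  exists f : V -> K, scalar f /\ f u != 0 /\ forall v, f v = f (component v i).
Proof.
move=> fd Gu u0.
pose spans n := exists b : 'I_n -> V, (forall j, G i (b j)) /\
    forall u, G i u -> exists c : 'I_n -> K, u = \sum_j c j *: b j.
have /cid [n0 hn0] : exists n, `[< spans n >].
  by have [n h] := fd; exists n; apply/asboolP; exact: h.
have ex0 : exists n, (fun n => `[< spans n >]) n by exists n0.
case: (ex_minnP ex0) => n /asboolP [b [Gb sb]] minn.
(* A relation with [c j] nonzero expresses [b j] by the others, and a shorter family would span. *)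
have free (c : 'I_n -> K) : \sum_j c j *: b j = 0 -> forall j, c j = 0.
  move=> c0 j; apply/eqP; apply: contraT => cj.
  case: n b Gb sb minn c c0 j cj => [|n] b Gb sb minn c c0 j cj; first by case: j {cj}.
  suff /minn : `[< spans n >] by rewrite ltnn.
  apply/asboolP; exists (fun k => b (lift j k)); split=> // v /sb [d ->].
  have bj : b j = - \sum_(k < n) (c j)^-1 *: (c (lift j k) *: b (lift j k)).
    rewrite -scaler_sumr; apply: (scalerI cj).
    rewrite scalerN scalerA divff // scale1r; apply/eqP; rewrite -subr_eq0 opprK.
    by rewrite -[X in _ == X]c0 (bigD1_ord j).
  exists (fun k => d (lift j k) - d j * (c j)^-1 * c (lift j k)).
  rewrite (bigD1_ord j) //= bj scalerN addrC scaler_sumr -sumrB; apply: eq_bigr => k _.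
  by rewrite scalerBl !scalerA.
have hc v : exists c : 'I_n -> K, component v i = \sum_j c j *: b j by exact: sb (component_in v i).
pose crd v := projT1 (cid (hc v)).
have crdE v : component v i = \sum_j crd v j *: b j by rewrite /crd; case: cid.
have crdU v c : component v i = \sum_j c j *: b j -> crd v =1 c.
  move=> e j; apply/eqP; rewrite -subr_eq0; apply/eqP.
  apply: (free (fun j => crd v j - c j)).
  under eq_bigr do rewrite scalerBl.
  by rewrite sumrB -crdE -e subrr.
have [j cj] : exists j, crd u j != 0.
  apply/not_existsP => h; case/eqP: u0.
  rewrite -[LHS](_ : component u i = _); last by rewrite (component_homog i Gu) eqxx.
  by rewrite crdE big1 // => j _; have /negP := h j; rewrite negbK => /eqP ->; rewrite scale0r.
exists (fun v => crd v j); split=> [a x y|].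
  rewrite (@crdU _ (fun j => a * crd x j + crd y j)) // component_linear !crdE.
  by rewrite scaler_sumr -big_split /=; apply: eq_bigr => k _; rewrite scalerDl scalerA.
split=> // v; apply: crdU; rewrite -crdE (component_homog i (component_in v i)).
by rewrite eqxx.
Qed.

Lemma homog_form i u : findim (G i) -> G i u -> u != 0 ->
  exists w : rdual G, rdual_supp w = [fset i]%fset /\ w u != 0.
Proof.
move=> fd Gu u0; have [f [lf [fu fc]]] := findim_functional fd Gu u0.
by have [w [we sw]] := rdual_at i lf; exists w; rewrite we -fc.
Qed.

(** Forms concentrated in one degree separate vectors: identities in the completion are tested by
    numbers, to which convergence and derivatives apply. *)
Lemma homog_ext i x y : findim (G i) -> G i x -> G i y ->
  (forall w : rdual G, rdual_supp w = [fset i]%fset -> w x = w y) -> x = y.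
Proof.
move=> fd Gx Gy h; apply/eqP; rewrite -subr_eq0; apply: contraT => u0.
have [f [lf [fu fc]]] := findim_functional fd (subspace_sub (sG i) Gx Gy) u0.
have [w [wE sw]] := rdual_at i lf.
have := h w sw; rewrite !wE -!fc => e.
move: fu; rewrite addrC -scaleN1r lf e mulN1r addNr eqxx.
by [].
Qed.

Lemma rdual_ext x y : (forall i, findim (G i)) -> (forall w : rdual G, w x = w y) -> x = y.
Proof.
move=> fd h; apply: component_inj; apply/funext => i.
apply: (homog_ext (fd i)); try exact: component_in.
move=> w sw; have e z : w z = w (component z i).
  by rewrite -(pairing_at _ sw) (pairing_embeds w (embeds_component z)).
by rewrite -!e.
Qed.

End GradedSpaces.

(** * Transport of a grading along a partial bijection of degrees *)

Section PartialBijection.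
Variables (K : fieldType) (V : lmodType K) (I J : choiceType).
Variables (G : I -> set V) (a : J -> option I) (b : I -> option J).
Hypothesis ab : forall j i, a j = Some i <-> b i = Some j.
Hypothesis dG : direct_sum G.
Hypothesis Gb : forall i, b i = None -> forall u, G i u -> u = 0.

(** A degree without partner receives the zero space; by [Gb] nothing is lost in the opposite
    direction. *)
Definition regrade (j : J) : set V := oapp G [set 0] (a j).

Lemma regrade_some j i : a j = Some i -> regrade j = G i.
Proof. by rewrite /regrade => ->. Qed.

Lemma regrade_none j u : a j = None -> regrade j u -> u = 0.
Proof. by rewrite /regrade => ->. Qed.

Lemma regrade_homog x : (forall i, G i (x i)) -> forall j, regrade j (oapp x 0 (a j)).
Proof. by move=> hx j; rewrite /regrade; case: (a j) => [i|] //=. Qed.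

Lemma embeds_regrade x u : embeds G x u -> embeds regrade (fun j => oapp x 0 (a j)) u.
Proof.
move=> [hx [s [hs ->]]]; split; first exact: regrade_homog.
have ba i j : b i = Some j <-> a j = Some i by split => /ab.
have [A [e hA]] := sum_pbij (fun j => oapp x 0 (a j)) s ba.
exists A; split.
  move=> j jA; case E : (a j) => [i|] //=; apply: hs; apply: contraNN jA => iS.
  by apply/hA; exists i => //; apply/ab.
rewrite -e; apply: eq_bigr => i _; case E : (b i) => [j|] /=.
  by have /ab -> := E.
exact: Gb E _ (hx i).
Qed.

Lemma regrade_findim : (forall i, findim (G i)) -> forall j, findim (regrade j).
Proof.
move=> fd j; rewrite /regrade; case: (a j) => [i|] /=; first exact: fd.
exists 0%N, (fun=> 0); split=> [[]//|u ->]; exists (fun=> 0); by rewrite big_ord0.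
Qed.

Lemma regrade_direct_sum : direct_sum regrade.
Proof.
have sG := dG.1; split.
  move=> j; rewrite /regrade; case: (a j) => [i|] //=.
  by split=> // c u v /= -> ->; rewrite scaler0 addr0.
move=> u; have h := embeds_regrade (embeds_component dG u).
exists (fun j => oapp (component G u) 0 (a j)); split=> // y hy.
have : embeds G (fun i => oapp y 0 (b i)) u.
  case: hy => hy [s [hs ->]]; split.
    move=> i; case E : (b i) => [j|] /=; last exact: homog0.
    by have := hy j; rewrite (regrade_some (i := i)) //; apply/ab.
  have [A [e hA]] := sum_pbij (fun i => oapp y 0 (b i)) s ab.
  exists A; split.
    move=> i iA; case E : (b i) => [j|] //=; apply: hs; apply: contraNN iA => jS.
    by apply/hA; exists j => //; apply/ab.
  rewrite -e; apply: eq_bigr => j _; case E : (a j) => [i|] /=.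
    by have /ab -> := E.
  exact: regrade_none E (hy j).
move=> e; rewrite (component_eq dG e); apply/funext => j.
case E : (a j) => [i|] /=; first by have /ab -> := E.
by rewrite (regrade_none E (hy.1 j)).
Qed.

(** The form is unchanged and only its support moves: in a degree without partner there is only the
    vector 0. *)
Lemma rdual_regrade (w : rdual regrade) : exists w' : rdual G, w' =1 w.
Proof.
have [A [_ hA]] := sum_pbij (fun _ : I => (0 : V)) (rdual_supp w) ab.
have [||w' [h _]] := @rdual_ex _ _ _ G w A.
- by move=> c x y; rewrite linearP.
- move=> i u iA Gu; case E : (b i) => [j|]; last by rewrite (Gb E Gu) raddf0.
  have /ab E' := E; apply: (@rdual_out _ _ _ _ w j).
    by apply: contraNN iA => jS; apply/hA; exists j.
  by rewrite (regrade_some E').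
by exists w'.
Qed.

Lemma pairing_regrade (w : rdual regrade) (w' : rdual G) x : (forall i, G i (x i)) ->
  w' =1 w -> pairing w (fun j => oapp x 0 (a j)) = pairing w' x.
Proof.
move=> hx e; have [A [_ hA]] := sum_pbij (fun _ : I => (0 : V)) (rdual_supp w) ab.
rewrite (@pairing_fset _ _ _ _ w' x A) //.
  have [A' [e' hA']] := sum_pbij (fun i => w' (x i)) (rdual_supp w) ab.
  have -> : A = A'.
    by apply/fsetP => i; apply/idP/idP; [move=> /hA/hA'|move=> /hA'/hA].
  rewrite -e' /pairing; apply: eq_bigr => j _; rewrite -e.
  by case: (a j) => [i|] //=; rewrite raddf0.
move=> i u iA Gu; case E : (b i) => [j|]; last by rewrite (Gb E Gu) raddf0.
have /ab E' := E; rewrite e; apply: (@rdual_out _ _ _ _ w j).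
  by apply: contraNN iA => jS; apply/hA; exists j.
by rewrite (regrade_some E').
Qed.

End PartialBijection.

(** * Wirtinger derivatives *)

Section Wirtinger.
Variable R : realType.
Local Notation C := R[i].

(** The point 0 is not excluded, so this is continuity at 0 with value [l]; [lim0_off] reads that
    value off the punctured plane. *)
Definition lim0 (f : C -> C) (l : C) : Prop := forall e : R, 0 < e ->
  exists2 d : R, 0 < d & forall t, normc t < d -> normc (f t - l) < e.

Lemma lim0_cst l : lim0 (fun=> l) l.
Proof. by move=> e e0; exists 1 => // t _; rewrite subrr normc0'. Qed.

Lemma lim0_id : lim0 id 0.
Proof. by move=> e e0; exists e => // t; rewrite subr0. Qed.

Lemma lim0_conj f l : lim0 f l -> lim0 (fun t => conjc (f t)) (conjc l).
Proof.
move=> h e /h [d d0 hd]; exists d => // t /hd.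
by rewrite -rmorphB /= normcJ'.
Qed.

Lemma lim0D f g l m : lim0 f l -> lim0 g m -> lim0 (fun t => f t + g t) (l + m).
Proof.
move=> hf hg e e0; have e2 : 0 < e / 2 by rewrite divr_gt0.
have [d d0 hd] := hf _ e2; have [d' d'0 hd'] := hg _ e2.
exists (Num.min d d') => [|t]; first by rewrite lt_min d0.
rewrite lt_min => /andP[/hd h1 /hd' h2].
have -> : f t + g t - (l + m) = (f t - l) + (g t - m) by ring.
apply: le_lt_trans (normcD_le _ _) _; lra.
Qed.

Lemma lim0M f g l m : lim0 f l -> lim0 g m -> lim0 (fun t => f t * g t) (l * m).
Proof.
move=> hf hg e e0.
pose B := normc l + normc m + 1; have B0 : 1 <= B.
  by rewrite /B -[leLHS]add0r lerD // addr_ge0 ?normc_ge0.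
have B1 : 0 < B by apply: lt_le_trans B0.
(* With both errors below [e' <= 1], the three terms add up to at most [e' * (1 + normc l + normc m)
   = e' * B <= e / 2]. *)
pose e' := Num.min 1 (e / (2 * B)).
have e'0 : 0 < e' by rewrite lt_min ltr01 divr_gt0 // mulr_gt0.
have [d d0 hd] := hf _ e'0; have [d' d'0 hd'] := hg _ e'0.
exists (Num.min d d') => [|t]; first by rewrite lt_min d0.
rewrite lt_min => /andP[/hd h1 /hd' h2].
have -> : f t * g t - l * m = (f t - l) * (g t - m) + ((f t - l) * m + l * (g t - m)) by ring.
have h3 : normc (f t - l) < 1 by apply: lt_le_trans h1 _; rewrite ge_min lexx.
have h4 : e' * B * 2 <= e.
  rewrite -mulrA -ler_pdivlMr ?mulr_gt0 // [B * 2]mulrC ge_min lexx orbT //.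
have := normc_ge0 l; have := normc_ge0 m; have := normc_ge0 (f t - l); have := normc_ge0 (g t - m).
move=> n1 n2 n3 n4.
apply: le_lt_trans (normcD_le _ _) _; rewrite normcM'.
apply: le_lt_trans (lerD (lexx _) (normcD_le _ _)) _; rewrite !normcM'.
move: h1 h2 h3 h4 n1 n2 n3 n4; rewrite /B.
move: (normc (f t - l)) (normc (g t - m)) (normc l) (normc m) => x y a b *; nra.
Qed.

Lemma lim0_comp f g l : lim0 g 0 -> lim0 f l -> lim0 (fun t => f (g t)) l.
Proof.
move=> hg hf e /hf [d d0 hd]; have [d' d'0 hd'] := hg _ d0.
by exists d' => // t /hd' h; apply: hd; move: h; rewrite subr0.
Qed.

Lemma lim0_off (g : C -> C) a l : lim0 g l -> (forall t, t != 0 -> g t = a) -> a = l.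
Proof.
move=> hg ha; apply/eqP; rewrite -subr_eq0 -normc_eq0; apply: contraT => n0.
have n1 : 0 < normc (a - l) by rewrite lt0r n0 normc_ge0.
have [d d0 hd] := hg _ n1.
have t0 : (d / 2)%:C%C != 0 :> C by rewrite eq_complex /= eqxx andbT; lra.
have := hd (d / 2)%:C%C; rewrite ha // ltxx normcR ger0_norm; last by lra.
by move=> h; apply: h; lra.
Qed.

(* Caratheodory's form of real differentiability at z: A and B are the derivatives of f
   with respect to z and \bar z. *)
Definition wirt (f : C -> C) (z A B : C) : Prop := exists phi psi : C -> C,
  [/\ lim0 phi A, lim0 psi B & forall t, f (z + t) = f z + phi t * t + psi t * conjc t].

Lemma wirt_cont f z A B : wirt f z A B -> lim0 (fun t => f (z + t)) (f z).
Proof.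
move=> [phi [psi [h1 h2 h3]]].
have -> : (fun t => f (z + t)) = (fun t => f z + phi t * t + psi t * conjc t) by apply/funext.
rewrite -[X in lim0 _ X](_ : f z + A * 0 + B * conjc 0 = f z); last first.
  by rewrite rmorph0 !mulr0 !addr0.
by do 2?[apply: lim0D]; try exact: lim0_cst; apply: lim0M => //;
  [exact: lim0_id|exact: lim0_conj lim0_id].
Qed.

Lemma eq_wirt f g z A B A' B' : f =1 g -> A = A' -> B = B' -> wirt f z A B -> wirt g z A' B'.
Proof. by move=> /funext -> -> ->. Qed.

Lemma wirt_cst c z : wirt (fun=> c) z 0 0.
Proof.
exists (fun=> 0), (fun=> 0); split; try exact: lim0_cst.
by move=> t; rewrite !mul0r !addr0.
Qed.

Lemma wirt_id z : wirt id z 1 0.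
Proof.
exists (fun=> 1), (fun=> 0); split; try exact: lim0_cst.
by move=> t; rewrite mul0r mul1r addr0.
Qed.

Lemma wirt_lin a f g z A B A' B' : wirt f z A B -> wirt g z A' B' ->
  wirt (fun t => a * f t + g t) z (a * A + A') (a * B + B').
Proof.
move=> [p [q [h1 h2 h3]]] [p' [q' [h1' h2' h3']]].
exists (fun t => a * p t + p' t), (fun t => a * q t + q' t); split.
- by apply: lim0D => //; apply: lim0M => //; exact: lim0_cst.
- by apply: lim0D => //; apply: lim0M => //; exact: lim0_cst.
by move=> t; rewrite h3 h3'; ring.
Qed.

Lemma wirtD f g z A B A' B' : wirt f z A B -> wirt g z A' B' ->
  wirt (fun t => f t + g t) z (A + A') (B + B').
Proof.
move=> h h'; apply: eq_wirt (wirt_lin 1 h h') => [t||]; by rewrite mul1r.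
Qed.

Lemma wirtM f g z A B A' B' : wirt f z A B -> wirt g z A' B' ->
  wirt (fun t => f t * g t) z (A * g z + f z * A') (B * g z + f z * B').
Proof.
move=> [p [q [h1 h2 h3]]] hg; have [p' [q' [h1' h2' h3']]] := hg.
exists (fun t => p t * g (z + t) + f z * p' t), (fun t => q t * g (z + t) + f z * q' t); split.
- by apply: lim0D; apply: lim0M => //; [exact: wirt_cont hg|exact: lim0_cst].
- by apply: lim0D; apply: lim0M => //; [exact: wirt_cont hg|exact: lim0_cst].
by move=> t; rewrite h3 h3'; ring.
Qed.

Lemma wirt_comp f g z A B A' B' : wirt f (g z) A B -> wirt g z A' B' ->
  wirt (fun t => f (g t)) z (A * A' + B * conjc B') (A * B' + B * conjc A').
Proof.
move=> [p [q [h1 h2 h3]]] hg; have [p' [q' [h1' h2' h3']]] := hg.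
pose s t := p' t * t + q' t * conjc t.
have s0 : lim0 s 0.
  rewrite -[0](_ : A' * 0 + B' * conjc 0 = 0); last by rewrite rmorph0 !mulr0 addr0.
  by apply: lim0D; apply: lim0M => //; [exact: lim0_id|exact: lim0_conj lim0_id].
exists (fun t => p (s t) * p' t + q (s t) * conjc (q' t)),
       (fun t => p (s t) * q' t + q (s t) * conjc (p' t)); split.
- by apply: lim0D; apply: lim0M => //; try exact: lim0_comp s0 _; exact: lim0_conj.
- by apply: lim0D; apply: lim0M => //; try exact: lim0_comp s0 _; exact: lim0_conj.
move=> t; rewrite h3' -addrA -/(s t) h3 /s !rmorphD !rmorphM /= conjcK; ring.
Qed.

(** The whole remainder, divided by [t], goes into [phi], and [psi] is constant. *)
Lemma wirt_o f z A B : (forall e : R, 0 < e -> exists2 d : R, 0 < d & forall t, normc t < d ->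
    normc (f (z + t) - f z - (A * t + B * conjc t)) <= e * normc t) -> wirt f z A B.
Proof.
move=> h; pose r t := f (z + t) - f z - (A * t + B * conjc t).
exists (fun t => A + r t / t), (fun=> B); split; last 1 first.
- move=> t; have [->|t0] := eqVneq t 0.
    by rewrite conjc0 !mulr0 !addr0.
  rewrite mulrDl divfK // /r; ring.
- move=> e e0; have [d d0 hd] := h _ (divr_gt0 e0 (ltr0n _ 2)).
  exists d => // t /hd; rewrite -/(r t) addrC addKr normcM' normcV'.
  have [->|t0] := eqVneq t 0; first by move=> _; rewrite [X in X / _]normc0' ||
    rewrite [X in _ / X]normc0' invr0 mulr0.
  have t1 : 0 < normc t by rewrite normc_gt0.
  rewrite -ler_pdivrMr // => hh; apply: le_lt_trans hh _; lra.
- exact: lim0_cst.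
Qed.

Lemma wirt_quad f z A B (K r : R) : 0 < r -> (forall t, normc t < r ->
    normc (f (z + t) - f z - (A * t + B * conjc t)) <= K * normc t ^+ 2) -> wirt f z A B.
Proof.
move=> r0 h; apply: wirt_o => e e0; have K0 : 0 < `|K| + 1 by rewrite ltr_wpDl.
exists (Num.min r (e / (`|K| + 1))) => [|t]; first by rewrite lt_min r0 divr_gt0.
rewrite lt_min ltr_pdivlMr // => /andP[/h h1 h2]; apply: le_trans h1 _.
have := normc_ge0 t; have := ler_norm K; have := normr_ge0 K.
move: h2; move: (normc t) (`|K|) => x k *; rewrite expr2 mulrA ler_wpM2r //; nra.
Qed.

Lemma wirt_line f (z d A B : C) (s : R) : wirt f (z + s%:C%C * d) A B ->
  is_derive s (1 : R) (fun s : R => Re (f (z + s%:C%C * d))) (Re (A * d + B * conjc d)) /\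
  is_derive s (1 : R) (fun s : R => Im (f (z + s%:C%C * d))) (Im (A * d + B * conjc d)).
Proof.
move=> [p [q [h1 h2 h3]]].
(* The difference quotient along the line; the factorisation defines it at [t = 0] too. *)
pose k (t : R) := p (t%:C%C * d) * d + q (t%:C%C * d) * conjc d.
have kE t : f (z + (t + s)%:C%C * d) - f (z + s%:C%C * d) = t%:C%C * k t.
  have -> : z + (t + s)%:C%C * d = z + s%:C%C * d + t%:C%C * d by rewrite rmorphD /=; ring.
  have ec : conjc (t%:C%C * d) = t%:C%C * conjc d by case: (d) => a b; simpc.
  by rewrite h3 ec /k; ring.
have klim : forall e : R, 0 < e -> exists2 r : R, 0 < r & forall t : R, `|t| < r ->
     normc (k t - (A * d + B * conjc d)) < e.
  have hk : lim0 (fun t => p (t * d) * d + q (t * d) * conjc d) (A * d + B * conjc d).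
    have hd : lim0 (fun t => t * d) 0.
      by rewrite -[0](mul0r d); apply: lim0M; [exact: lim0_id|exact: lim0_cst].
    by apply: lim0D; apply: lim0M; try exact: lim0_comp hd _; exact: lim0_cst.
  by move=> e /hk [r r0 hr]; exists r => // t ht; apply: hr; rewrite normcR.
have aux (part : C -> R) : (forall x y, part (x - y) = part x - part y) ->
    (forall x, `|part x| <= normc x) -> (forall t x, part (t%:C%C * x) = t * part x) ->
    is_derive s (1 : R) (fun s : R => part (f (z + s%:C%C * d))) (part (A * d + B * conjc d)).
  move=> pB pn pZ.
  have hc : (fun h : R => h^-1 *: (((fun s : R => part (f (z + s%:C%C * d))) \o shift s) (h *: (1 :
    R)) -
      part (f (z + s%:C%C * d)))) @ 0^' --> part (A * d + B * conjc d).
    apply/cvgrPdist_lt => e /klim [r r0 hr].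
    near=> h.
    have h0 : h != 0 by near: h; exact: nbhs_dnbhs_neq.
    rewrite /= /shift /= -pB [h *: 1]mulr1 kE pZ /GRing.scale /= mulKf //.
    rewrite -pB; apply: le_lt_trans (pn _) _; rewrite normcB; apply: hr.
    by near: h; exact: dnbhs0_lt.
  by split; [apply/cvg_ex; eexists; exact: hc|exact: cvg_lim hc].
split; apply: aux.
- by move=> [? ?] [? ?].
- exact: normc_Re.
- by move=> t [x y] /=; rewrite mul0r subr0.
- by move=> [? ?] [? ?].
- exact: normc_Im.
- by move=> t [x y] /=; rewrite mul0r addr0.
Unshelve. all: by end_near. Qed.

Lemma ddx_wirt f z A B : wirt f z A B -> ddx f z = A + B.
Proof.
move=> h; have [] := @wirt_line f z 1 A B 0; first by rewrite mul0r addr0.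
rewrite conjc1 !mulr1 /ddx !derive1E => h1 h2.
have e t : (t +i* 0)%C = t%:C%C * 1 :> C by rewrite mulr1.
have er : (fun t : R => Re (f (z + (t +i* 0)%C))) = (fun s : R => Re (f (z + s%:C%C * 1))).
  by apply/funext => t; rewrite e.
have ei : (fun t : R => Im (f (z + (t +i* 0)%C))) = (fun s : R => Im (f (z + s%:C%C * 1))).
  by apply/funext => t; rewrite e.
by rewrite er ei !derive_val; case: (A + B).
Qed.

Lemma ddy_wirt f z A B : wirt f z A B -> ddy f z = 'i%C * (A - B).
Proof.
move=> h; have [] := @wirt_line f z 'i%C A B 0; first by rewrite mul0r addr0.
have -> : A * 'i%C + B * conjc 'i%C = 'i%C * (A - B).
  have -> : conjc 'i%C = - 'i%C :> C by simpc.
  ring.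
rewrite /ddy !derive1E => h1 h2.
have e t : (0 +i* t)%C = t%:C%C * 'i%C :> C by simpc.
have er : (fun t : R => Re (f (z + (0 +i* t)%C))) = (fun s : R => Re (f (z + s%:C%C * 'i%C))).
  by apply/funext => t; rewrite e.
have ei : (fun t : R => Im (f (z + (0 +i* t)%C))) = (fun s : R => Im (f (z + s%:C%C * 'i%C))).
  by apply/funext => t; rewrite e.
by rewrite er ei !derive_val; case: ('i%C * (A - B)).
Qed.

Lemma sqr_imag : 'i%C * 'i%C = -1 :> C.
Proof. by simpc. Qed.

Lemma ddz_wirt f z A B : wirt f z A B -> ddz f z = A.
Proof.
move=> h; rewrite /ddz (ddx_wirt h) (ddy_wirt h) mulrA sqr_imag mulN1r opprK.
have -> : A + B + (A - B) = A * 2 by ring.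
by rewrite mulfK // pnatr_eq0.
Qed.

Lemma ddzbar_wirt f z A B : wirt f z A B -> ddzbar f z = B.
Proof.
move=> h; rewrite /ddzbar (ddx_wirt h) (ddy_wirt h) mulrA sqr_imag mulN1r.
have -> : A + B - (A - B) = B * 2 by ring.
by rewrite mulfK // pnatr_eq0.
Qed.

Lemma wirt_unique f z A B A' B' : wirt f z A B -> wirt f z A' B' -> A = A' /\ B = B'.
Proof.
move=> h h'; rewrite -(ddz_wirt h) -(ddz_wirt h') -(ddzbar_wirt h) -(ddzbar_wirt h').
by [].
Qed.

(** On the line through [y] and [x], real and imaginary parts are functions of one real variable
    with zero derivative. *)
Lemma wirt0_const f : (forall z, wirt f z 0 0) -> forall x y, f x = f y.
Proof.
move=> h x y.
have hl s := @wirt_line f y (x - y) 0 0 s (h _).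
have e1 : y + 1%:C%C * (x - y) = x by rewrite mul1r addrC subrK.
have e0 : y + 0%:C%C * (x - y) = y by rewrite mul0r addr0.
have hr : Re (f x) = Re (f y).
  rewrite -e1 -[in RHS]e0; apply: (@is_derive_0_is_cst R (fun s => Re (f (y + s%:C%C * (x - y))))).
  by move=> s; have [+ _] := hl s; rewrite !mul0r addr0.
have hi : Im (f x) = Im (f y).
  rewrite -e1 -[in RHS]e0; apply: (@is_derive_0_is_cst R (fun s => Im (f (y + s%:C%C * (x - y))))).
  by move=> s; have [_] := hl s; rewrite !mul0r addr0.
by move: hr hi; case: (f x) (f y) => [? ?] [? ?] /= -> ->.
Qed.

Lemma derive_o (f : R -> R) (l : R) : is_derive (0 : R) (1 : R) f l ->
  forall e : R, 0 < e -> exists2 d : R, 0 < d & forall t : R, `|t| < d ->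
    `|f t - f 0 - l * t| <= e * `|t|.
Proof.
move=> h e e0; have [df lf] := h.
have hc : (fun h : R => h^-1 *: ((f \o shift 0) (h *: (1 : R)) - f 0)) @ 0^' --> l.
  by rewrite -lf; exact: df.
move/cvgrPdist_le : hc => /(_ e e0) /nbhs_ballP [d d0 hd]; exists d => // t td.
have [->|t0] := eqVneq t 0; first by rewrite subrr mulr0 subr0 normr0 mulr0.
have := hd t; rewrite /ball /= sub0r normrN => /(_ td t0).
rewrite /shift /= addr0 [t *: 1]mulr1 /GRing.scale /= => hh.
have -> : f t - f 0 - l * t = - ((l - t^-1 * (f t - f 0)) * t).
  by rewrite mulrBl mulrAC mulVf // mul1r opprB.
by rewrite normrN normrM ler_wpM2r.
Qed.

Lemma wirt_Re (f : R -> R) (l : R) : is_derive (0 : R) (1 : R) f l ->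
  wirt (fun z => (f (Re z))%:C%C) 0 (l%:C%C / 2) (l%:C%C / 2).
Proof.
move=> /derive_o h; apply: wirt_o => e e0; have [d d0 hd] := h e e0; exists d => // t td.
have tn := normc_Re t.
have -> : l%:C%C / 2 * t + l%:C%C / 2 * conjc t = (l * Re t)%:C%C.
  have n2 : (2%:R : C) != 0 by rewrite pnatr_eq0.
  by rewrite -mulrDr addcJ rmorphM /= mulrA mulfVK.
rewrite add0r (_ : _ - _ - _ = (f (Re t) - f 0 - l * Re t)%:C%C); last by rewrite !rmorphB.
rewrite normcR.
by apply: le_trans (hd _ _) _; [exact: le_lt_trans tn td|by rewrite ler_wpM2l // ltW].
Qed.

Lemma wirt_Im (f : R -> R) (l : R) : is_derive (0 : R) (1 : R) f l ->
  wirt (fun z => (f (Im z))%:C%C) 0 (l%:C%C / (2 * 'i%C)) (- (l%:C%C / (2 * 'i%C))).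
Proof.
move=> /derive_o h; apply: wirt_o => e e0; have [d d0 hd] := h e e0; exists d => // t td.
have tn := normc_Im t.
have i0 : (2 * 'i%C : C) != 0.
  by rewrite mulf_neq0 ?pnatr_eq0 // eq_complex /= oner_eq0 andbF.
have -> : l%:C%C / (2 * 'i%C) * t + - (l%:C%C / (2 * 'i%C)) * conjc t = (l * Im t)%:C%C.
  rewrite mulNr -mulrBr subcJ rmorphM /= mulrAC -mulrA.
  have -> : 2%:R * (Im t)%:C%C * 'i%C / (2 * 'i%C) = (Im t)%:C%C :> C.
    by apply: (mulIf i0); rewrite divfK //; ring.
  by [].
rewrite add0r (_ : _ - _ - _ = (f (Im t) - f 0 - l * Im t)%:C%C); last by rewrite !rmorphB.
rewrite normcR.
by apply: le_trans (hd _ _) _; [exact: le_lt_trans tn td|by rewrite ler_wpM2l // ltW].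
Qed.

(** The real derivatives of exp, cos and sin at 0 give the claim there; the addition law carries it
    to every point. *)
Lemma wirt_cexp z : wirt (@cexp R) z (cexp z) 0.
Proof.
have h0 : wirt (@cexp R) 0 1 0.
  have he := @wirt_Re _ _ (is_derive_expR (0 : R)).
  have hs := @wirt_Im _ _ (is_derive_sin (0 : R)).
  have hc := @wirt_Im _ _ (is_derive_cos (0 : R)).
  have := wirtM he (wirt_lin 'i%C hs hc).
  have -> : Re (0 : C) = 0 by [].
  have -> : Im (0 : C) = 0 by [].
  rewrite expR0 sin0 cos0 oppr0 rmorph1 rmorph0 !mulr0 !add0r !mul0r oppr0 !addr0 !mulr1 !mul1r
    mulrN.
  have n2 : (2 : C) != 0 by rewrite pnatr_eq0.
  have i0 : ('i%C : C) != 0 by rewrite eq_complex /= oner_eq0 andbF.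
  have -> : 'i%C * (2 * 'i%C)^-1 = 2^-1 :> C.
    by rewrite invfM mulrCA divff // mulr1.
  apply: eq_wirt => [[x y]||].
  - by rewrite /cexp /=; simpc.
  - by apply: (mulIf n2); rewrite mulrDl mulVf // mul1r.
  - by rewrite subrr.
have [p [q [h1 h2 h3]]] := h0.
exists (fun t => cexp z * p t), (fun t => cexp z * q t); split.
- by rewrite -[X in lim0 _ X]mulr1; apply: lim0M => //; exact: lim0_cst.
- by rewrite -(mulr0 (cexp z)); apply: lim0M => //; exact: lim0_cst.
by move=> t; have := h3 t; rewrite add0r => h3t; rewrite cexpD h3t cexp0; ring.
Qed.

Lemma wirt_cexp_lin (a b z : C) :
  wirt (fun t => cexp (a * t + b * conjc t)) z
    (a * cexp (a * z + b * conjc z)) (b * cexp (a * z + b * conjc z)).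
Proof.
have h : wirt (fun t => a * t + b * conjc t) z a b.
  exists (fun=> a), (fun=> b); split; try exact: lim0_cst.
  by move=> t; rewrite rmorphD /=; ring.
by apply: eq_wirt (wirt_comp (wirt_cexp _) h) => [t||] //; rewrite mul0r addr0 mulrC.
Qed.

(* z d/dz and zbar d/dzbar are the translations in the logarithm of z. *)
Lemma euler_homogeneous (g : C -> C) (a b : C) :
  (forall z, z != 0 -> exists A B, wirt g z A B /\ z * A = a * g z /\ conjc z * B = b * g z) ->
  forall t z, z != 0 -> g (cexp t * z) = cexp (a * t + b * conjc t) * g z.
Proof.
move=> h t z z0.
pose k s := g (cexp s * z) * cexp (- a * s + - b * conjc s).
have hk s : wirt k s 0 0.
  have nz : cexp s * z != 0 by rewrite mulf_neq0 // cexp_neq0.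
  have [A [B [hA [eA eB]]]] := h _ nz.
  have h1 : wirt (fun s => cexp s * z) s (cexp s * z) 0.
    apply: eq_wirt (wirtM (wirt_cexp s) (wirt_cst z s)) => //; rewrite ?mulr0 ?mul0r ?addr0 //.
  have := wirtM (wirt_comp (g := fun s => cexp s * z) hA h1) (wirt_cexp_lin (- a) (- b) s).
  apply: eq_wirt => //.
    by rewrite rmorph0 mulr0 addr0 [A * _]mulrC eA; ring.
  by rewrite mulr0 add0r [B * _]mulrC eB; ring.
have := wirt0_const hk t 0; rewrite /k cexp0 mul1r rmorph0 !mulr0 addr0 cexp0 mulr1 => <-.
rewrite mulrCA -cexpD (_ : _ + _ = 0) ?cexp0 ?mulr1 //; ring.
Qed.

(** The function [s |-> g (cexp s * z)] is differentiated at 0 by the chain rule and by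
    homogeneity. *)
Lemma homogeneous_euler (g : C -> C) (a b z A B : C) : z != 0 -> wirt g z A B ->
  (forall t, g (cexp t * z) = cexp (a * t + b * conjc t) * g z) ->
  z * A = a * g z /\ conjc z * B = b * g z.
Proof.
move=> z0 hg h.
have h1 : wirt (fun s => cexp s * z) 0 z 0.
  by apply: eq_wirt (wirtM (wirt_cexp 0) (wirt_cst z 0)) => //;
    rewrite cexp0 ?mul1r ?mulr0 ?mul0r ?addr0.
have h2 : wirt (fun s => g (cexp s * z)) 0 (A * z) (B * conjc z).
  have := wirt_comp (f := g) (g := fun s => cexp s * z) (z := 0) (A := A) (B := B).
  rewrite cexp0 mul1r => /(_ _ _ hg h1); apply: eq_wirt => //.
  - by rewrite rmorph0 mulr0 addr0.
  - by rewrite mulr0 add0r.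
have h3 : wirt (fun s => g (cexp s * z)) 0 (a * g z) (b * g z).
  apply: eq_wirt (wirtM (wirt_cexp_lin a b 0) (wirt_cst (g z) 0)) => [t||].
  - by rewrite h.
  - by rewrite rmorph0 !mulr0 !addr0 cexp0 mulr1.
  - by rewrite rmorph0 !mulr0 !addr0 cexp0 mulr1.
by have [e1 e2] := wirt_unique h2 h3; rewrite [z * A]mulrC [_ * B]mulrC.
Qed.

End Wirtinger.

(** * Smooth functions of several complex variables *)

Section SmoothFunctions.
Variable R : realType.
Local Notation C := R[i].

Lemma near_eq_differentiable (V W : normedModType R) (f g : V -> W) (x : V) :
  (\forall y \near x, f y = g y) -> differentiable f x -> differentiable g x.
Proof.
move=> fg df; have [cf /eqaddoP ef] := (diff_locallyP _ _).1 df.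
have gx : f x = g x by exact: nbhs_singleton fg.
have eg : g \o shift x = cst (g x) + 'd f x +o_ (0 : V) id.
  apply/eqaddoP => e e0; have := ef e e0; move: fg; rewrite (near_shift 0 x) => fg h.
  have {}fg : \forall y \near (0 : V), f (y + x) = g (y + x).
    by move: fg; rewrite /= subr0.
  near=> y; rewrite -gx.
  have : `|(f \o shift x - (cst (f x) + 'd f x)) y| <= e * `|y| by near: y.
  have -> // : (f \o shift x - (cst (f x) + 'd f x)) y = (g \o shift x - (cst (f x) + 'd f x)) y.
  have : f (y + x) = g (y + x) by near: y.
  by rewrite !fctE /= => ->.
have e := diff_unique cf eg.
by apply/diff_locallyP; rewrite e.
Unshelve. all: by end_near. Qed.

(** * Functions of class C^k on an open set *)

Section Ck.
Variables (m : nat) (U : set 'rV[R]_m).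
Hypothesis oU : open U.

Lemma near_open (P : 'rV[R]_m -> Prop) x : U x -> (forall y, U y -> P y) -> \forall y \near x, P y.
Proof. by move=> Ux h; apply: filterS h _; exact: open_nbhs_nbhs. Qed.

Lemma eq_Ck k f g : (forall x, U x -> f x = g x) -> Ck k U f -> Ck k U g.
Proof.
elim: k f g => [|k IH] f g fg /=.
  move=> cf x Ux; have e : \forall y \near x, f y = g y by exact: near_open.
  have h : f @ x --> f x := cf x Ux.
  by change (g @ x --> g x); rewrite -fg //; exact: cvg_trans (near_eq_cvg e) h.
move=> [df dk]; split.
  move=> x Ux; apply: near_eq_differentiable (df x Ux); exact: near_open.
move=> v; apply: IH (dk v) => x Ux; apply: near_eq_derive; exact: near_open.
Qed.

Lemma Ck_cst k c : Ck k U (fun=> c).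
Proof.
elim: k c => [|k IH] c /=; first by move=> x _; exact: cst_continuous.
split=> [x _|v]; first exact: differentiable_cst.
by apply: eq_Ck (IH 0) => x _; rewrite derive_cst.
Qed.

Lemma Ck_pred k f : Ck k.+1 U f -> Ck k U f.
Proof.
elim: k f => [|k IH] f /=.
  by move=> [df _] x Ux; apply: differentiable_continuous; exact: df.
by move=> [df dk]; split=> // v; apply: IH; exact: dk.
Qed.

Lemma Ck_add k f g : Ck k U f -> Ck k U g -> Ck k U (fun x => f x + g x).
Proof.
elim: k f g => [|k IH] f g /=.
  by move=> cf cg x Ux; apply: continuousD; [exact: cf|exact: cg].
move=> [df dkf] [dg dkg]; split=> [x Ux|v].
  by apply: differentiableD; [exact: df|exact: dg].
apply: eq_Ck (IH _ _ (dkf v) (dkg v)) => x Ux; rewrite -[RHS]/('D_v (f + g) x) deriveD //.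
- by apply: diff_derivable; exact: df.
- by apply: diff_derivable; exact: dg.
Qed.

(** The Leibniz rule contains the factors themselves, which [Ck_pred] lowers to the class of the
    induction hypothesis. *)
Lemma Ck_mul k f g : Ck k U f -> Ck k U g -> Ck k U (fun x => f x * g x).
Proof.
elim: k f g => [|k IH] f g.
  by move=> cf cg x Ux; apply: continuousM; [exact: cf|exact: cg].
move=> hf hg; have [df dkf] := hf; have [dg dkg] := hg; split=> [x Ux|v].
  by apply: differentiableM; [exact: df|exact: dg].
have h := Ck_add (IH _ _ (Ck_pred hf) (dkg v)) (IH _ _ (Ck_pred hg) (dkf v)).
apply: eq_Ck h => x Ux; rewrite -[RHS]/('D_v (f * g) x) deriveM //.
- by apply: diff_derivable; exact: df.
- by apply: diff_derivable; exact: dg.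
Qed.

Lemma Ck_opp k f : Ck k U f -> Ck k U (fun x => - f x).
Proof.
by move=> h; apply: eq_Ck (Ck_mul (Ck_cst k (-1)) h) => x _; rewrite mulN1r.
Qed.

Lemma Ck_coord k (j : 'I_m) : Ck k U (fun x => x 0 j).
Proof.
case: k => [|k] /=; first by move=> x _; exact: coord_continuous.
split=> [x _|v]; first exact: differentiable_coord.
apply: eq_Ck (Ck_cst k (v 0 j)) => x _; apply/esym.
have lf : linear (fun x : 'rV[R]_m => x 0 j : R) by move=> a y z; rewrite !mxE.
pose f : {linear 'rV[R]_m -> R} := HB.pack (fun x : 'rV[R]_m => x 0 j : R)
  (GRing.isLinear.Build R 'rV[R]_m R *:%R (fun x : 'rV[R]_m => x 0 j) lf).
rewrite (_ : (fun _ => _) = f) // deriveE; last exact: differentiable_coord.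
by rewrite diff_lin //; exact: coord_continuous.
Qed.

End Ck.

Lemma differentiable_mulmxr m n (M : 'M[R]_(m, n)) (x : 'rV[R]_m) :
  differentiable (fun x : 'rV[R]_m => x *m M) x.
Proof.
have -> : (fun x : 'rV[R]_m => x *m M) =
   \sum_(j < n) (fun x : 'rV[R]_m => (\sum_(i < m) (fun x : 'rV[R]_m => M i j * x 0 i)) x *:
     delta_mx 0 j).
  apply/funext => y; rewrite fct_sumE; apply/rowP => k; rewrite mxE summxE (bigD1 k) //=.
  rewrite [X in _ + X]big1 ?addr0 => [|j jk /=]; last first.
    by rewrite [LHS]mxE [delta_mx _ _ _ _]mxE eq_sym (negPf jk) andbF mulr0.
  by rewrite !mxE !eqxx mulr1 fct_sumE; apply: eq_bigr => i _; rewrite mulrC.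
apply: differentiable_sum => j; apply: differentiableZl.
apply: differentiable_sum => i; apply: (@differentiableZ _ _ _ (fun x : 'rV[R]_m => x 0 i : R)).
exact: differentiable_coord.
Qed.

(** Real matrices suffice: the changes of variables to come append the point 0 or subtract the last
    point, and act on real and imaginary parts by the same matrix. *)
Definition mulmx_tuple m n (B : 'M[R]_(m, n)) (z : m.-tuple C) : n.-tuple C :=
  [tuple \sum_(i < m) (B i j)%:C%C * tnth z i | j < n].

Lemma of_coords_mulmx m n (B : 'M[R]_(m, n)) (x : 'rV[R]_(m + m)) :
  of_coords (x *m block_mx B 0 0 B) = mulmx_tuple B (of_coords x).
Proof.
apply: eq_from_tnth => j; rewrite !tnth_mktuple.
rewrite -[x]hsubmxK mul_row_block !mulmx0 addr0 add0r row_mxEl row_mxEr !mxE.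
under [RHS]eq_bigr => i _ do rewrite tnth_mktuple row_mxEl row_mxEr.
elim: (index_enum _) => [|i r IH]; first by rewrite !big_nil.
by rewrite !big_cons -IH; simpc; congr (_ +i* _)%C; ring.
Qed.

Lemma Ck_mulmxr m n (M : 'M[R]_(m, n)) k (U : set 'rV[R]_n) g : open U ->
  Ck k U g -> Ck k [set x | U (x *m M)] (fun x => g (x *m M)).
Proof.
move=> oU; have cM : continuous (fun x : 'rV[R]_m => x *m M).
  by move=> x; apply: differentiable_continuous; exact: differentiable_mulmxr.
have oV : open [set x : 'rV[R]_m | U (x *m M)].
  by apply: open_comp => // x _; exact: cM.
elim: k g => [|k IH] g /=.
  by move=> cg x Ux; apply: continuous_comp; [exact: cM|exact: cg].
move=> [dg dk]; split=> [x Ux|v].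
  by apply: differentiable_comp; [exact: differentiable_mulmxr|exact: dg].
apply: (eq_Ck oV) (IH _ (dk (v *m M))) => x Ux; rewrite /derive.
suff -> : (fun h : R => h^-1 *: ((g \o shift (x *m M)) (h *: (v *m M)) - g (x *m M))) =
  (fun h => h^-1 *: (((fun y => g (y *m M)) \o shift x) (h *: v) - g (x *m M))) by [].
by apply/funext => h; rewrite /= mulmxDl scalemxAl.
Qed.

Definition open_coords n (D : set (n.-tuple C)) : Prop :=
  open [set x : 'rV[R]_(n + n) | D (of_coords x)].

Lemma smooth_on_mulmx m n (B : 'M[R]_(m, n)) (D : set (n.-tuple C)) f : open_coords D ->
  smooth_on D f -> smooth_on [set z | D (mulmx_tuple B z)] (fun z => f (mulmx_tuple B z)).
Proof.
move=> oD h k; have [h1 h2] := h k.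
have := Ck_mulmxr (block_mx B 0 0 B) oD h1; have := Ck_mulmxr (block_mx B 0 0 B) oD h2.
have e : (fun x => of_coords (x *m block_mx B 0 0 B)) = (fun x => mulmx_tuple B (of_coords x)).
  by apply/funext => x; rewrite of_coords_mulmx.
have es : [set x | [set x | D (of_coords x)] (x *m block_mx B 0 0 B)] =
   [set x | [set z | D (mulmx_tuple B z)] (of_coords x)].
  by apply/funext => x /=; rewrite of_coords_mulmx.
have eR : (fun x => Re (f (of_coords (x *m block_mx B 0 0 B)))) =
   (fun x => Re (f (mulmx_tuple B (of_coords x)))) by apply/funext => x; rewrite of_coords_mulmx.
have eI : (fun x => Im (f (of_coords (x *m block_mx B 0 0 B)))) =
   (fun x => Im (f (mulmx_tuple B (of_coords x)))) by apply/funext => x; rewrite of_coords_mulmx.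
by rewrite es eR eI.
Qed.

Section SmoothOn.
Variables (n : nat) (D : set (n.-tuple C)).
Hypothesis oD : open_coords D.

Lemma eq_smooth_on f g : (forall z, D z -> f z = g z) -> smooth_on D f -> smooth_on D g.
Proof.
move=> fg h k; have [h1 h2] := h k.
by split; [apply: eq_Ck h1|apply: eq_Ck h2] => // x Dx; rewrite fg.
Qed.

Lemma smooth_on_cst c : smooth_on D (fun=> c).
Proof. by move=> k; split; exact: Ck_cst. Qed.

Lemma smooth_on_add f g : smooth_on D f -> smooth_on D g -> smooth_on D (fun z => f z + g z).
Proof.
move=> hf hg k; have [f1 f2] := hf k; have [g1 g2] := hg k.
split; [apply: (eq_Ck oD) (Ck_add oD f1 g1)|apply: (eq_Ck oD) (Ck_add oD f2 g2)] => x _;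
  by case: (f _) (g _) => [? ?] [? ?].
Qed.

Lemma smooth_on_mul f g : smooth_on D f -> smooth_on D g -> smooth_on D (fun z => f z * g z).
Proof.
move=> hf hg k; have [f1 f2] := hf k; have [g1 g2] := hg k.
split.
  have := Ck_add oD (Ck_mul oD f1 g1) (Ck_opp oD (Ck_mul oD f2 g2)).
  by apply: (eq_Ck oD) => x _; case: (f _) (g _) => [? ?] [? ?].
have := Ck_add oD (Ck_mul oD f1 g2) (Ck_mul oD f2 g1).
by apply: (eq_Ck oD) => x _; case: (f _) (g _) => [? ?] [? ?].
Qed.

Lemma smooth_on_sum (I : Type) (r : seq I) (f : I -> n.-tuple C -> C) :
  (forall i, smooth_on D (f i)) -> smooth_on D (fun z => \sum_(i <- r) f i z).
Proof.
move=> h; elim: r => [|i r IH].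
  by apply: eq_smooth_on (smooth_on_cst 0) => z _; rewrite big_nil.
by apply: eq_smooth_on (smooth_on_add (h i) IH) => z _; rewrite big_cons.
Qed.

Lemma smooth_on_exp f k : smooth_on D f -> smooth_on D (fun z => f z ^+ k).
Proof.
move=> h; elim: k => [|k IH]; first by apply: eq_smooth_on (smooth_on_cst 1).
by apply: eq_smooth_on (smooth_on_mul h IH) => z _; rewrite exprS.
Qed.

Lemma smooth_on_conj f : smooth_on D f -> smooth_on D (fun z => conjc (f z)).
Proof.
move=> h k; have [h1 h2] := h k.
split; [apply: (eq_Ck oD) h1|apply: (eq_Ck oD) (Ck_opp oD h2)] => x _;
  by case: (f _).
Qed.

Lemma smooth_on_coord (j : 'I_n) : smooth_on D (fun z => tnth z j).
Proof.
move=> k; split.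
  by apply: (eq_Ck oD) (Ck_coord oD k (lshift n j)) => x _; rewrite tnth_mktuple.
by apply: (eq_Ck oD) (Ck_coord oD k (rshift n j)) => x _; rewrite tnth_mktuple.
Qed.

End SmoothOn.

Lemma open_coords_neq n (i j : 'I_n) : i != j -> open_coords [set z : n.-tuple C |
  tnth z i != tnth z j].
Proof.
move=> ij.
have -> : open_coords [set z : n.-tuple C | tnth z i != tnth z j] = open
   ([set x : 'rV[R]_(n + n) | x 0 (lshift n i) - x 0 (lshift n j) != 0] `|`
    [set x : 'rV[R]_(n + n) | x 0 (rshift n i) - x 0 (rshift n j) != 0]).
  rewrite /open_coords; congr (open _); apply/funext => x; apply/propext.
  rewrite /= !tnth_mktuple eq_complex /= negb_and !subr_eq0.
  by split=> [/orP|/orP].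
apply: openU.
  apply: (@open_comp _ _ (fun x : 'rV[R]_(n + n) => x 0 (lshift n i) - x 0 (lshift n j)) [set t |
    t != 0]).
    by move=> x _; apply: continuousB; exact: coord_continuous.
  exact: open_neq.
apply: (@open_comp _ _ (fun x : 'rV[R]_(n + n) => x 0 (rshift n i) - x 0 (rshift n j)) [set t |
  t != 0]).
  by move=> x _; apply: continuousB; exact: coord_continuous.
exact: open_neq.
Qed.

Lemma open_coords_uniq n : open_coords [set z : n.-tuple C | uniq z].
Proof.
have -> : [set z : n.-tuple C | uniq z] =
  [set z | forall ij : 'I_n * 'I_n, ij.1 != ij.2 -> tnth z ij.1 != tnth z ij.2].
  apply/funext => z; apply/propext; split=> [/tuple_uniqP h [i j] /= ij|h].
    by apply: contra ij => /eqP /h ->.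
  by apply/tuple_uniqP => i j e; apply/eqP; apply: contraT => ij; have := h (i, j) ij;
    rewrite e eqxx.
rewrite /open_coords openE => x hx.
apply: (@filter_forall _ _ (fun (ij : 'I_n * 'I_n) y => ij.1 != ij.2 ->
    tnth (of_coords y) ij.1 != tnth (of_coords y) ij.2) (nbhs x)) => ij;
      have [e|ij'] := boolP (ij.1 != ij.2); last first.
  by apply: filterE => y.
have := open_coords_neq e; rewrite /open_coords openE => /(_ x (hx ij e)).
by apply: filterS => y + _.
Qed.

Lemma open_coords_conf n : open_coords [set z : n.-tuple C | (0 < n)%N && uniq z].
Proof.
by have := @open_coords_uniq n; case: n.
Qed.

Lemma open_coords_mulmx m n (B : 'M[R]_(m, n)) (D : set (n.-tuple C)) :
  open_coords D -> open_coords [set z | D (mulmx_tuple B z)].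
Proof.
move=> oD; rewrite /open_coords.
have -> : [set x | [set z | D (mulmx_tuple B z)] (of_coords x)] =
   (fun x => x *m block_mx B 0 0 B) @^-1` [set x | D (of_coords x)].
  by apply/funext => x /=; rewrite of_coords_mulmx.
apply: open_comp => // x _; apply: differentiable_continuous; exact: differentiable_mulmxr.
Qed.

Definition to_coords n (z : n.-tuple C) : 'rV[R]_(n + n) :=
  row_mx (\row_j Re (tnth z j)) (\row_j Im (tnth z j)).

Lemma to_coordsK n : cancel (@to_coords n) (@of_coords R n).
Proof.
move=> z; apply: eq_from_tnth => j; rewrite tnth_mktuple row_mxEl row_mxEr !mxE.
by case: (tnth z j).
Qed.

(** Differentiability in 2n real variables, read along a complex direction [d]. Additivity in [d] is
    what later splits the derivative along a common translation of all points into the derivatives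
    in the single points. *)
Lemma smooth_on_wirt n (D : set (n.-tuple C)) f z : open_coords D -> smooth_on D f -> D z ->
  exists A B : n.-tuple C -> C,
  (forall d d', A [tuple tnth d j + tnth d' j | j < n] = A d + A d' /\
                B [tuple tnth d j + tnth d' j | j < n] = B d + B d') /\
  forall d, wirt (fun t => f [tuple tnth z j + t * tnth d j | j < n]) 0 (A d) (B d).
Proof.
move=> oD hf Dz; have [[/= dR _] [/= dI _]] := hf 1%N.
pose x := to_coords z.
have Ux : [set x : 'rV[R]_(n + n) | D (of_coords x)] x by rewrite /= to_coordsK.
have {}dR := dR x Ux; have {}dI := dI x Ux.
set fR := (fun x => Re (f (of_coords x))) in dR; set fI := (fun x => Im (f (of_coords x))) in dI.
pose L (v : 'rV[R]_(n + n)) : C := ('d fR x v +i* 'd fI x v)%C.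
have aux (lR lI : {linear 'rV[R]_(n + n) -> R}) :
    (forall v w, (lR (v + w) +i* lI (v + w))%C = (lR v +i* lI v)%C + (lR w +i* lI w)%C :> C) /\
    (forall a v, (lR (a *: v) +i* lI (a *: v))%C = a%:C%C * (lR v +i* lI v)%C :> C).
  by split=> [v w|a v]; [rewrite !raddfD | rewrite !linearZ /=; simpc].
have [LD LZ] := aux ('d fR x) ('d fI x).
have {}LD v w : L (v + w) = L v + L w := LD v w.
have {}LZ (a : R) v : L (a *: v) = a%:C%C * L v := LZ a v.
clear aux.
pose id_ (d : n.-tuple C) : n.-tuple C := [tuple 'i%C * tnth d j | j < n].
(* The complex-linear and antilinear parts of the real differential [L], which sees multiplication
   by i through [id_]. *)
exists (fun d => (L (to_coords d) - 'i%C * L (to_coords (id_ d))) / 2),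
       (fun d => (L (to_coords d) + 'i%C * L (to_coords (id_ d))) / 2); split.
  move=> d d'.
  have tcD (e e' : n.-tuple C) : to_coords [tuple tnth e j + tnth e' j |
    j < n] = to_coords e + to_coords e'.
    rewrite /to_coords add_row_mx; congr row_mx; apply/rowP => j; rewrite !mxE tnth_mktuple;
      by case: (tnth e j) (tnth e' j) => [? ?] [? ?].
  have idD : id_ [tuple tnth d j + tnth d' j | j < n] = [tuple tnth (id_ d) j + tnth (id_ d') j |
    j < n].
    by apply: eq_from_tnth => j; rewrite !tnth_mktuple mulrDr.
  rewrite idD !tcD !LD; split; ring.
move=> d; set v1 := to_coords d; set v2 := to_coords (id_ d).
(* The displacement [t d = Re t d + Im t (i d)] in real coordinates. *)
pose h (t : C) : 'rV[R]_(n + n) := Re t *: v1 + Im t *: v2.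
have hE t : f [tuple tnth z j + t * tnth d j | j < n] = (fR (h t + x) +i* fI (h t + x))%C.
  have e : [tuple tnth z j + t * tnth d j | j < n] = of_coords (h t + x).
    apply: eq_from_tnth => j; rewrite /h /v1 /v2 /x.
    have := congr1 (fun u => tnth u j) (to_coordsK (id_ d)).
    rewrite tnth_mktuple -{1}(to_coordsK z) -{2 3}(to_coordsK d).
    move: (to_coords d) (to_coords (id_ d)) (to_coords z) => a b c.
    rewrite !tnth_mktuple !mxE => -[e1 e2]; rewrite e1 e2.
    by case: (t) => [? ?]; simpc; congr (_ +i* _)%C => /=; ring.
  by rewrite /fR /fI -e; case: (f _).
have hL t : L (h t) = (L v1 - 'i%C * L v2) / 2 * t + (L v1 + 'i%C * L v2) / 2 * conjc t.
  rewrite LD !LZ.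
  have n2 : (2 : C) != 0 by rewrite pnatr_eq0.
  apply: (mulIf n2).
  have e1 : (Re t)%:C%C * 2 = t + conjc t by rewrite addcJ mulrC.
  have e2 : (Im t)%:C%C * 2 = - 'i%C * (t - conjc t).
    rewrite subcJ; have -> : - 'i%C * (2%:R * (Im t)%:C%C * 'i%C) = - ('i%C * 'i%C) * (2 * (Im
      t)%:C%C) by ring.
    by rewrite sqr_imag opprK mul1r mulrC.
  rewrite mulrDl [_ * _ * 2]mulrAC e1 [(Im t)%:C%C * _ * 2]mulrAC e2 mulrDl.
  have e3 (a b c : C) : (a / 2 * t + b / 2 * c) * 2 = (a / 2 * 2) * t + (b / 2 * 2) * c by ring.
  rewrite e3 !divfK //; ring.
have hn t : `|h t| <= (`|v1| + `|v2|) * normc t.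
  apply: le_trans (ler_normD _ _) _; rewrite !normrZ mulrDl.
  rewrite ![_ * normc t]mulrC.
  by apply: lerD; rewrite ler_wpM2r // ?normc_Re ?normc_Im.
have small (g : 'rV[R]_(n + n) -> R) (dg : differentiable g x) (e : R) : 0 < e ->
   exists2 r : R, 0 < r & forall t, normc t < r ->
     `|g (h t + x) - g x - 'd g x (h t)| <= e * normc t.
  move=> e0; have K0 : 0 < `|v1| + `|v2| + 1 by rewrite ltr_wpDl // addr_ge0.
  have [_ /eqaddoP eg] := (diff_locallyP _ _).1 dg.
  have /nbhs_ballP [r r0 hr] := eg _ (divr_gt0 e0 K0).
  exists (r / (`|v1| + `|v2| + 1)); first by rewrite divr_gt0.
  move=> t; rewrite ltr_pdivlMr // => ht.
  have hh : `|h t| <= normc t * (`|v1| + `|v2| + 1).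
    by apply: le_trans (hn t) _; rewrite mulrC ler_wpM2l ?normc_ge0 // lerDl.
  have hb : ball (0 : 'rV[R]_(n + n)) r (h t).
    by rewrite -ball_normE /= sub0r normrN; exact: le_lt_trans ht.
  have := hr _ hb; rewrite !fctE /= => hr'.
  rewrite -addrA -opprD; apply: le_trans hr' _.
  by rewrite mulrAC ler_pdivrMr // -mulrA ler_wpM2l // ltW.
apply: wirt_o => e e0; have e2 : 0 < e / 2 by rewrite divr_gt0.
have [r1 r10 h1] := small _ dR _ e2; have [r2 r20 h2] := small _ dI _ e2.
exists (Num.min r1 r2); first by rewrite lt_min r10.
move=> t; rewrite lt_min => /andP[/h1 {}h1 /h2 {}h2].
rewrite add0r -hL !hE; have -> : h 0 = 0 by rewrite /h /= !scale0r addr0.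
rewrite add0r; apply: le_trans (normc_le_ReIm _) _.
rewrite [e * _](_ : _ = e / 2 * normc t + e / 2 * normc t); last by rewrite -mulrDl -splitr.
rewrite /L; move: h1 h2; move: ('d fR x (h t)) ('d fI x (h t)) => k l.
move: (fR (h t + x)) (fI (h t + x)) (fR x) (fI x) => a1 b1 a2 b2 h1 h2.
exact: lerD.
Qed.

End SmoothFunctions.

(** * Correlators and their covariance under translations *)

Section Sequences.
Variable T : nmodType.

(** Cuts or pads with 0. Working with lists turns lengths such as [(k + l).-1] from type indices
    into provable equations. *)
Definition ntup n (s : seq T) : n.-tuple T := [tuple nth 0 s i | i < n].

Lemma ntupK n (t : n.-tuple T) : ntup n t = t.
Proof. by apply: eq_from_tnth => i; rewrite tnth_mktuple (tnth_nth 0). Qed.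

Lemma val_ntup n (s : seq T) : size s = n -> val (ntup n s) = s.
Proof.
move=> e; apply: (@eq_from_nth _ 0); rewrite size_tuple ?e // => i ilt.
by have := tnth_nth 0 (ntup n s) (Ordinal ilt); rewrite tnth_mktuple /= => <-.
Qed.

Lemma val_upd n (u : n.-tuple T) (i : 'I_n) x : val (upd u i x) = splice i u [:: x].
Proof.
have ilt := ltn_ord i.
apply: (@eq_from_nth _ 0).
  by rewrite size_tuple /splice !size_cat size_take size_drop size_tuple ilt /=; lia.
move=> j; rewrite size_tuple => jlt.
have := tnth_nth 0 (upd u i x) (Ordinal jlt); rewrite tnth_mktuple -val_eqE /= => <-.
rewrite /splice.
rewrite nth_cat size_take size_tuple ilt; case: ltngtP => ij.
- by rewrite nth_take // (tnth_nth 0).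
- have -> : (j - i)%N = (j - i).-1.+1 by lia.
  by rewrite /= nth_drop (tnth_nth 0) /=; congr nth; lia.
- by rewrite ij subnn.
Qed.

Lemma splice_cat (s t : seq T) x v : splice (size s) (s ++ x :: t) v = s ++ v ++ t.
Proof. by rewrite /splice take_size_cat // drop_cat ltnNge leqnSn /= subSnn drop1. Qed.

Lemma size_splice_seq i (s v : seq T) : (i < size s)%N ->
  size (splice i s v) = (size s + size v).-1.
Proof. by move=> h; rewrite /splice !size_cat size_take size_drop h; lia. Qed.

End Sequences.

Section SequenceCorrelators.
Variable R : realType.
Local Notation C := R[i].
Variable F : ffa_data R.
Local Notation gr := (@ffa_gr _ F).

(* m_n as a total function of sequences, 0 when the points are not distinct. *)
Definition mseq (u : seq F) (z : seq C) : R * R -> F :=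
  oapp (fun c : conf R (size z) => ffa_m (ntup (size z) u) c) (fun=> 0) (insub (in_tuple z)).

Lemma conf_ex n (z : seq C) : size z = n -> z != [::] -> uniq z ->
  exists c : conf R n, val (val c) = z.
Proof.
move=> e z0 uz; subst n.
have h : (0 < size z)%N && uniq (in_tuple z) by rewrite lt0n size_eq0 z0.
by exists (exist _ (in_tuple z) h).
Qed.

Lemma mseqE n (u : seq F) (c : conf R n) (z : seq C) : z = val (val c) ->
  mseq u z = ffa_m (ntup n u) c.
Proof.
move=> e; have sz : size z = n by rewrite e size_tuple.
subst n; rewrite /mseq.
have e' : in_tuple z = val c by apply: val_inj.
by rewrite e' valK.
Qed.

Lemma mseqT n (u : n.-tuple F) (c : conf R n) : mseq u (val (val c)) = ffa_m u c.
Proof. by rewrite (mseqE _ (erefl _)) ntupK. Qed.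

Lemma mseq_tuple n (U : n.-tuple F) (c : conf R n) (u : seq F) (z : seq C) :
  u = val U -> z = val (val c) -> mseq u z = ffa_m U c.
Proof. by move=> -> ->; rewrite mseqT. Qed.

Lemma mseq_degenerate (u : seq F) (z : seq C) : ~~ ((z != [::]) && uniq z) -> mseq u z = fun=> 0.
Proof.
move=> h; rewrite /mseq insubF //=; apply/negbTE; apply: contra h.
by rewrite lt0n size_eq0.
Qed.

Lemma corr_mseq (w : rdual gr) n (u : n.-tuple F) (z : n.-tuple C) :
  ffa_corr w u z = pairing w (mseq u z).
Proof.
rewrite /ffa_corr; case: insubP => [c _ <- /=|]; first by rewrite mseqT.
move=> h /=; rewrite mseq_degenerate; last first.
  by move: h; rewrite lt0n -size_eq0 size_tuple.
by rewrite /pairing big1 // => i _; rewrite raddf0.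
Qed.

Definition act (c : C) : F -> F :=
  gmap gr (fun pq u => chi (- pq.1%:C%C) (- pq.2%:C%C) c *: u).

(* The part of is_ffa that does not involve d^L, d^R, D^L and D^R. *)
Record is_precore : Prop := IsPrecore {
  pre_grading : direct_sum gr;
  pre_findim : forall pq, findim (gr pq);
  pre_lower : exists N : R, forall p q, p < N \/ q < N -> forall u, gr (p, q) u -> u = 0;
  pre_homogeneous : forall n (u : n.-tuple F) z pq, gr pq (ffa_m u z pq);
  pre_multilinear : forall n (z : conf R n), multilinear (fun u : n.-tuple F => ffa_m u z);
  pre_smooth : forall n (u : n.-tuple F) (w : rdual gr),
    smooth_on [set z : n.-tuple C | (0 < n)%N && uniq z] (ffa_corr w u);
  pre_identity1 : forall (u : F) (z : conf R 1), val z = [tuple 0] ->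
    embeds gr (ffa_m [tuple u] z) u;
  pre_identity : forall n (u : n.-tuple F) (z : conf R n) (z' : conf R n.+1) zn,
    val z' = [tuple of rcons (val z) zn] ->
    ffa_m [tuple of rcons u (@ffa_one _ F)] z' = ffa_m u z;
  pre_convergence : forall k l (i : 'I_k) (u : k.-tuple F) (v : l.-tuple F)
      (z : conf R k) (zeta : conf R l) (z' : conf R (k + l).-1),
    let zi := tnth (val z) i in
    (forall (s : 'I_l) (j : 'I_k), j != i ->
      `|tnth (val zeta) s| < `|zi - tnth (val z) j|) ->
    val z' = splice_tuple i (val z) (map_tuple (fun x => zi + x) (val zeta)) ->
    forall w : rdual gr,
    sums_absolutely
      (fun pq : R * R => pairing w (ffa_m (upd u i (ffa_m v zeta pq)) z))
      (pairing w (ffa_m (splice_tuple i u v) z'));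
  pre_permutation : forall n (s : 'S_n) (u : n.-tuple F) (z z' : conf R n),
    val z' = permute s (val z) -> ffa_m (permute s u) z' = ffa_m u z }.

(* The conditions common to both sides: covariance under rescaling replaces the brackets
   with d^L and d^R, and core_degrees the ones with D^L and D^R. *)
Record is_core : Prop := IsCore {
  core_pre : is_precore;
  core_int : forall p q u, gr (p, q) u -> u != 0 -> exists k : int, p - q = k%:~R;
  core_one : gr (0, 0) (@ffa_one _ F);
  core_scaling : forall c u z p q, c != 0 -> size u = size z ->
    chi (- p%:C%C) (- q%:C%C) c *: mseq u z (p, q) =
      mseq (map (act c) u) (map (fun x => x / c) z) (p, q);
  core_degrees : forall p q u t r s, gr (p, q) u -> mseq [:: u] [:: t] (r, s) != 0 ->
    exists i j : nat, r = p + i%:R /\ s = q + j%:R }.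

Section ActionOfScalars.
Hypothesis dG : direct_sum gr.

Lemma linear_chi pq c : linear (fun u : F => chi (- pq.1%:C%C) (- pq.2%:C%C) c *: u : F).
Proof. by move=> a u v; rewrite scalerDr !scalerA mulrC. Qed.

Lemma act_linear c : linear (act c).
Proof. by apply: (gmap_linear dG) => pq; exact: linear_chi. Qed.

Lemma act_homog c p q u : gr (p, q) u -> act c u = chi (- p%:C%C) (- q%:C%C) c *: u.
Proof. by move=> h; rewrite /act (gmap_homog dG _ h) // => i; rewrite scaler0. Qed.

Lemma component_act c u p q : component gr (act c u) (p, q) =
  chi (- p%:C%C) (- q%:C%C) c *: component gr u (p, q).
Proof.
rewrite /act (component_gmap dG) => [//|pq|pq x Gx].
- exact: linear_chi.
- by apply: subspace_scal => //; have [] := dG.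
Qed.

End ActionOfScalars.

Lemma precore_of_ffa : is_ffa F -> is_precore.
Proof. by case=> *; split. Qed.

Hypothesis pF : is_precore.
Let dG := pre_grading pF.

Lemma mseq_homog u z pq : gr pq (mseq u z pq).
Proof.
rewrite /mseq; case: insub => [c|] /=; first exact: pre_homogeneous.
exact: homog0.
Qed.

Lemma mseq_lin s t a x y z pq : size z = (size s + size t).+1 ->
  mseq (s ++ (a *: x + y) :: t) z pq = a *: mseq (s ++ x :: t) z pq + mseq (s ++ y :: t) z pq.
Proof.
move=> sz; have [/andP[z0 uz]|h] := boolP ((z != [::]) && uniq z); last first.
  by rewrite !(mseq_degenerate _ h) scaler0 addr0.
have [c ec] := conf_ex (erefl (size z)) z0 uz.
rewrite !(mseqE _ (esym ec)).
have lt : (size s < size z)%N by rewrite sz ltnS leq_addr.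
have e w : ntup (size z) (s ++ w :: t) = upd (ntup (size z) (s ++ 0 :: t)) (Ordinal lt) w.
  apply: val_inj; rewrite val_upd !val_ntup ?size_cat /= ?addnS //.
  by rewrite splice_cat.
by rewrite (e (a *: x + y)) (e x) (e y) pre_multilinear.
Qed.

Lemma mseq_identity1 u : embeds gr (mseq [:: u] [:: 0]) u.
Proof.
have [//|//|c ec] := @conf_ex 1 [:: 0] (erefl _).
rewrite (mseqE _ (esym ec)); have -> : ntup 1 [:: u] = [tuple u].
  by apply: val_inj; rewrite val_ntup.
by apply: pre_identity1 => //; apply: val_inj.
Qed.

Lemma mseq_identity u z t : size u = size z -> z != [::] -> uniq (rcons z t) ->
  mseq (rcons u (@ffa_one _ F)) (rcons z t) = mseq u z.
Proof.
move=> su z0 uzt; have uz : uniq z by move: uzt; rewrite rcons_uniq => /andP[].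
have [c ec] := conf_ex (erefl (size z)) z0 uz.
have [||c' ec'] := @conf_ex (size z).+1 (rcons z t) _ _ uzt; rewrite ?size_rcons //.
  by case: (z).
rewrite (mseq_tuple (esym (val_ntup su)) (esym ec)).
rewrite -(@pre_identity pF _ _ c c' t); last by apply: val_inj; rewrite /= ec' ec.
apply: mseq_tuple => //; congr rcons; exact/esym/val_ntup.
Qed.

(** The convergence condition already keeps the inserted points away from the remaining ones: a
    coincidence would make its strict inequality an equality. *)
Lemma uniq_insertion i (z zeta : seq C) : (i < size z)%N -> uniq z -> uniq zeta ->
  (forall s j, s \in zeta -> (j < size z)%N -> j != i ->
    normc s < normc (nth 0 z i - nth 0 z j)) ->
  uniq (splice i z [seq nth 0 z i + x | x <- zeta]).
Proof.
move=> iz uz uze h; apply: (@splice_uniq _ 0) => //.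
  by rewrite map_inj_uniq //; exact: addrI.
move=> x j /mapP[s sz ->] jz ji; have := h s j sz jz ji.
by apply: contraTneq => <-; rewrite opprD addNKr normcN' ltxx.
Qed.

Lemma mseq_convergence i u v z zeta : (i < size z)%N -> size u = size z -> size v = size zeta ->
  zeta != [::] -> uniq z -> uniq zeta ->
  (forall s j, s \in zeta -> (j < size z)%N -> j != i ->
    normc s < normc (nth 0 z i - nth 0 z j)) ->
  forall w : rdual gr, sums_absolutely
    (fun pq => pairing w (mseq (splice i u [:: mseq v zeta pq]) z))
    (pairing w (mseq (splice i u v) (splice i z [seq nth 0 z i + x | x <- zeta]))).
Proof.
move=> iz su sv ze0 uz uze h w.
have z0 : z != [::] by case: (z) iz.
have [c ec] := conf_ex (erefl (size z)) z0 uz.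
have [d ed] := conf_ex (erefl (size zeta)) ze0 uze.
have us := uniq_insertion iz uz uze h.
have [||e ee] := @conf_ex (size z + size zeta).-1 _ _ _ us.
- by rewrite size_splice_seq // size_map.
- by rewrite -size_eq0 size_splice_seq // size_map; case: (zeta) ze0 => //= *; rewrite addnS /=;
    case: (z) iz.
have zi : tnth (val c) (Ordinal iz) = nth 0 z i by rewrite (tnth_nth 0) ec.
have := @pre_convergence pF _ _ (Ordinal iz) (ntup _ u) (ntup _ v) c d e.
rewrite /= zi => /(_ _ _ w) H.
have {H} H : sums_absolutely _ _ := H _ _.
have vu : tval (ntup (size z) u) = u := val_ntup su.
have vv : tval (ntup (size zeta) v) = v := val_ntup sv.
rewrite (@mseq_tuple _ (splice_tuple (Ordinal iz) (ntup (size z) u) (ntup (size zeta) v)) e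
  (splice i u v) (splice i z [seq nth 0 z i + x | x <- zeta])) //; last by rewrite /= vu vv.
apply: eq_sums (H _ _) => [pq||].
- congr pairing; apply/funext => rs.
  rewrite (@mseq_tuple _ (ntup _ v) d v zeta) ?val_ntup //.
  by rewrite (@mseq_tuple _ (upd (ntup (size z) u) (Ordinal iz) (ffa_m (ntup (size zeta) v) d pq)) c
    (splice i u [:: ffa_m (ntup (size zeta) v) d pq]) z) // val_upd val_ntup.
- move=> s j ji; have ec' : tval (sval c) = z := ec.
  rewrite ltcE_normc [X in _ - X](tnth_nth 0) ec'; apply: h.
  + have ed' : tval (sval d) = zeta := ed.
    by rewrite -[X in _ \in X]ed'; exact: mem_tnth.
  + exact: ltn_ord.
  + by rewrite -val_eqE in ji.
- have ec' : tval (sval c) = z := ec.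
  have ed' : tval (sval d) = zeta := ed.
  by apply: val_inj; rewrite [LHS]ee /= ec' ed'.
Qed.

(** Vectors and points are permuted as one list of pairs; both sides vanish together when the points
    are not distinct. *)
Lemma mseq_permutation (l l' : seq (F * C)) : perm_eq l l' ->
  mseq (unzip1 l) (unzip2 l) = mseq (unzip1 l') (unzip2 l').
Proof.
move=> ll'; have [/andP[z0 uz]|h] := boolP ((unzip2 l' != [::]) && uniq (unzip2 l')); last first.
  rewrite (mseq_degenerate _ h) mseq_degenerate //; apply: contra h.
  have p2 := perm_map snd ll'.
  by rewrite (perm_uniq p2) -!size_eq0 (perm_size p2).
have /tuple_permP [s es] : perm_eq l (in_tuple l') by [].
have e1 : unzip1 l = permute s (map_tuple fst (in_tuple l')).
  by rewrite /unzip1 {1}es -map_comp /=; apply: eq_map => i /=; rewrite tnth_map.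
have e2 : unzip2 l = permute s (map_tuple snd (in_tuple l')).
  by rewrite /unzip2 {1}es -map_comp /=; apply: eq_map => i /=; rewrite tnth_map.
have [|c ec] := @conf_ex (size l') _ _ z0 uz; first by rewrite size_map.
have uz' : uniq (unzip2 l) by rewrite (perm_uniq (perm_map snd ll')).
have z0' : unzip2 l != [::] by rewrite -size_eq0 (perm_size (perm_map snd ll')) size_eq0.
have [|c' ec'] := @conf_ex (size l') _ _ z0' uz'; first by rewrite size_map (perm_size ll').
rewrite (mseq_tuple e1 (esym ec')) (@mseq_tuple _ (map_tuple fst (in_tuple l')) c) //.
apply: pre_permutation => //; apply: val_inj; rewrite ec' e2; congr (val (permute s _)).
by apply: val_inj; rewrite /= ec.
Qed.

Lemma mseq_swap u v x y : mseq [:: u; v] [:: x; y] = mseq [:: v; u] [:: y; x].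
Proof. by rewrite -[LHS](@mseq_permutation [:: (v, y); (u, x)] [:: (u, x);
  (v, y)]) // (perm_catC [:: _] [:: _]). Qed.

(** Carries facts about m_2, the correlator in the bracket axioms, over to m_1. *)
Lemma mseq_one1 u t : t != 0 -> mseq [:: u; @ffa_one _ F] [:: t; 0] = mseq [:: u] [:: t].
Proof. by move=> t0; rewrite -(@mseq_identity [:: u] [:: t] 0) //= inE t0. Qed.

Lemma mseq_wirt n (w : rdual gr) (u : seq F) (z : seq C) : size u = n -> size z = n ->
  z != [::] -> uniq z ->
  exists A B : n.-tuple C -> C,
  (forall d d', A [tuple tnth d j + tnth d' j | j < n] = A d + A d' /\
                B [tuple tnth d j + tnth d' j | j < n] = B d + B d') /\
  forall d : n.-tuple C,
    wirt (fun t => pairing w (mseq u [seq nth 0 z j + t * nth 0 d j |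
      j <- iota 0 n])) 0 (A d) (B d).
Proof.
move=> su sz z0 uz; have vz : tval (ntup n z) = z := val_ntup sz.
have [|A [B [hAB hw]]] := smooth_on_wirt (z :=
  ntup n z) (@open_coords_conf R n) (pre_smooth pF (ntup n u) w).
  by change ((0 < n)%N && uniq (tval (ntup n z))); rewrite vz uz -sz lt0n size_eq0 z0.
exists A, B; split=> // d; apply: eq_wirt (hw d) => // t.
rewrite corr_mseq; congr (pairing w (mseq _ _)); first exact: val_ntup.
rewrite -val_enum_ord -map_comp; apply: eq_map => j.
by rewrite [X in X + _](tnth_nth 0) [X in _ * X](tnth_nth 0) vz.
Qed.

(** A single point is subject to no condition, so m_1 is smooth at 0 as well, where the identity
    axiom gives its value. *)
Lemma m1_continuous (w : rdual gr) u : lim0 (fun t => pairing w (mseq [:: u] [:: t])) (w u).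
Proof.
have [||A [B [_ hw]]] := @mseq_wirt 1 w [:: u] [:: 0] erefl erefl => //.
have := wirt_cont (hw [tuple 1]); rewrite /= mul0r addr0.
rewrite (pairing_embeds w (mseq_identity1 u)).
have -> // : (fun t => pairing w (mseq [:: u] [:: 0 + (0 + t) * 1])) =
  (fun t => pairing w (mseq [:: u] [:: t])).
by apply/funext => t; rewrite !add0r mulr1.
Qed.

Lemma mseq2_linl (v : F) z pq : size z = 2 -> linear (fun u => mseq [:: u; v] z pq).
Proof. by move=> sz a x y; apply: (@mseq_lin [::] [:: v]). Qed.

Lemma mseq2_linr (u : F) z pq : size z = 2 -> linear (fun v => mseq [:: u; v] z pq).
Proof. by move=> sz a x y; apply: (@mseq_lin [:: u] [::]). Qed.

(* The components of D^L^i D^R^j / (i! j!), as those of u |-> m_1(u; 1). *)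
Definition shiftop (i j : nat) : F -> F :=
  gmap gr (fun pq u => mseq [:: u] [:: 1] (pq.1 + i%:R, pq.2 + j%:R)).

Lemma linear_m1 t pq : linear (fun u : F => mseq [:: u] [:: t] pq).
Proof. by move=> a u v; exact: (@mseq_lin [::] [::]). Qed.

Lemma shiftop_linear i j : linear (shiftop i j).
Proof. by apply: (gmap_linear dG) => pq; exact: linear_m1. Qed.

Lemma shiftopE i j p q u : gr (p, q) u -> shiftop i j u = mseq [:: u] [:: 1] (p + i%:R, q + j%:R).
Proof.
by move=> h; rewrite /shiftop (gmap_homog dG _ h) // => pq; apply: (linear0 (linear_m1 _ _)).
Qed.

Lemma shiftop_homog i j p q u : gr (p, q) u -> gr (p + i%:R, q + j%:R) (shiftop i j u).
Proof. by move=> h; rewrite (shiftopE _ _ h); exact: mseq_homog. Qed.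

End SequenceCorrelators.

(** * Rescaling and translation of the correlators of a core *)

Section CoreTheory.
Variable R : realType.
Local Notation C := R[i].
Variable F : ffa_data R.
Local Notation gr := (@ffa_gr _ F).
Hypothesis cF : is_core F.
Let pF := core_pre cF.
Let dG := pre_grading pF.

Lemma chi_int p q (u : F) : gr (p, q) u -> u != 0 ->
  exists k : int, - p%:C%C - - q%:C%C = k%:~R :> C.
Proof.
move=> Gu u0; have [k hk] := core_int cF Gu u0; exists (- k).
by rewrite opprK addrC -rmorphB /= -opprB hk rmorphN /= mulrNz rmorph_int.
Qed.

Lemma act1 (u : F) : act 1 u = u.
Proof.
apply: (component_inj dG); apply/funext => -[p q].
by rewrite (component_act dG) chi1 scale1r.
Qed.

Lemma actM c d (u : F) : c != 0 -> d != 0 -> act (c * d) u = act c (act d u).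
Proof.
move=> c0 d0; apply: (component_inj dG); apply/funext => -[p q].
(* [chiM] asks for an integral difference of the degrees, which [chi_int] provides where the
   component is not 0. *)
rewrite !(component_act dG) scalerA; have [->|u0] := eqVneq (component gr u (p, q)) 0.
  by rewrite !scaler0.
have [k hk] := chi_int (component_in dG u (p, q)) u0.
by rewrite (chiM c0 d0 hk).
Qed.

Lemma act_one c : act c (@ffa_one _ F) = @ffa_one _ F.
Proof. by rewrite (act_homog dG c (core_one cF)) oppr0 chi0 scale1r. Qed.

(** In m_2(1, 1; t, 0) either vacuum can be forgotten, so a single vacuum moves from [t] to 0. *)
Lemma mseq_one t : embeds gr (mseq [:: @ffa_one _ F] [:: t]) (@ffa_one _ F).
Proof.
have [->|t0] := eqVneq t 0; first exact: mseq_identity1.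
rewrite -(mseq_one1 pF _ t0) (mseq_swap pF).
rewrite -[X in embeds _ X _](_ : mseq [:: @ffa_one _ F] [:: 0] = _); first exact: mseq_identity1.
by rewrite -(@mseq_identity _ _ pF [:: _] [:: 0] t) //= inE eq_sym t0.
Qed.

(** Rescaling by [t^-1] carries the point 1 to [t]; of the characters only [chi i j t] remains, a
    monomial because [i] and [j] are natural numbers. *)
Lemma m1_shift i j p q u t : t != 0 -> gr (p, q) u ->
  mseq [:: u] [:: t] (p + i%:R, q + j%:R) = (t ^+ i * conjc t ^+ j) *: shiftop i j u.
Proof.
move=> t0 Gu; rewrite (shiftopE pF _ _ Gu).
have [->|u0] := eqVneq u 0.
  by rewrite !(linear0 (linear_m1 pF _ _)) scaler0.
have ti0 : t^-1 != 0 by rewrite invr_neq0.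
have := @core_scaling _ _ cF t^-1 [:: u] [:: 1] (p + i%:R) (q + j%:R) ti0 erefl.
rewrite /= invrK mul1r (act_homog dG _ Gu) (linear_scal _ _ (linear_m1 pF _ _)).
move=> /(congr1 (fun x => (chi (- p%:C%C) (- q%:C%C) t^-1)^-1 *: x)).
rewrite !scalerA mulVf ?chi_neq0 // scale1r => <-.
rewrite -chiN -chiD !opprK !rmorphD /= !rmorph_nat.
have -> : p%:C%C + - (p%:C%C + i%:R) = - i%:R :> C by ring.
have -> : q%:C%C + - (q%:C%C + j%:R) = - j%:R :> C by ring.
have ij : (i%:R - j%:R : C) = (i%:Z - j%:Z)%:~R by rewrite rmorphB.
rewrite chiN -(chiV _ ij) //; first by rewrite invrK chi_nat.
Qed.

(** By [m1_shift] the component of m_1(x; t) in the degree of x is the same for all nonzero t;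
    continuity at 0 identifies it with x. *)
Lemma shiftop00 (u : F) : shiftop 0 0 u = u.
Proof.
apply: (linear_ext dG (S := shiftop 0 0) (T := id)) => //; first exact: shiftop_linear.
move=> [p q] x Gx; have := shiftop_homog pF 0 0 Gx; rewrite !addr0 => Gs.
apply: (homog_ext dG (pre_findim pF (p, q))) => // w sw.
apply: lim0_off (m1_continuous pF w x) _ => t t0.
have := m1_shift 0 0 t0 Gx; rewrite !addr0 mul1r scale1r => <-.
by rewrite (pairing_at _ sw).
Qed.

Lemma m1_shiftE i j p q u t : gr (p, q) u ->
  mseq [:: u] [:: t] (p + i%:R, q + j%:R) = (t ^+ i * conjc t ^+ j) *: shiftop i j u.
Proof.
move=> Gu; have [->|t0] := eqVneq t 0; last exact: m1_shift.
rewrite -(component_eq dG (mseq_identity1 pF u)) (component_homog dG _ Gu).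
case: i j => [|i] [|j].
- by rewrite !addr0 eqxx expr0 expr0 mulr1 scale1r shiftop00.
- rewrite xpair_eqE -[X in _ && (_ == X)]addr0 (inj_eq (addrI q)) pnatr_eq0 andbF.
  by rewrite conjc0 [0 ^+ j.+1]exprS mul0r mulr0 scale0r.
- rewrite xpair_eqE -[X in (_ == X) && _]addr0 (inj_eq (addrI p)) pnatr_eq0 /=.
  by rewrite exprS !mul0r scale0r.
- rewrite xpair_eqE -[X in (_ == X) && _]addr0 (inj_eq (addrI p)) pnatr_eq0 /=.
  by rewrite exprS !mul0r scale0r.
Qed.

(** A correlator inserted into m_1 meets no other point, so the expansion converges for all [zeta]
    and [t]. Degrees only rise under m_1 and are bounded below, which makes it finite, with a bound
    depending on (r, s) alone. *)
Lemma translation (r s : R) : exists N : nat, forall (v : seq F) zeta t, size v = size zeta ->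
  mseq v [seq t + x | x <- zeta] (r, s) = \sum_(k : 'I_N.+2 * 'I_N.+2)
    (t ^+ k.1 * conjc t ^+ k.2) *: shiftop k.1 k.2 (mseq v zeta (r - k.1%:R, s - k.2%:R)).
Proof.
have [M hM] := pre_lower pF.
(* Lowering a degree by [N] leads below the bound [M]. The form [N0.+2] guarantees the indices 0 and
   1 of the first-order terms. *)
pose N0 := addn (Num.truncn `|r - M|) (Num.truncn `|s - M|); pose N := N0.+2.
have hN : r - N%:R < M /\ s - N%:R < M.
  have h1 := truncnS_gt `|r - M|; have h2 := truncnS_gt `|s - M|.
  have n1 := ler_norm (r - M); have n2 := ler_norm (s - M).
  have e1 : (Num.truncn `|r - M|).+1%:R <= N%:R :> R by rewrite ler_nat ltnS leqW // leq_addr.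
  have e2 : (Num.truncn `|s - M|).+1%:R <= N%:R :> R by rewrite ler_nat ltnS leqW // leq_addl.
  by split; lra.
exists N0 => v zeta t sv; rewrite -/N.
have [/andP[ze0 uze]|deg] := boolP ((zeta != [::]) && uniq zeta); last first.
  rewrite (mseq_degenerate _ deg) mseq_degenerate; last first.
    by rewrite map_inj_uniq ?(inj_eq _) -?size_eq0 ?size_map ?size_eq0 //; exact: addrI.
  by rewrite big1 // => k _; rewrite (linear0 (shiftop_linear pF _ _)) scaler0.
have sG : forall i, subspace (gr i) by have [] := dG.
have Gk (k : 'I_N * 'I_N) : gr (r, s) (shiftop k.1 k.2 (mseq v zeta (r - k.1%:R, s - k.2%:R))).
  have := shiftop_homog pF k.1 k.2 (mseq_homog pF v zeta (r - k.1%:R, s - k.2%:R)).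
  by rewrite !subrK.
apply: (homog_ext dG (pre_findim pF (r, s))).
- exact: mseq_homog.
- by apply: subspace_sum => // k; apply: subspace_scal.
move=> w sw.
have := @mseq_convergence _ _ pF 0 [:: 0] v [:: t] zeta isT erefl sv ze0 isT uze.
have h : forall (x : C) (j : nat), x \in zeta -> (j < 1)%N -> j != 0%N ->
   normc x < normc (t - nth 0 [:: t] j) by move=> x [|j].
move=> /(_ h w); rewrite /splice /= !cats0 => H.
pose fl (k : 'I_N * 'I_N) := (r - k.1%:R, s - k.2%:R).
have fl_inj : injective fl.
  move=> [i j] [i' j'] [/addrI/oppr_inj/eqP + /addrI/oppr_inj/eqP]; rewrite !eqr_nat.
  by move=> /eqP/val_inj -> /eqP/val_inj ->.
pose A := seq_fset tt [seq fl k | k <- index_enum ('I_N * 'I_N)%type].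
have := sums_finite_eq (A := A) _ H.
rewrite (pairing_at _ sw) => ->.
  rewrite (perm_big _ (seq_fset_perm _ _)) undup_id ?map_inj_uniq ?index_enum_uniq //.
  rewrite big_map linear_sum; apply: eq_bigr => k _; rewrite (pairing_at _ sw).
  congr (w _); rewrite -(m1_shiftE _ _ _ (mseq_homog pF v zeta (fl k))) /= .
  by rewrite !subrK.
move=> [p q] pqA; rewrite (pairing_at _ sw).
have [->|n0] := eqVneq (mseq [:: mseq v zeta (p, q)] [:: t] (r, s)) 0; first by rewrite raddf0.
have [i [j [er es]]] := core_degrees cF (mseq_homog pF v zeta (p, q)) n0.
have z0 : mseq v zeta (p, q) = 0 -> w (mseq [:: mseq v zeta (p, q)] [:: t] (r, s)) = 0.
  by move=> ->; rewrite (linear0 (linear_m1 pF _ _)) raddf0.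
case: (ltnP i N) => iN; last first.
  apply/z0/(hM p q) => //; last exact: mseq_homog.
  left; have : N%:R <= i%:R :> R by rewrite ler_nat.
  by have [h1 _] := hN; rewrite er in h1; lra.
case: (ltnP j N) => jN; last first.
  apply/z0/(hM p q) => //; last exact: mseq_homog.
  right; have : N%:R <= j%:R :> R by rewrite ler_nat.
  by have [_ h1] := hN; rewrite es in h1; lra.
case/negP: pqA; rewrite seq_fsetE; apply/mapP; exists (Ordinal iN, Ordinal jN).
  exact: mem_index_enum.
by rewrite /fl /= er es !addrK.
Qed.

End CoreTheory.

(** * From correlators to Khat-algebras *)

Section Weights.
Variable R : realType.
Local Notation C := R[i].

Definition weight_of (pq : R * R) : option (weight R) := insub (pq.1%:C%C, pq.2%:C%C).

Definition real_weight (M : weight R) : option (R * R) :=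
  if (Im (val M).1 == 0) && (Im (val M).2 == 0) then Some (Re (val M).1, Re (val M).2) else None.

Lemma real_weightP M pq : real_weight M = Some pq <-> val M = (pq.1%:C%C, pq.2%:C%C).
Proof.
rewrite /real_weight; split; last first.
  by move=> ->; rewrite /= !eqxx; case: pq.
case: ifP => // /andP[/eqP h1 /eqP h2] [<-] /=.
by case: M h1 h2 => [[[a b] [c d]] hM] /= -> ->.
Qed.

Lemma weight_pbij M pq : real_weight M = Some pq <-> weight_of pq = Some M.
Proof.
rewrite real_weightP /weight_of; split=> [<-|]; first by rewrite valK.
by case: insubP => // M' _ <- [->].
Qed.

Lemma weight_of_none p q (k : int) : weight_of (p, q) = None -> p - q <> k%:~R.
Proof.
rewrite /weight_of; case: insubP => // /asboolP h _ e; apply: h; exists k.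
by rewrite /= -rmorphB /= e rmorph_int.
Qed.

Lemma weight_int (M : weight R) : exists k : int, - (val M).1 - - (val M).2 = k%:~R.
Proof.
have /asboolP [k hk] := valP M; exists (- k); rewrite mulrNz -hk.
by rewrite opprB opprK addrC.
Qed.

End Weights.

Section KhatAlgebraOfCore.
Variable R : realType.
Local Notation C := R[i].
Variable F : ffa_data R.
Local Notation gr := (@ffa_gr _ F).

Definition actseq (s : seq C) (u : seq F) : seq F := [seq act x.1 x.2 | x <- zip s u].

(** The correlators start at n = 1; the nullary operation is the vacuum, placed in degree (0, 0). *)
Definition nuseq (u : seq F) (p : seq C) (a : C) (s : seq C) (pq : R * R) : F :=
  if p is [::] then if pq == (0, 0) then @ffa_one _ F else 0
  else mseq (actseq s u) [seq x - a | x <- p] pq.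

Definition kalg_of_ffa : kalg_data R := @KAlgData R F (fun c => act (val c))
  (fun n Q u M => oapp (nuseq u (kpts Q) (ka Q) (ks Q)) 0 (real_weight M)).

Local Notation K := kalg_of_ffa.

Hypothesis cF : is_core F.
Let pF := core_pre cF.
Let dG := pre_grading pF.

Lemma weight_of_int pq : weight_of pq = None -> forall u, gr pq u -> u = 0.
Proof.
case: pq => p q h u Gu; apply/eqP; apply: contraT => u0.
have [k hk] := core_int cF Gu u0; by case: (weight_of_none (k := k) h).
Qed.

(** A nonzero component of degree (p, q) of a vector of weight [M] transforms by two characters,
    which [chi_inj] identifies. So the vector has a single degree, and none when [M] is not real. *)
Lemma isotypicE : @isotypic _ K = regrade gr (@real_weight R).
Proof.
apply/funext => M; apply/funext => u; apply/propext; split; last first.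
  rewrite /regrade; case E : (real_weight M) => [[p q]|] /=.
    move/real_weightP : E => E Gu c; have [-> ->] : (val M).1 = p%:C%C /\
      (val M).2 = q%:C%C by rewrite E.
    exact: (act_homog dG _ Gu).
  by move=> -> c; rewrite scaler0; exact: (linear0 (act_linear dG _)).
move=> hu; have [k hk] := weight_int M.
have key pq : component gr u pq != 0 -> real_weight M = Some pq.
  case: pq => p q u0; apply/real_weightP.
  have [k' hk'] := chi_int cF (component_in dG u (p, q)) u0.
  suff [/oppr_inj e1 /oppr_inj e2] : (- (val M).1, - (val M).2) = (- p%:C%C, - q%:C%C) :> C * C.
    by rewrite [val M]surjective_pairing e1 e2.
  apply: (chi_inj hk hk') => c c0; have :=
    hu (exist _ c c0) => /(congr1 (fun x => component gr x (p, q))).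
  rewrite (component_act dG) (component_scal dG) => /eqP;
    rewrite -subr_eq0 -scalerBl scaler_eq0 (negPf u0) orbF subr_eq0.
  by move=> /eqP ->.
have [s [hs es]] := component_supp dG u.
rewrite /regrade; case E : (real_weight M) => [pq|] /=.
  rewrite (_ : u = component gr u pq); first exact: component_in.
  apply: (component_inj dG); apply/funext => pq'.
  rewrite (component_homog dG _ (component_in dG u pq)); case: eqP => [-> //|ne].
  by apply/eqP; apply: contraT => /key; rewrite E => -[e]; case: ne.
rewrite es big1_seq // => pq _; apply/eqP; apply: contraT => /key.
by rewrite E.
Qed.

Lemma regrade_dG : direct_sum (regrade gr (@real_weight R)).
Proof. exact: (regrade_direct_sum (@weight_pbij R) dG weight_of_int). Qed.

Lemma rdual_isotypic (w : rdual (@isotypic _ K)) : exists w' : rdual gr, w' =1 w /\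
  forall x, (forall pq, gr pq (x pq)) -> pairing w (fun M => oapp x 0 (real_weight M)) = pairing w'
    x.
Proof.
move: w; rewrite isotypicE => w.
have [w' e] := rdual_regrade (@weight_pbij R) weight_of_int w; exists w'; split=> // x hx.
exact: (pairing_regrade (@weight_pbij R) weight_of_int hx e).
Qed.

Lemma size_actseq s u : size s = size u -> size (actseq s u) = size u.
Proof. by move=> e; rewrite size_map size_zip e minnn. Qed.

Lemma nuseq_homog u p a s pq : gr pq (nuseq u p a s pq).
Proof.
rewrite /nuseq; case: p => [|x p]; last exact: (mseq_homog pF).
case: eqP => [->|_]; first exact: core_one.
exact: (homog0 dG).
Qed.

Lemma actseq_cat s1 s2 u1 u2 : size s1 = size u1 ->
  actseq (s1 ++ s2) (u1 ++ u2) = actseq s1 u1 ++ actseq s2 u2.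
Proof. by move=> e; rewrite /actseq zip_cat // map_cat. Qed.

Lemma nuseq_lin u1 u2 a x y p b s pq : size p = (size u1 + size u2).+1 -> size s = size p ->
  nuseq (u1 ++ (a *: x + y) :: u2) p b s pq =
  a *: nuseq (u1 ++ x :: u2) p b s pq + nuseq (u1 ++ y :: u2) p b s pq.
Proof.
move=> sp ss; have h1 : (size u1 < size s)%N by rewrite ss sp ltnS leq_addr.
have [s1 [c [s2 [es e1 e2]]]] : exists s1 c s2, [/\ s = s1 ++ c :: s2,
  size s1 = size u1 & size s2 = size u2].
  exists (take (size u1) s), (nth 0 s (size u1)), (drop (size u1).+1 s); split.
  - by rewrite -drop_nth // cat_take_drop.
  - by rewrite size_take h1.
  - by rewrite size_drop ss sp; lia.
have e w : actseq s (u1 ++ w :: u2) = actseq s1 u1 ++ act c w :: actseq s2 u2.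
  by rewrite es actseq_cat.
rewrite /nuseq; case: p sp ss => // z p sp ss; rewrite (e (a *: x + y)) (e x) (e y) (act_linear dG).
by apply: (mseq_lin pF); rewrite size_map !size_actseq.
Qed.

Lemma splice_nth (T : Type) (x0 : T) i (s : seq T) : (i < size s)%N ->
  s = splice i s [:: nth x0 s i].
Proof. by move=> h; rewrite /splice /= -drop_nth // cat_take_drop. Qed.

(** The identity axiom forgets a vacuum in the last slot; a permutation brings any slot there. *)
Lemma mseq_insert_one u1 u2 z1 z2 t : size u1 = size z1 -> size u2 = size z2 ->
  z1 ++ z2 != [::] -> uniq (z1 ++ t :: z2) ->
  mseq (u1 ++ @ffa_one _ F :: u2) (z1 ++ t :: z2) = mseq (u1 ++ u2) (z1 ++ z2).
Proof.
move=> e1 e2 z0 uz.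
have e : perm_eq (zip (u1 ++ @ffa_one _ F :: u2) (z1 ++ t :: z2))
    (zip (rcons (u1 ++ u2) (@ffa_one _ F)) (rcons (z1 ++ z2) t)).
  rewrite zip_cat //= zip_rcons ?size_cat ?e1 ?e2 // zip_cat // -cats1 -catA perm_cat2l.
  by rewrite perm_sym cats1 perm_rcons.
have s1 : size (u1 ++ @ffa_one _ F :: u2) = size (z1 ++ t :: z2) by rewrite !size_cat /= e1 e2.
have s2 : size (rcons (u1 ++ u2) (@ffa_one _ F)) = size (rcons (z1 ++ z2) t).
  by rewrite !size_rcons !size_cat e1 e2.
have := mseq_permutation pF e; rewrite !unzip1_zip ?unzip2_zip ?s1 ?s2 // => ->.
apply: (mseq_identity pF) => //; first by rewrite !size_cat e1 e2.
by move: uz; rewrite rcons_uniq !cat_uniq mem_cat /= => /and3P[-> /norP[/negPf->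
  /negPf->]] /andP[/negPf-> ->].
Qed.

Lemma act_nuseq c v p b s p' q' : c != 0 -> p != [::] -> size v = size p -> size s = size p ->
  act c (nuseq v p b s (p', q')) =
  mseq [seq act c x | x <- actseq s v] [seq (x - b) / c | x <- p] (p', q').
Proof.
move=> c0 p0 sv ss; rewrite (act_homog dG c (nuseq_homog v p b s (p', q'))).
rewrite /nuseq; case: p p0 sv ss => // z p _ sv ss.
rewrite (core_scaling cF) // -?map_comp //.
by rewrite [RHS]size_map size_actseq ?ss ?sv.
Qed.

Lemma actseq_scale c s v : c != 0 -> 0 \notin s ->
  actseq [seq c * x | x <- s] v = [seq act c x | x <- actseq s v].
Proof.
move=> c0; elim: s v => [|y s IH] [|x v] //; rewrite inE negb_or => /andP[y0 s0].
rewrite /actseq /= -/(actseq _ _) IH // (actM cF) //; by rewrite eq_sym.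
Qed.

(** Covariance absorbs the scaling [c] of slot [i] into the inserted correlator, whose points become
    [(x - b) / c]; the sewing condition divided by [normc c] is then the domain of convergence. *)
Lemma nuseq_sewing (i : nat) (u v : seq F) (p : seq C) a (s p' : seq C) b (s' : seq C) :
  (i < size p)%N -> size u = size p -> size s = size p -> size v = size p' -> size s' = size p' ->
  uniq p -> uniq p' -> 0 \notin s -> 0 \notin s' ->
  (forall x j, x \in p' -> (j < size p)%N -> j != i ->
     normc (x - b) < normc (nth 0 s i) * normc (nth 0 p j - nth 0 p i)) ->
  forall w : rdual gr, sums_absolutely
    (fun pq => pairing w (nuseq (splice i u [:: nuseq v p' b s' pq]) p a s))
    (pairing w (nuseq (splice i u v)
       (splice i p [seq nth 0 p i + (x - b) / nth 0 s i | x <- p']) a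
       (splice i s [seq nth 0 s i * x | x <- s']))).
Proof.
move=> ip su ss sv ss' up up' s0 s'0 h w; set c := nth 0 s i.
have c0 : c != 0 by apply: contra s0 => /eqP <-; apply: mem_nth; rewrite ss.
have p0 : p != [::] by case: (p) ip.
pose U1 := actseq (take i s) (take i u); pose U2 := actseq (drop i.+1 s) (drop i.+1 u).
have st : size (take i s) = size (take i u) by rewrite !size_take ss su.
have sd : size (drop i.+1 s) = size (drop i.+1 u) by rewrite !size_drop ss su.
have sU1 : size U1 = i by rewrite size_actseq // size_take su ip.
have sU2 : size U2 = (size p - i.+1)%N by rewrite size_actseq // size_drop su.
pose z := [seq x - a | x <- p].
have nuE x : nuseq (splice i u [:: x]) p a s = mseq (U1 ++ act c x :: U2) z.
  rewrite /nuseq /z; case: (p) p0 => // y p1 _; congr mseq.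
  rewrite {1}(@splice_nth _ 0 i s) ?ss // /splice actseq_cat //.
have sz : size z = size p by rewrite size_map.
have zi : nth 0 z i = nth 0 p i - a by rewrite (nth_map 0).
have uz : uniq z by rewrite map_inj_uniq //; exact: addIr.
(* The sphere without positive punctures inserts the vacuum, a case outside the convergence axiom:
   the sum over degrees has one term, and the puncture is forgotten. *)
have [p'0|p'0] := eqVneq p' [::].
  have v0 : v = [::] by apply/size0nil; rewrite sv p'0.
  have s'nil : s' = [::] by apply/size0nil; rewrite ss' p'0.
  subst p' v s'; rewrite /= .
  have := @sums_finite _ _ (fun pq : R * R => pairing w (nuseq (splice i u [:: if pq == (0,0) then
    @ffa_one _ F else 0]) p a s)) [fset ((0 : R), (0 : R))]%fset.
  rewrite big_seq_fset1 eqxx => H.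
  have -> : pairing w (nuseq (splice i u [::]) (splice i p [::]) a (splice i s [::])) =
    pairing w (nuseq (splice i u [:: @ffa_one _ F]) p a s).
    rewrite nuE (act_one cF).
    have ez : z = take i z ++ nth 0 z i :: drop i.+1 z by rewrite -drop_nth ?sz // cat_take_drop.
    (* If this was the only puncture, the result is the nullary operation, to be matched with m_1 of
       the vacuum. *)
    have [zs0|zs0] := eqVneq (take i z ++ drop i.+1 z) [::].
      have [i0 p1] : i = 0%N /\ size p = 1%N.
        by move: zs0 => /(congr1 size); rewrite size_cat size_take size_drop sz ip /=; lia.
      have sp : splice i p [::] = [::] by apply/size0nil; rewrite size_splice_seq //= p1.
      rewrite sp; have -> : U1 = [::] by apply/size0nil; rewrite sU1 i0.
      have -> : U2 = [::] by apply/size0nil; rewrite sU2 i0 p1.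
      have -> : z = [:: nth 0 z 0] by move: sz; rewrite p1; case: (z) => [|? []].
      rewrite (pairing_embeds w (mseq_one cF _)).
      apply: pairing_embeds; have := embeds_homog _ (core_one cF); apply.
      by have [] := dG.
    rewrite ez mseq_insert_one -?ez //.
    - rewrite /nuseq; have sp : splice i p [::] != [::].
        by apply: contra zs0; rewrite /splice /= /z -map_take -map_drop -map_cat; case: (_ ++ _).
      have -> : mseq (U1 ++ U2) (take i z ++ drop i.+1 z) =
        mseq (actseq (splice i s [::]) (splice i u [::])) [seq x - a | x <- splice i p [::]].
        by rewrite /splice /= actseq_cat // map_cat map_take map_drop.
      by case: (splice i p [::]) sp.
    - by rewrite sU1 size_take sz ip.
    - by rewrite sU2 size_drop sz.
  apply: H => pq; rewrite inE => /negPf ->.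
  have -> : nuseq (splice i u [:: 0]) p a s = fun=> 0.
    apply/funext => rs; rewrite nuE; apply: (@linear0 _ _ _ (fun x => mseq (U1 ++ act c x :: U2) z
      rs)).
    move=> k x y; rewrite (act_linear dG); apply: (mseq_lin pF).
    by rewrite sz sU1 sU2; lia.
  by rewrite /pairing big1 // => ? _; rewrite raddf0.
pose zeta := [seq (x - b) / c | x <- p'].
have H := @mseq_convergence _ _ pF i (actseq s u) [seq act c x | x <- actseq s' v] z zeta.
have {H} := H _ _ _ _ uz _ _ w.
rewrite sz size_actseq ?ss // !size_map size_zip ss' sv minnn su -size_eq0 size_map.
have uze : uniq zeta.
  rewrite map_inj_uniq // => x y /mulIf; rewrite invr_neq0 // => /(_ isT) /addIr; exact.
have hz : forall (x : C) (j : nat), x \in zeta -> (j < size p)%N -> j != i ->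
    normc x < normc (nth 0 z i - nth 0 z j).
  move=> _ j /mapP[x xp ->] jp ji; rewrite zi (nth_map 0) //.
  have -> : nth 0 p i - a - (nth 0 p j - a) = nth 0 p i - nth 0 p j by ring.
  have hh := h x j xp jp ji; rewrite [normc (nth 0 p j - _)]normcB mulrC in hh.
  by rewrite normcM' normcV' ltr_pdivrMr ?normc_gt0.
rewrite size_eq0 => /(_ ip erefl erefl p'0 uze hz).
have eA x : splice i (actseq s u) x = U1 ++ x ++ U2.
  have -> : actseq s u = U1 ++ act c (nth 0 u i) :: U2.
    rewrite [X in actseq X _](@splice_nth _ 0 i s) ?ss // [X in actseq _ X](@splice_nth _ 0 i u) ?su
      //.
    by rewrite /splice actseq_cat.
  by rewrite -{1}sU1 splice_cat.
have ez : splice i z [seq nth 0 z i + x | x <- zeta] =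
    [seq x - a | x <- splice i p [seq nth 0 p i + (x - b) / c | x <- p']].
  rewrite /splice !map_cat map_take map_drop -!map_comp; congr (_ ++ _ ++ _).
  by apply: eq_map => x /=; rewrite zi addrAC.
have sp : splice i p [seq nth 0 p i + (x - b) / c | x <- p'] != [::].
  by rewrite -size_eq0 size_splice_seq // size_map -lt0n; case: (p') p'0 => //= *; rewrite addnS;
    case: (p) ip.
have -> : pairing w (nuseq (splice i u v)
      (splice i p [seq nth 0 p i + (x - b) / c | x <- p']) a (splice i s [seq c * x | x <- s'])) =
    pairing w (mseq (splice i (actseq s u) [seq act c x | x <- actseq s' v])
      (splice i z [seq nth 0 z i + x | x <- zeta])).
  rewrite ez eA -actseq_scale // /nuseq; case E : (splice i p _) sp => [//|y p1] _.
  by rewrite -E /splice actseq_cat // actseq_cat // size_map ss' sv.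
apply: eq_sums => -[p1 q1]; rewrite nuE act_nuseq ?ss' ?sv //.
by rewrite eA.
Qed.

Lemma val_kpts n (Q : Khat R n.+1) : val (kpts Q) = rcons (kz Q) 0.
Proof.
have -> : rcons (kz Q) 0 = val [tuple of rcons (kz Q) 0] by [].
congr val; apply: eq_from_tnth => j; rewrite tnth_mktuple (tnth_nth 0) /=.
rewrite nth_rcons size_tuple /=; case: ltngtP => // nj.
  by rewrite nth_default// size_tuple ltnW.
by rewrite nth_default// size_tuple nj.
Qed.

Lemma nuseq_one c u : embeds gr (nuseq [:: u] [:: 0] 0 [:: c]) (act c u).
Proof.
rewrite /nuseq /actseq /= subrr; exact: (mseq_identity1 pF).
Qed.

(** Only the differences [x - a] enter; this lets spheres be used without putting them in normal
    form. *)
Lemma nuseq_translate (t : C) u p a s : nuseq u [seq x - t | x <- p] (a - t) s = nuseq u p a s.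
Proof.
rewrite /nuseq; case: p => [//|x p]; rewrite -map_comp /=.
have -> : x - t - (a - t) = x - a by ring.
congr (mseq _ (_ :: _)); apply: eq_map => y /=; ring.
Qed.

Lemma nuseq_represents n (Q : Khat R n) p a s u : represents Q p a s ->
  nuseq u (kpts Q) (ka Q) (ks Q) = nuseq u p a s.
Proof.
move=> [e1 e2 e3]; rewrite e1 e2 e3 /=.
exact: nuseq_translate.
Qed.

Lemma oapp_some (T U : Type) (f : T -> U) d x : oapp f d (Some x) = f x.
Proof. by []. Qed.

Lemma kalg_nuE n (Q : Khat R n) (u : n.-tuple K) M :
  kalg_nu Q u M = oapp (nuseq u (kpts Q) (ka Q) (ks Q)) 0 (real_weight M).
Proof. by []. Qed.

Lemma nuseq_nil u (p : seq C) a s pq : p = [::] ->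
  nuseq u p a s pq = if pq == (0, 0) then @ffa_one _ F else 0.
Proof. by move=> ->. Qed.

Lemma nuseq_mseq u (p : seq C) a s pq : p != [::] ->
  nuseq u p a s pq = mseq (actseq s u) [seq x - a | x <- p] pq.
Proof. by case: p. Qed.

Lemma kpts0 (Q : Khat R 0) : tval (kpts Q) = [::].
Proof. exact/size0nil/size_tuple. Qed.

Lemma kptsS n (Q : Khat R n.+1) : tval (kpts Q) != [::].
Proof. by rewrite -size_eq0 size_tuple. Qed.

Lemma actseq_tuple n (s : n.-tuple C) (u : n.-tuple F) :
  actseq s u = [seq act (tnth s j) (tnth u j) | j <- enum 'I_n].
Proof.
by rewrite -{1}(map_tnth_enum s) -{1}(map_tnth_enum u) /actseq zip_map -map_comp.
Qed.

Lemma nuseq_zero (i : nat) (u : seq F) (p : seq C) a (s : seq C) : (i < size p)%N ->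
  size u = size p -> size s = size p -> nuseq (splice i u [:: 0]) p a s = fun=> 0.
Proof.
move=> ip su ss; apply/funext => pq.
apply: (@linear0 _ _ _ (fun x => nuseq (splice i u [:: x]) p a s pq)) => k x y.
by rewrite /splice /= nuseq_lin // size_take size_drop su ip; lia.
Qed.

Lemma pairing0 (w : rdual gr) : pairing w (fun=> 0) = 0.
Proof. by rewrite /pairing big1 // => ? _; rewrite raddf0. Qed.

Lemma kalg_of_core_multilinear n (Q : Khat R n) :
  multilinear (fun u : n.-tuple K => kalg_nu Q u).
Proof.
move=> u j a x y M.
have e (t : n.-tuple F) : kalg_nu (k := K) Q t M = oapp (nuseq (val t) (kpts Q) (ka Q) (ks Q)) 0
  (real_weight M) by [].
rewrite !e !val_upd /splice.
case: (real_weight M) => [pq|]; last by rewrite scaler0 addr0.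
have jn := ltn_ord j.
have sz : size (kpts Q) = (size (take j u) + size (drop j.+1 u)).+1.
  rewrite size_take size_drop !size_tuple jn; lia.
by rewrite !oapp_some !cat1s (nuseq_lin _ _ _ _ _ sz) // !size_tuple.
Qed.

Lemma mseq_scale (k : seq C) (u : seq F) z pq : size k = size z -> size u = size z ->
  mseq [seq x.1 *: x.2 | x <- zip k u] z pq = (\prod_(x <- k) x) *: mseq u z pq.
Proof.
move=> sk su.
suff h (v : seq F) k1 (u1 : seq F) : size k1 = size u1 -> size z = (size v + size u1)%N ->
    mseq (v ++ [seq x.1 *: x.2 | x <- zip k1 u1]) z pq = (\prod_(x <- k1) x) *: mseq (v ++ u1) z pq.
  by apply: (h [::]); rewrite ?sk.
elim: k1 u1 v => [|x k1 IH] [|y u1] v //=; first by rewrite big_nil scale1r.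
move=> [e1] e2; rewrite big_cons -cat_rcons IH ?size_rcons //; last by rewrite e2 addnS.
rewrite cat_rcons mulrC -scalerA; congr (_ *: _).
have sz : size z = (size v + size u1).+1 by rewrite e2 addnS.
have := mseq_lin pF (x - 1) y y pq sz; rewrite scalerBl scale1r subrK => ->.
by rewrite scalerBl scale1r subrK.
Qed.

Lemma mseq_all_one n z : size z = n.+1 -> uniq z ->
  embeds gr (mseq (nseq n.+1 (@ffa_one _ F)) z) (@ffa_one _ F).
Proof.
elim: n z => [|n IH] z; first by case: z => [|t []] // _ _; exact: mseq_one.
case/lastP: z => // z t; rewrite size_rcons => -[sz] uz.
have -> : nseq n.+2 (@ffa_one _ F) = rcons (nseq n.+1 (@ffa_one _ F)) (@ffa_one _ F).
  by elim: (n.+1) => //= k {1}->.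
rewrite (mseq_identity pF) ?size_nseq //; last by case: (z) sz.
by apply: IH => //; move: uz; rewrite rcons_uniq => /andP[].
Qed.

(** The vacuum is the only nonzero value of the nullary operation and is fixed by rescalings, so its
    line is already a submodule. *)
Lemma kalg_W_one u : kalg_W (F := K) u <-> exists a, u = a *: (@ffa_one _ F).
Proof.
split.
  move=> h; apply: (h [set u | exists a, u = a *: (@ffa_one _ F)]).
  - by split; [exists 0; rewrite scale0r|move=> a x y [b ->] [c ->]; exists (a * b + c);
      rewrite scalerDl scalerA].
  - move=> c x [b ->]; exists b; rewrite /= (linear_scal _ _ (act_linear dG _)).
    by rewrite (act_one cF).
  - move=> Q M; rewrite kalg_nuE; case: (real_weight M) => [pq|]; last by exists 0; rewrite scale0r.
    rewrite oapp_some (nuseq_nil _ _ _ _ (kpts0 Q)); case: eqP => _; first by exists 1;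
      rewrite scale1r.
    by exists 0; rewrite scale0r.
move=> [a ->] S [S0 Sl] _ Snu.
have H0 : [&& uniq (rcons [tuple] (0 : C)), 0 \notin [tuple of ([::] : seq C)]
    & (0 == 0)%N ==> ((0 : C) == 0)] by rewrite /= eqxx.
pose Q0 := @MkKhat R 0 [tuple] 0 [tuple of [::]] H0.
case E : (weight_of (0 : R, 0 : R)) => [M|]; last first.
  by case: (weight_of_none (k := 0) E); rewrite subrr.
move/weight_pbij : E => E; have := Snu Q0 M.
rewrite kalg_nuE E [oapp _ _ _](nuseq_nil _ _ _ _ (kpts0 Q0)) eqxx => S1.
by rewrite -[_ *: _]addr0; exact: Sl.
Qed.

Lemma kalg_of_core_W n (Q : Khat R n) (u : n.-tuple K) :
  (forall j, kalg_W (tnth u j)) -> forall M, kalg_W (kalg_nu Q u M).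
Proof.
move=> hu M; apply/kalg_W_one; rewrite kalg_nuE.
case: (real_weight M) => [pq|]; last by exists 0; rewrite scale0r.
rewrite oapp_some.
case: n Q u hu => [|n] Q u hu.
  rewrite (nuseq_nil _ _ _ _ (kpts0 Q)); case: eqP => _; first by exists 1; rewrite scale1r.
  by exists 0; rewrite scale0r.
have h j : exists a, tnth u j = a *: (@ffa_one _ F) by apply/kalg_W_one.
pose a j := projT1 (cid (h j)).
have aE j : tnth u j = a j *: (@ffa_one _ F) by rewrite /a; case: cid.
have [k ek] : exists k, k = [seq a j | j <- enum 'I_n.+1] by eexists.
have sk : size k = n.+1 by rewrite ek size_map size_enum_ord.
have e : actseq (ks Q) u = [seq x.1 *: x.2 | x <- zip k (nseq n.+1 (@ffa_one _ F))].
  have -> : nseq n.+1 (@ffa_one _ F) = [seq @ffa_one _ F | _ <- enum 'I_n.+1].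
    by rewrite -{1}(size_enum_ord n.+1); elim: (enum 'I_n.+1) => //= ? l ->.
  rewrite actseq_tuple ek; elim: (enum 'I_n.+1) => //= j l ->; congr (_ :: _).
  by rewrite aE (linear_scal _ _ (act_linear dG _)) (act_one cF).
rewrite (nuseq_mseq _ _ _ _ (kptsS Q)).
have sz : size [seq x - ka Q | x <- kpts Q] = n.+1 by rewrite size_map size_tuple.
rewrite e mseq_scale ?sk ?sz ?size_nseq //.
have uz : uniq [seq x - ka Q | x <- kpts Q] by rewrite map_inj_uniq ?kpts_uniq //; exact: addIr.
rewrite -(component_eq dG (mseq_all_one sz uz)) (component_homog dG _ (core_one cF)).
by case: eqP => _; [eexists|exists 0; rewrite scaler0 scale0r].
Qed.

Lemma kalg_of_core : is_kalg K.
Proof.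
have embK x u : embeds gr x u -> embeds (@isotypic _ K) (fun M => oapp x 0 (real_weight M)) u.
  by rewrite isotypicE; exact: (embeds_regrade (@weight_pbij R) weight_of_int).
split.
- by move=> c; exact: (act_linear dG).
- by move=> u; exact: act1.
- by move=> c d u; apply: (actM cF); [exact: (valP c)|exact: (valP d)].
- by rewrite isotypicE; exact: regrade_dG.
- by rewrite isotypicE; exact: regrade_findim (pre_findim pF).
- by move=> n Q u M; rewrite isotypicE; apply: regrade_homog => pq; exact: nuseq_homog.
- exact: kalg_of_core_multilinear.
- exact: kalg_of_core_W.
- move=> u; have := embK _ _ (nuseq_one 1 u); rewrite (act1 cF).
  by congr embeds; apply/funext => M /=; rewrite -[X in nuseq _ X](_ : val (kpts (Khat_id R)) = _)
    // val_kpts.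
- move=> n s Q Q' u hQ; apply/funext => M; rewrite !kalg_nuE (nuseq_represents _ hQ).
  case: (real_weight M) => [pq|] //; rewrite !oapp_some.
  case: n s Q Q' u hQ => [|n] s Q Q' u _.
    by rewrite (nuseq_nil _ _ _ _ (kpts0 Q)) nuseq_nil //; apply/size0nil/size_tuple.
  rewrite !nuseq_mseq ?kptsS //; last by rewrite -size_eq0 size_tuple.
  (* Scalings are absorbed into the vectors first, so that permuting the pairs (vector, point)
     permutes all labels. *)
  pose l := [tuple (act (tnth (ks Q) j) (tnth u j), tnth (kpts Q) j - ka Q) | j < n.+1].
  have sl : perm_eq (permute s l) l by apply/tuple_permP; exists s.
  have := mseq_permutation pF sl; rewrite !actseq_tuple.
  have -> : unzip1 l = [seq act (tnth (ks Q) j) (tnth u j) | j <- enum 'I_n.+1].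
    by rewrite /unzip1 -map_comp.
  have -> : unzip2 l = [seq x - ka Q | x <- kpts Q].
    by rewrite /unzip2 -{1}(map_tnth_enum (kpts Q)) -!map_comp.
  have -> : unzip1 (permute s l) = [seq act (tnth (permute s (ks Q)) j) (tnth (permute s u) j) |
    j <- enum 'I_n.+1].
    by rewrite /unzip1 -map_comp; apply: eq_map => j /=; rewrite !tnth_mktuple.
  have -> : unzip2 (permute s l) = [seq x - ka Q | x <- permute s (kpts Q)].
    by rewrite /unzip2 -!map_comp; apply: eq_map => j /=; rewrite !tnth_mktuple.
  by move=> ->.
- move=> m n P i Q S PQ hS u v w; have [w' [ew hw]] := rdual_isotypic w.
  have ilt : (i < size (kpts P))%N by rewrite size_tuple.
  have ni : nth 0 (ks P) i = tnth (ks P) i by rewrite (tnth_nth 0).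
  have npi : nth 0 (kpts P) i = tnth (kpts P) i by rewrite (tnth_nth 0).
  have /and3P[_ P0 _] := khatP P; have /and3P[_ Q0 _] := khatP Q.
  have h : forall (x : C) (j : nat), x \in tval (kpts Q) -> (j < size (kpts P))%N -> j != i ->
     normc (x - ka Q) < normc (nth 0 (ks P) i) * normc (nth 0 (kpts P) j - nth 0 (kpts P) i).
    move=> x j /tnthP[k ->]; rewrite size_tuple => jm ji.
    have := PQ k (Ordinal jm); rewrite -val_eqE /= => /(_ ji).
    by rewrite -normrM ltcE_normc normcM' (tnth_nth 0 (ks P)) (tnth_nth 0 (kpts P) (Ordinal _))
      (tnth_nth 0 (kpts P) i).
  have H := @nuseq_sewing i u v (kpts P) (ka P) (ks P) (kpts Q) (ka Q) (ks Q) ilt.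
  have {H} := H _ _ _ _ (kpts_uniq P) (kpts_uniq Q) P0 Q0 h w'.
  rewrite !size_tuple => /(_ erefl erefl erefl erefl).
  have -> : pairing w (kalg_nu (k := K) S (splice_tuple i u v)) = pairing w' (nuseq (splice i u v)
       (splice i (kpts P) [seq nth 0 (kpts P) i + (x - ka Q) / nth 0 (ks P) i | x <- kpts Q]) (ka P)
       (splice i (ks P) [seq nth 0 (ks P) i * x | x <- ks Q])).
    rewrite -hw; last by move=> pq; exact: nuseq_homog.
    congr pairing; apply/funext => M; rewrite kalg_nuE (nuseq_represents _ hS).
    by rewrite ni npi.
  move=> H; have {}H := sums_pbij (@weight_pbij R) _ H.
  apply: eq_sums (H _) => [M|pq hpq].
    have -> : pairing w (kalg_nu (k := K) P (upd u i (kalg_nu (k := K) Q v M))) =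
      pairing w' (nuseq (splice i u [:: oapp (nuseq v (kpts Q) (ka Q) (ks Q)) 0 (real_weight M)])
        (kpts P) (ka P) (ks P)).
      rewrite -hw; last by move=> pq; exact: nuseq_homog.
      congr pairing; apply/funext => M'; rewrite kalg_nuE; congr (oapp _ _ _).
      by rewrite -[tval (upd _ _ _)]/(val _) val_upd.
    case: (real_weight M) => [pq|] //.
    by rewrite [oapp (nuseq _ _ _ _) _ _]/(0 : F) nuseq_zero ?size_tuple // pairing0.
  by rewrite (weight_of_int hpq (nuseq_homog _ _ _ _ _)) nuseq_zero ?size_tuple // pairing0.
- move=> c u; have := embK _ _ (nuseq_one (val c) u).
  by congr embeds; apply/funext => M /=; rewrite -[X in nuseq _ X](_ : val (kpts (rescaling c)) = _)
    // val_kpts.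
Qed.

End KhatAlgebraOfCore.

(** * Smoothness of the Khat-algebra *)

Section Separable.
Variable R : realType.
Local Notation C := R[i].

Definition append0_mx n : 'M[R]_(n, n.+1) := \matrix_(i, j) (i == j :> nat)%:R.

Lemma append0_mxE n (z : n.-tuple C) : mulmx_tuple (append0_mx n) z = [tuple of rcons z 0].
Proof.
apply: eq_from_tnth => j; rewrite tnth_mktuple (tnth_nth 0) /= nth_rcons size_tuple.
case: ltngtP => jn.
- rewrite (bigD1 (Ordinal jn)) //= mxE eqxx rmorph1 mul1r (tnth_nth 0) big1 ?addr0 // => i ij.
  by rewrite mxE (_ : (i == j :> nat) = false) ?rmorph0 ?mul0r //; apply: contraNF ij => /eqP e;
    apply/eqP/val_inj.
- by have := ltn_ord j; rewrite ltnS leqNgt jn.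
- rewrite big1 // => i _; rewrite mxE (_ : (i == j :> nat) = false) ?rmorph0 ?mul0r //.
  by apply/negbTE; rewrite jn neq_ltn ltn_ord.
Qed.

Lemma open_append0 n : open_coords [set z : n.-tuple C | uniq (rcons z 0)].
Proof.
have := @open_coords_mulmx R _ _ (append0_mx n) _ (@open_coords_uniq R n.+1).
rewrite /open_coords (_ : [set x | [set z | [set z1 |
  uniq z1] (mulmx_tuple (append0_mx n) z)] (of_coords x)] =
  [set x | [set z : n.-tuple C | uniq (rcons z 0)] (of_coords x)]) //.
apply/funext => x.
by change (is_true (uniq (mulmx_tuple (append0_mx n) (of_coords x))) = is_true (uniq (rcons
  (of_coords x) 0)));
  rewrite append0_mxE.
Qed.

(** The decomposition of the smoothness axiom, with [a], the scalings and the points as independent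
    variables instead of coordinates of a point of the operad; in this form it is stable under
    linear combinations. *)
Definition separable n (f : C -> n.-tuple C -> n.-1.-tuple C -> C) : Prop :=
  exists (L : nat) (g : 'I_L -> C -> n.-tuple C -> C) (h : 'I_L -> n.-1.-tuple C -> C),
    [/\ forall l, elementary (g l),
        forall l, smooth_on [set z : n.-1.-tuple C | uniq (rcons z 0)] (h l)
      & forall a (s : n.-tuple C) (z : n.-1.-tuple C), 0 \notin s -> uniq (rcons z 0) ->
        f a s z = \sum_(l < L) g l a s * h l z].

Variable n : nat.
Implicit Types f : C -> n.-tuple C -> n.-1.-tuple C -> C.

Lemma eq_separable f f' : (forall a (s : n.-tuple C) (z : n.-1.-tuple C),
  0 \notin s -> uniq (rcons z 0) ->
    f a s z = f' a s z) ->
  separable f -> separable f'.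
Proof.
move=> e [L [g [h [hg hh hf]]]]; exists L, g, h; split=> // a s z s0 uz.
by rewrite -e // hf.
Qed.

Lemma separable0 : separable (n := n) (fun _ _ _ => 0).
Proof.
exists 0%N, (fun _ _ _ => 0), (fun _ _ => 0); split=> [[]//|[]//|a s z _ _].
by rewrite big_ord0.
Qed.

Lemma separable1 g h : elementary (n := n) g ->
  smooth_on [set z : n.-1.-tuple C | uniq (rcons z 0)] h -> separable (fun a s z => g a s * h z).
Proof.
move=> hg hh; exists 1%N, (fun=> g), (fun=> h); split=> // a s z _ _.
by rewrite big_ord1.
Qed.

Lemma separable_add f f' : separable f -> separable f' ->
  separable (fun a s z => f a s z + f' a s z).
Proof.
move=> [L [g [h [hg hh hf]]]] [L' [g' [h' [hg' hh' hf']]]].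
exists (L + L')%N, (fun l => match fintype.split l with inl i => g i | inr i => g' i end),
  (fun l => match fintype.split l with inl i => h i | inr i => h' i end); split.
- by move=> l; case: (fintype.split l).
- by move=> l; case: (fintype.split l).
move=> a s z s0 uz; rewrite hf // hf' // big_split_ord /=; congr (_ + _).
  by apply: eq_bigr => i _; rewrite (unsplitK (inl i)).
by apply: eq_bigr => i _; rewrite (unsplitK (inr i)).
Qed.

Lemma separable_scale c f : separable f -> separable (fun a s z => c * f a s z).
Proof.
move=> [L [g [h [hg hh hf]]]]; exists L, g, (fun l z => c * h l z); split=> //.
  move=> l; apply: (smooth_on_mul (open_append0 (n := n.-1))) => //.
  exact: (smooth_on_cst (open_append0 (n := n.-1))).
by move=> a s z s0 uz; rewrite hf // mulr_sumr; apply: eq_bigr => l _; rewrite mulrCA.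
Qed.

Lemma separable_sum (J : Type) (r : seq J) (f : J -> C -> n.-tuple C -> n.-1.-tuple C -> C) :
  (forall j, separable (f j)) -> separable (fun a s z => \sum_(j <- r) f j a s z).
Proof.
move=> hf; elim: r => [|j r IH].
  by apply: eq_separable separable0 => a s z _ _; rewrite big_nil.
by apply: eq_separable (separable_add (hf j) IH) => a s z _ _; rewrite big_cons.
Qed.

End Separable.

Section SmoothKhatAlgebraOfCore.
Variable R : realType.
Local Notation C := R[i].
Variable F : ffa_data R.
Local Notation gr := (@ffa_gr _ F).
Hypothesis cF : is_core F.
Let pF := core_pre cF.
Let dG := pre_grading pF.
Local Notation K := (kalg_of_ffa F).

Lemma smooth_matrix_element n (u : seq F) (f : F -> C) rs : scalar f -> size u = n.+1 ->
  smooth_on [set z : n.-tuple C | uniq (rcons z 0)] (fun z => f (mseq u (rcons z 0) rs)).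
Proof.
move=> lf su; have [w [we sw]] := rdual_at dG rs lf.
have vu : tval (ntup n.+1 u) = u := val_ntup su.
have := smooth_on_mulmx (append0_mx R n) (@open_coords_conf R n.+1) (pre_smooth pF (ntup n.+1 u) w).
have -> : [set z | [set z0 : n.+1.-tuple C | (0 < n.+1)%N && uniq z0] (mulmx_tuple (append0_mx R n)
  z)] =
  [set z : n.-tuple C | uniq (rcons z 0)].
  apply/funext => z.
  by change (is_true (uniq (mulmx_tuple (append0_mx R n) z)) = is_true (uniq (rcons z 0)));
    rewrite append0_mxE.
move=> H; apply: eq_smooth_on H => [|z _]; first exact: open_append0.
rewrite append0_mxE corr_mseq (pairing_at _ sw) we vu.
by rewrite (component_homog dG _ (mseq_homog pF _ _ rs)) eqxx.
Qed.

(** On homogeneous vectors the scalings come out as a product of powers, and the translation by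
    [- a] as a polynomial in [a] and its conjugate; the coefficients are matrix elements of m_n,
    smooth in the points. *)
Lemma separable_nu n (u : seq F) : size u = n.+1 -> forall w : rdual gr,
  separable (n := n.+1) (fun a s z => pairing w (mseq (actseq s u) [seq x - a | x <- rcons z 0])).
Proof.
move: u; apply: (homog_ind dG (0, 0)) => [u hu su w|u1 u2 k x y Hx Hy su w]; last first.
  have su' v : size (u1 ++ v :: u2) = n.+1 by rewrite -su !size_cat.
  apply: eq_separable (separable_add (separable_scale k (Hx (su' x) w)) (Hy (su' y) w)) => a s z _
    _.
  rewrite /pairing mulr_sumr -big_split /=; apply: eq_bigr => rs _.
  have e v : mseq (actseq s v) [seq t - a | t <- rcons z 0] rs = nuseq v (rcons z 0) a s rs.
    by rewrite nuseq_mseq //; case: (tval z).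
  have sz : size (rcons z 0) = (size u1 + size u2).+1.
    by rewrite size_rcons size_tuple; move: su; rewrite size_cat /= addnS => -[->].
  rewrite !e (nuseq_lin cF _ _ _ _ _ sz); last by rewrite size_tuple size_rcons size_tuple.
  by rewrite linearP.
have hd (j : 'I_n.+1) : exists pq, gr pq (nth 0 u j) by apply: hu; apply: mem_nth; rewrite su.
pose d j := projT1 (cid (hd j)).
have dP j : gr (d j) (nth 0 u j) by rewrite /d; case: cid.
have vu : tval (ntup n.+1 u) = u := val_ntup su.
pose kk (s : n.+1.-tuple C) j := chi (- (d j).1%:C%C) (- (d j).2%:C%C) (tnth s j).
have ea (s : n.+1.-tuple C) : actseq s u = [seq x.1 *: x.2 | x <- zip [seq kk s j |
  j <- enum 'I_n.+1] u].
  have eu : [seq nth 0 u (j : 'I_n.+1) | j <- enum 'I_n.+1] = u := vu.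
  rewrite -[X in actseq _ X]eu -[X in zip _ X]eu -{1}(map_tnth_enum s) /actseq.
  elim: (enum 'I_n.+1) => //= j l ->; congr (_ :: _).
  have := dP j; rewrite /kk; case: (d j) => p q Gu.
  by rewrite (act_homog dG _ Gu).
have em (s : n.+1.-tuple C) a (z : n.-tuple C) rs : mseq (actseq s u) [seq x - a |
  x <- rcons z 0] rs =
    (\prod_j kk s j) *: mseq u [seq x - a | x <- rcons z 0] rs.
  have sz : size [seq x - a | x <- rcons z 0] = n.+1 by rewrite size_map size_rcons size_tuple.
  have sk : size [seq kk s j | j <- enum 'I_n.+1] = n.+1 by rewrite size_map size_enum_ord.
  by rewrite ea mseq_scale ?sk ?sz // big_map big_enum.
have hsep rs : separable (n := n.+1) (fun a s z => w (mseq (actseq s u) [seq x - a |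
  x <- rcons z 0] rs)).
  case: rs => r t; have [N hN] := translation cF r t.
  pose f (k : 'I_N.+2 * 'I_N.+2) (a : C) (s : n.+1.-tuple C) (z : n.-tuple C) : C :=
    ((-1) ^+ k.1 * (-1) ^+ k.2 * a ^+ k.1 * conjc a ^+ k.2 *
     \prod_(j < n.+1) (cpow (tnth s j) (- (d j).1)%:C%C * cpowbar (tnth s j) (- (d j).2)%:C%C)) *
     w (shiftop k.1 k.2 (mseq u (rcons z 0) (r - k.1%:R, t - k.2%:R))).
  suff hf k : separable (n := n.+1) (f k).
    have H := separable_sum (n := n.+1) (index_enum ('I_N.+2 * 'I_N.+2)%type) hf.
    apply: eq_separable H => a s z _ _; rewrite em /f; apply/esym.
    have -> : [seq x - a | x <- rcons z 0] = [seq - a + x | x <- rcons z 0].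
      by apply: eq_map => x; rewrite addrC.
    rewrite hN; last by rewrite size_rcons size_tuple.
    rewrite scaler_sumr linear_sum; apply: eq_bigr => k _.
    rewrite scalerA linearZ /=; congr (_ * _).
    rewrite rmorphN /= [(- a) ^+ _]exprNn [(- conjc a) ^+ _]exprNn.
    have -> : \prod_j kk s j = \prod_(j < n.+1) (cpow (tnth s j) (- (d j).1)%:C%C * cpowbar (tnth s
      j) (- (d j).2)%:C%C).
      by apply: eq_bigr => j _; rewrite /kk /chi !rmorphN.
    ring.
  apply: (@separable1 _ n.+1 (fun a s => (-1) ^+ k.1 * (-1) ^+ k.2 * a ^+ k.1 * conjc a ^+ k.2 *
     \prod_(j < n.+1) (cpow (tnth s j) (- (d j).1)%:C%C * cpowbar (tnth s j) (- (d j).2)%:C%C))).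
    exists 1%N, (fun=> (-1) ^+ k.1 * (-1) ^+ k.2), (fun=> k.1 : nat), (fun=> k.2 : nat),
      (fun _ j => - (d j).1), (fun _ j => - (d j).2) => a s _.
    by rewrite big_ord1.
  apply: (@smooth_matrix_element n u (fun v => w (shiftop k.1 k.2 v))) => //.
  by move=> c x y; rewrite (shiftop_linear pF) linearP.
exact: separable_sum.
Qed.

Lemma kptsE n (Q : Khat R n) : tval (kpts Q) = if n is m.+1 then rcons (kz Q) 0 else [::].
Proof. by case: n Q => [|n] Q; [exact: kpts0|exact: val_kpts]. Qed.

Lemma smooth_kalg_of_core : is_smooth_kalg K.
Proof.
split.
  have [N hN] := pre_lower pF; exists N => M hM u; rewrite isotypicE // /regrade.
  case E : (real_weight M) => [[p q]|] //= Gu; apply: (hN p q) => //.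
  by move/real_weightP : E => E; move: hM; rewrite E.
move=> n u w; have [w' [ew hw]] := rdual_isotypic cF w.
suff [L [g [h [hg hh hf]]]] : separable (n := n) (fun a s z => pairing w' (nuseq u
    (if n is m.+1 then rcons z 0 else [::]) a s)).
  exists L, g, h; split=> // Q; have /and3P[uz s0 _] := khatP Q.
  rewrite -hf //.
  transitivity (pairing w' (nuseq u (kpts Q) (ka Q) (ks Q))).
    by rewrite -hw // => pq; exact: nuseq_homog.
  by rewrite kptsE.
clear ew; case: n u w hw => [|n] u w hw.
  apply: (@eq_separable _ 0 (fun a s z => pairing w' (fun pq => if pq == (0,
    0) then @ffa_one _ F else 0) * 1)).
    by move=> a s z _ _; rewrite mulr1; congr pairing.
  apply: (@separable1 _ 0 (fun _ _ => pairing w' (fun pq => if pq == (0,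
    0) then @ffa_one _ F else 0)) (fun=> 1));
    last by apply: smooth_on_cst; exact: open_append0.
  exists 1%N, (fun=> pairing w' (fun pq => if pq == (0, 0) then @ffa_one _ F else 0)), (fun=> 0%N),
    (fun=> 0%N),
    (fun _ _ => 0), (fun _ _ => 0) => a s _.
  by rewrite big_ord1 big_ord0 !mulr1.
apply: eq_separable (separable_nu (size_tuple u) w') => a s z _ _.
by congr pairing; apply/funext => pq; rewrite nuseq_mseq //; case: (tval z).
Qed.

End SmoothKhatAlgebraOfCore.

(** * From correlators to full field algebras *)

Section FirstOrder.
Variable R : realType.
Local Notation C := R[i].

Lemma wirt_sum (I : Type) (r : seq I) (f : I -> C -> C) z (A B : I -> C) :
  (forall i, wirt (f i) z (A i) (B i)) ->
  wirt (fun t => \sum_(i <- r) f i t) z (\sum_(i <- r) A i) (\sum_(i <- r) B i).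
Proof.
move=> h; elim: r => [|i r IH].
  by apply: eq_wirt (wirt_cst 0 z) => [t||]; rewrite big_nil.
by apply: eq_wirt (wirtD (h i) IH) => [t||]; rewrite big_cons.
Qed.

Lemma wirt_shift (f : C -> C) (z A B : C) : wirt (fun t => f (z + t)) 0 A B <-> wirt f z A B.
Proof.
by split=> -[p [q [h1 h2 h3]]]; exists p, q; split=> // t; have := h3 t; rewrite ?addr0 ?add0r.
Qed.

Lemma wirt_monomial (i j : nat) : wirt (fun t : C => t ^+ i * conjc t ^+ j) 0
  ((i, j) == (1, 0))%N%:R ((i, j) == (0, 1))%N%:R.
Proof.
have [ij|] := boolP (1 < i + j)%N; last first.
  case: i j => [|[|i]] [|[|j]] //= _.
  - by apply: eq_wirt (wirt_cst 1 0) => // t; rewrite mulr1.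
  - exists (fun=> 0), (fun=> 1); split; try exact: lim0_cst.
    by move=> t; rewrite rmorph0 rmorphD rmorph0 !expr0 !expr1 !mul1r mul0r addr0 add0r.
  - by apply: eq_wirt (wirt_id 0) => // t; rewrite mulr1.
have -> : ((i, j) == (1, 0))%N = false by apply/negbTE; apply: contraTN ij => /eqP[-> ->].
have -> : ((i, j) == (0, 1))%N = false by apply/negbTE; apply: contraTN ij => /eqP[-> ->].
apply: (@wirt_quad _ _ _ _ _ 1 1) => // t t1; rewrite add0r conjc0.
have -> : (0 : C) ^+ i * 0 ^+ j = 0.
  by rewrite !expr0n; case: i j ij => [|i] [|j] //; rewrite ?mul0r ?mulr0.
rewrite !mul0r addr0 !subr0 normcM' !normcX normcJ' -exprD mul1r.
by apply: ler_wiXn2l => //; rewrite ?normc_ge0 // ltW.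
Qed.

(** A majorant outside the finite set [A0] bounds the remainder of an absolutely convergent
    expansion. *)
Lemma sums_tail (I : choiceType) (f : I -> C) (g : I -> R) (A0 : {fset I}) s M :
  sums_absolutely f s -> (forall i, i \notin A0 -> normc (f i) <= g i) -> (forall i, 0 <= g i) ->
  (forall A : {fset I}, \sum_(i <- A) g i <= M) -> normc (s - \sum_(i <- A0) f i) <= M.
Proof.
move=> [_ h] fg g0 gM; apply/ler_addgt0Pr => e e0.
have [A hA] := h e e0; have := hA (A `|` A0)%fset (fsubsetUl _ _).
set S := \sum_(i <- (A `|` A0)%fset) f i => hS.
have -> : s - \sum_(i <- A0) f i = (s - S) + (S - \sum_(i <- A0) f i) by ring.
apply: le_trans (normcD_le _ _) _; rewrite addrC normcB; apply: lerD; last exact: ltW.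
have -> : \sum_(i <- A0) f i = \sum_(i <- (A `|` A0)%fset | i \in A0) f i.
  rewrite -[RHS]big_filter; apply: perm_big; apply: uniq_perm;
    rewrite ?filter_uniq ?fset_uniq // => i.
  by rewrite mem_filter inE; case: (i \in A0); rewrite ?orbT.
rewrite /S (bigID (fun i => i \in A0)) /= addrAC subrr add0r.
apply: le_trans (normc_sum _ _ _) _; apply: le_trans (gM (A `|` A0)%fset).
rewrite [leRHS](bigID (fun i => i \in A0)) /=.
apply: le_trans (ler_sum _ (fun i hi => fg i hi)) _.
by rewrite lerDr sumr_ge0.
Qed.

End FirstOrder.

Definition gradeL (R : realType) (F : ffa_data R) : F -> F :=
  gmap (@ffa_gr _ F) (fun pq u => pq.1%:C%C *: u).

Definition gradeR (R : realType) (F : ffa_data R) : F -> F :=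
  gmap (@ffa_gr _ F) (fun pq u => pq.2%:C%C *: u).

Section FullFieldAlgebraOfCore.
Variable R : realType.
Local Notation C := R[i].
Variable F : ffa_data R.
Local Notation gr := (@ffa_gr _ F).
Hypothesis cF : is_core F.
Let pF := core_pre cF.
Let dG := pre_grading pF.

(* The convergent expansion of m_2(m_1(u; t), v; a, b) in powers of t, to first order. *)
Lemma wirt_first_slot (w : rdual gr) (u v : F) (a b : C) : a != b ->
  wirt (fun t => pairing w (mseq [:: u; v] [:: t; b])) a
    (pairing w (mseq [:: shiftop 1 0 u; v] [:: a; b])) (pairing w (mseq [:: shiftop 0 1 u; v] [:: a;
      b])).
Proof.
move=> ab; move: u; apply: (component_ind dG (0, 0)) => [[p q] u Gu|k x y Hx Hy]; last first.
  have lp z : pairing w (mseq [:: k *: x + y; v] [:: z; b]) =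
      k * pairing w (mseq [:: x; v] [:: z; b]) + pairing w (mseq [:: y; v] [:: z; b]).
    rewrite /pairing mulr_sumr -big_split /=; apply: eq_bigr => rs _.
    by rewrite (mseq2_linl pF v rs (erefl : size [:: z; b] = 2)) linearP.
  have ls i j : pairing w (mseq [:: shiftop i j (k *: x + y); v] [:: a; b]) =
      k * pairing w (mseq [:: shiftop i j x; v] [:: a; b]) + pairing w (mseq [:: shiftop i j y;
        v] [:: a; b]).
    rewrite /pairing mulr_sumr -big_split /=; apply: eq_bigr => rs _.
    by rewrite (shiftop_linear pF) (mseq2_linl pF v rs (erefl : size [:: a; b] = 2)) linearP.
  by apply: eq_wirt (wirt_lin k Hx Hy) => [t||].
pose T (t : C) pq : C := pairing w (mseq [:: mseq [:: u] [:: t] pq; v] [:: a; b]).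
pose c i j : C := pairing w (mseq [:: shiftop i j u; v] [:: a; b]).
have pair0 : pairing w (mseq [:: 0; v] [:: a; b]) = 0.
  rewrite /pairing big1 // => rs _.
  by rewrite (linear0 (mseq2_linl pF v rs (erefl : size [:: a; b] = 2))) raddf0.
have Tij t i j : T t (p + i%:R, q + j%:R) = t ^+ i * conjc t ^+ j * c i j.
  rewrite /T (m1_shiftE cF) // /c /pairing mulr_sumr; apply: eq_bigr => rs _.
  by rewrite (linear_scal _ _ (mseq2_linl pF v rs (erefl : size [:: a; b] = 2))) linearZ.
have sT t : normc t < normc (a - b) -> sums_absolutely (T t) (pairing w (mseq [:: u; v] [:: a + t;
  b])).
  move=> ht; have := @mseq_convergence _ _ pF 0 [:: 0; v] [:: u] [:: a;
    b] [:: t] isT erefl erefl isT.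
  rewrite /= inE ab /splice /= => /(_ isT isT) H; apply: H => x [|[|j]] //=.
  by rewrite inE => /eqP ->.
(* An auxiliary radius inside the disc of convergence; the sum of absolute values at this radius,
   bounded by [S], controls the remainder. *)
pose rho := normc (a - b) / 2.
have n0 : 0 < normc (a - b) by rewrite normc_gt0 subr_eq0.
have rho0 : 0 < rho by rewrite divr_gt0.
have rho1 : normc (rho%:C%C) < normc (a - b).
  by rewrite normcR ger0_norm ?(ltW rho0) // /rho; lra.
have [/summable_normcP [S hS] _] := sT _ rho1.
apply: (@wirt_quad _ _ _ _ _ (S / rho ^+ 2) rho rho0) => t ht.
(* The degrees of the terms of order at most 1 in [t]. *)
pose A0 : {fset R * R} := seq_fset tt [:: (p, q); (p + 1, q); (p, q + 1)].
have eA0 : \sum_(i <- A0) T t i = pairing w (mseq [:: u; v] [:: a;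
  b]) + (c 1 0 * t + c 0 1 * conjc t).
  have up : uniq [:: (p, q); (p + 1, q); (p, q + 1)].
    have p1 : p != p + 1 by rewrite -subr_eq0 opprD addNKr oppr_eq0 oner_eq0.
    have q1 : q != q + 1 by rewrite -subr_eq0 opprD addNKr oppr_eq0 oner_eq0.
    by rewrite /= !inE !xpair_eqE !eqxx /= (negPf p1) (negPf q1) ![p + 1 == p]eq_sym (negPf p1).
  have -> : \sum_(i <- A0) T t i = T t (p, q) + (T t (p + 1, q) + T t (p, q + 1)).
    rewrite (perm_big _ (seq_fset_perm _ _)) undup_id //.
    by rewrite !big_cons big_nil /= addr0.
  have := Tij t 0 0; rewrite !addr0 expr0 !mul1r => ->.
  have := Tij t 1 0; rewrite addr0 expr0 expr1 mulr1 => ->.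
  have := Tij t 0 1; rewrite addr0 expr0 expr1 mul1r => ->.
  by rewrite /c (shiftop00 cF); congr (_ + _); rewrite mulrC [conjc t * _]mulrC.
have tl : normc t < normc (a - b) by apply: lt_trans ht _; rewrite /rho; lra.
have := sums_tail (A0 := A0) (g := fun pq => (normc t / rho) ^+ 2 * normc (T rho%:C%C pq))
   (M := S / rho ^+ 2 * normc t ^+ 2) (sT t tl).
rewrite eA0 opprD addrA; apply.
- move=> [r s] rsA; have [z0|n1] := eqVneq (mseq [:: u] [:: t] (r, s)) 0.
    by rewrite /T z0 pair0 normc0' mulr_ge0 ?sqr_ge0 ?normc_ge0.
  have [i [j [er es]]] := core_degrees cF Gu n1; subst r s.
  rewrite !Tij !normcM' !normcX !normcJ' mulrA ler_wpM2r ?normc_ge0 //.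
  rewrite normcR ger0_norm ?(ltW rho0) // -!exprD.
  (* Outside [A0] the order is at least 2, so the term is at most [(normc t / rho) ^+ 2] times its
     modulus at radius [rho]. *)
  have ij : (2 <= i + j)%N.
    rewrite leqNgt; apply: contra rsA => ij; rewrite seq_fsetE !inE.
    case: i j ij {n1} => [|[|i]] [|[|j]] // _; rewrite ?addr0 ?eqxx ?orbT //.
  have h1 : normc t / rho <= 1 by rewrite ler_pdivrMr // mul1r ltW.
  have h2 : (normc t / rho) ^+ (i + j) <= (normc t / rho) ^+ 2.
    by apply: ler_wiXn2l => //; rewrite divr_ge0 ?normc_ge0 // ltW.
  apply: le_trans (ler_wpM2r _ h2); last by rewrite exprn_ge0 // ltW.
  by rewrite expr_div_n divfK // expf_neq0 // gt_eqF.
- by move=> i; rewrite mulr_ge0 ?sqr_ge0 ?normc_ge0.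
- move=> A; rewrite -mulr_sumr expr_div_n mulrAC.
  rewrite [leRHS]mulrC mulrA; apply: ler_wpM2r; first by rewrite invr_ge0 sqr_ge0.
  by apply: ler_wpM2l => //; rewrite sqr_ge0.
Qed.

Lemma gradeL_linear : linear (@gradeL _ F).
Proof. by apply: (gmap_linear dG) => pq a x y; rewrite scalerDr !scalerA mulrC. Qed.

Lemma gradeR_linear : linear (@gradeR _ F).
Proof. by apply: (gmap_linear dG) => pq a x y; rewrite scalerDr !scalerA mulrC. Qed.

Lemma gradeL_homog p q u : gr (p, q) u -> gradeL u = p%:C%C *: u.
Proof. by move=> h; rewrite /gradeL (gmap_homog dG _ h) // => i; rewrite scaler0. Qed.

Lemma gradeR_homog p q u : gr (p, q) u -> gradeR u = q%:C%C *: u.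
Proof. by move=> h; rewrite /gradeR (gmap_homog dG _ h) // => i; rewrite scaler0. Qed.

(** Covariance at [c = cexp (- t)]. Integrality of the differences, known unless the matrix element
    vanishes, turns the characters into exponentials. *)
Lemma mseq_homogeneous p q p' q' r s u v (z t : C) : gr (p, q) u -> gr (p', q') v ->
  mseq [:: u; v] [:: cexp t * z; 0] (r, s) =
  cexp ((r - p - p')%:C%C * t + (s - q - q')%:C%C * conjc t) *: mseq [:: u; v] [:: z; 0] (r, s).
Proof.
move=> Gu Gv; have c0 : cexp (- t) != 0 := cexp_neq0 _.
have := @core_scaling _ _ cF _ [:: u; v] [:: z; 0] r s c0 erefl.
rewrite /= (act_homog dG _ Gu) (act_homog dG _ Gv) mul0r.
rewrite (linear_scal _ _ (mseq2_linl pF _ _ (erefl : size [:: z / cexp (- t); 0] = 2))).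
rewrite (linear_scal _ _ (mseq2_linr pF _ _ (erefl : size [:: z / cexp (- t); 0] = 2))).
rewrite scalerA cexpN invrK [z * _]mulrC.
set M := mseq [:: u; v] [:: z; 0] (r, s); set M' := mseq _ [:: cexp t * z; 0] _ => h.
have [M0|M0] := eqVneq M 0.
  move: h; rewrite M0 !scaler0 => /esym/eqP; rewrite scaler_eq0 mulf_eq0 !(negPf (chi_neq0 _ _ _))
    /=.
  by move/eqP.
have u0 : u != 0.
  apply: contraNneq M0 => u0.
  by rewrite /M u0 (linear0 (mseq2_linl pF _ _ (erefl : size [:: z; 0] = 2))).
have v0 : v != 0.
  apply: contraNneq M0 => v0.
  by rewrite /M v0 (linear0 (mseq2_linr pF _ _ (erefl : size [:: z; 0] = 2))).
have [k hk] := chi_int cF Gu u0; have [k' hk'] := chi_int cF Gv v0.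
have [l hl] := chi_int cF (mseq_homog pF _ _ _) M0.
move: h; rewrite -cexpN (chi_cexp _ hk) (chi_cexp _ hk') (chi_cexp _ hl) -cexpD.
move=> /(congr1 (fun x => (cexp (- p%:C%C * - t + - q%:C%C * conjc (- t) +
  (- p'%:C%C * - t + - q'%:C%C * conjc (- t))))^-1 *: x)).
rewrite !scalerA mulVf ?cexp_neq0 // scale1r -cexpN -cexpD => <-; congr (cexp _ *: _).
by rewrite !rmorphB !rmorphN /=; ring.
Qed.

(** For homogeneous [u] and [v] the right sides multiply by the exponents of a homogeneous function,
    and by [wirt_first_slot] the left sides are its Euler derivatives. *)
Lemma grade_bracket (u v : F) (z : C) rs : z != 0 ->
  z *: mseq [:: shiftop 1 0 u; v] [:: z; 0] rs = gradeL (mseq [:: u; v] [:: z; 0] rs) -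
    mseq [:: u; gradeL v] [:: z; 0] rs - mseq [:: gradeL u; v] [:: z; 0] rs /\
  conjc z *: mseq [:: shiftop 0 1 u; v] [:: z; 0] rs = gradeR (mseq [:: u; v] [:: z; 0] rs) -
    mseq [:: u; gradeR v] [:: z; 0] rs - mseq [:: gradeR u; v] [:: z; 0] rs.
Proof.
move=> z0; have ll v' := mseq2_linl pF v' rs (erefl : size [:: z; 0] = 2).
have lr u' := mseq2_linr pF u' rs (erefl : size [:: z; 0] = 2).
have comb (k a : C) (A B X Y P Q U V : F) : k *: A = X - P - U -> k *: B = Y - Q - V ->
    k *: (a *: A + B) = a *: X + Y - (a *: P + Q) - (a *: U + V).
  move=> h1 h2; rewrite scalerDr scalerA [k * a]mulrC -scalerA h1 h2 !scalerBr.
  by rewrite addrACA [X in X + _]addrACA -!opprD.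
move: u; apply: (component_ind dG (0, 0)) => [[p q] u Gu|a x y [IH1 IH2] [IH1' IH2']]; last first.
  rewrite !(shiftop_linear pF) gradeL_linear gradeR_linear !ll gradeL_linear gradeR_linear.
  by split; exact: comb.
move: v; apply: (component_ind dG (0, 0)) => [[p' q'] v Gv|a x y [IH1 IH2] [IH1' IH2']]; last first.
  rewrite gradeL_linear gradeR_linear !lr gradeL_linear gradeR_linear.
  by split; exact: comb.
case: rs ll lr => r s ll lr; have sG : forall i, subspace (gr i) by have [] := dG.
have Gm u' v' : gr (r, s) (mseq [:: u'; v'] [:: z; 0] (r, s)) := mseq_homog pF _ _ _.
rewrite (gradeL_homog (Gm _ _)) (gradeR_homog (Gm _ _)) (gradeL_homog Gu) (gradeL_homog Gv).
rewrite (gradeR_homog Gu) (gradeR_homog Gv) !(linear_scal _ _ (ll _)) !(linear_scal _ _ (lr _)).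
rewrite -!scalerBl.
suff h (w : rdual gr) : rdual_supp w = [fset (r, s)]%fset ->
    z * w (mseq [:: shiftop 1 0 u; v] [:: z; 0] (r, s)) =
      (r - p - p')%:C%C * w (mseq [:: u; v] [:: z; 0] (r, s)) /\
    conjc z * w (mseq [:: shiftop 0 1 u; v] [:: z; 0] (r, s)) =
      (s - q - q')%:C%C * w (mseq [:: u; v] [:: z; 0] (r, s)).
  split; apply: (homog_ext dG (pre_findim pF (r, s))); try exact: subspace_scal.
    move=> w /h [e _]; rewrite linearZ [LHS]e linearZ; congr (_ * _).
    by rewrite !rmorphB /= addrAC.
  move=> w /h [_ e]; rewrite linearZ [LHS]e linearZ; congr (_ * _).
  by rewrite !rmorphB /= addrAC.
move=> sw; have := wirt_first_slot w u v z0; rewrite !(pairing_at _ sw) => hw.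
have H := @homogeneous_euler _ _ (r - p - p')%:C%C (s - q - q')%:C%C _ _ _ z0 hw.
rewrite !(pairing_at _ sw) in H; apply: H => t; rewrite !(pairing_at _ sw).
by rewrite (mseq_homogeneous _ _ _ _ Gu Gv) linearZ.
Qed.

(** The function m_2(u, v; z + t, t) is differentiated at [t = 0] in two ways: as the sum of the
    derivatives in the two points, and through its polynomial expansion by [translation]. *)
Lemma shiftop_bracket (u v : F) (z : C) r s : z != 0 ->
  shiftop 1 0 (mseq [:: u; v] [:: z; 0] (r - 1, s)) =
    mseq [:: u; shiftop 1 0 v] [:: z; 0] (r, s) + mseq [:: shiftop 1 0 u; v] [:: z; 0] (r, s) /\
  shiftop 0 1 (mseq [:: u; v] [:: z; 0] (r, s - 1)) =
    mseq [:: u; shiftop 0 1 v] [:: z; 0] (r, s) + mseq [:: shiftop 0 1 u; v] [:: z; 0] (r, s).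
Proof.
move=> z0; have sG : forall i, subspace (gr i) by have [] := dG.
have Gm u' v' : gr (r, s) (mseq [:: u'; v'] [:: z; 0] (r, s)) := mseq_homog pF _ _ _.
have G1 : gr (r, s) (shiftop 1 0 (mseq [:: u; v] [:: z; 0] (r - 1, s))).
  by have := shiftop_homog pF 1 0 (mseq_homog pF [:: u; v] [:: z; 0] (r - 1, s));
    rewrite subrK addr0.
have G2 : gr (r, s) (shiftop 0 1 (mseq [:: u; v] [:: z; 0] (r, s - 1))).
  by have := shiftop_homog pF 0 1 (mseq_homog pF [:: u; v] [:: z; 0] (r, s - 1));
    rewrite subrK addr0.
suff h (w : rdual gr) : rdual_supp w = [fset (r, s)]%fset ->
    w (shiftop 1 0 (mseq [:: u; v] [:: z; 0] (r - 1, s))) =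
     w (mseq [:: shiftop 1 0 u; v] [:: z; 0] (r, s)) + w (mseq [:: u; shiftop 1 0 v] [:: z;
       0] (r, s)) /\
    w (shiftop 0 1 (mseq [:: u; v] [:: z; 0] (r, s - 1))) =
     w (mseq [:: shiftop 0 1 u; v] [:: z; 0] (r, s)) + w (mseq [:: u; shiftop 0 1 v] [:: z;
       0] (r, s)).
  split; apply: (homog_ext dG (pre_findim pF (r, s))) => //;
    try by rewrite -[X in X + _]scale1r; apply: (sG (r, s)).2.
  - by move=> w /h [-> _]; rewrite linearD addrC.
  - by move=> w /h [_ ->]; rewrite linearD addrC.
move=> sw; have uz : uniq [:: z; 0] by rewrite /= inE z0.
have [A [B [hAB hw]]] := mseq_wirt pF w (erefl : size [:: u; v] = 2) (erefl : size [:: z;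
  0] = 2) isT uz.
have [eA eB] := hAB [tuple 1; 0] [tuple 0; 1].
have e11 : [tuple tnth [tuple 1; 0] j + tnth [tuple 0; 1] j | j < 2] = [tuple 1; 1] :> 2.-tuple C.
  by apply: eq_from_tnth => j; rewrite tnth_mktuple; case: j => [[|[|]]] //= ?;
    rewrite /tnth /= ?addr0 ?add0r.
rewrite e11 in eA eB.
have w1 : wirt (fun t => pairing w (mseq [:: u; v] [:: z + t; 0])) 0 (A [tuple 1; 0]) (B [tuple 1;
  0]).
  by apply: eq_wirt (hw [tuple 1; 0]) => // t; rewrite /= mulr1 mulr0 addr0.
have w2 : wirt (fun t => pairing w (mseq [:: v; u] [:: 0 + t; z])) 0 (A [tuple 0; 1]) (B [tuple 0;
  1]).
  by apply: eq_wirt (hw [tuple 0; 1]) => // t; rewrite /= mulr1 mulr0 addr0 (mseq_swap pF).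
have w3 : wirt (fun t => w (mseq [:: u; v] [:: t + z; t + 0] (r, s))) 0 (A [tuple 1;
  1]) (B [tuple 1; 1]).
  apply: eq_wirt (hw [tuple 1; 1]) => // t; rewrite /= mulr1 (pairing_at _ sw).
  by rewrite [z + t]addrC [0 + t]addrC.
have [e1 e1'] := wirt_unique ((wirt_shift _ _ _ _).1 w1) (wirt_first_slot w u v z0).
have z0' : 0 != z by rewrite eq_sym.
have [e2 e2'] := wirt_unique ((wirt_shift _ _ _ _).1 w2) (wirt_first_slot w v u z0').
have [N hN] := translation cF r s.
(* The coefficients of the expansion; those of orders (1, 0) and (0, 1) are the Wirtinger
   derivatives at 0. *)
pose X (k : 'I_N.+2 * 'I_N.+2) : C :=
  w (shiftop k.1 k.2 (mseq [:: u; v] [:: z; 0] (r - k.1%:R, s - k.2%:R))).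
have w4 := wirt_sum (index_enum ('I_N.+2 * 'I_N.+2)%type) (fun k =>
  wirt_lin (X k) (wirt_monomial R k.1 k.2) (wirt_cst 0 0)).
have [e3 e3'] : A [tuple 1; 1] = X (inord 1, inord 0) /\ B [tuple 1; 1] = X (inord 0, inord 1).
  have w4' : wirt (fun t => w (mseq [:: u; v] [:: t + z; t + 0] (r, s))) 0 (X (inord 1, inord 0))
     (X (inord 0, inord 1)).
    apply: eq_wirt w4 => [t||].
    - have := hN [:: u; v] [:: z; 0] t erefl; rewrite [map _ _]/= => ->; rewrite linear_sum.
      by apply: eq_bigr => k _; rewrite linearZ addr0 mulrC.
    - rewrite (bigD1 (inord 1, inord 0)) //= !inordK // eqxx mulr1 addr0 big1 ?addr0 // => -[i j]
        ij.
      rewrite addr0 /= (_ : (_ == _) = false) ?mulr0 //; apply: contraNF ij => /eqP [ei ej].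
      by apply/eqP; congr (_, _); apply: val_inj; rewrite /= inordK.
    - rewrite (bigD1 (inord 0, inord 1)) //= !inordK // eqxx mulr1 addr0 big1 ?addr0 // => -[i j]
        ij.
      rewrite addr0 /= (_ : (_ == _) = false) ?mulr0 //; apply: contraNF ij => /eqP [ei ej].
      by apply/eqP; congr (_, _); apply: val_inj; rewrite /= inordK.
  exact: wirt_unique w3 w4'.
move: e3 e3'; rewrite eA eB e1 e1' e2 e2' (mseq_swap pF (shiftop 1 0 v)) (mseq_swap pF (shiftop 0 1
  v)) /X /= !inordK //.
by rewrite !subr0 !(pairing_at _ sw).
Qed.

(** The operators D^L and D^R raise degrees by a fixed amount, so the sum of <w, D x> over the
    components of x is finite. *)
Lemma sums_shift (w : rdual gr) (f : R * R -> C) (a b : R) :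
  (forall pq, (pq.1 + a, pq.2 + b) \notin rdual_supp w -> f pq = 0) ->
  sums_absolutely f (\sum_(rs <- rdual_supp w) f (rs.1 - a, rs.2 - b)).
Proof.
move=> h; pose g (rs : R * R) := (rs.1 - a, rs.2 - b).
have gI : injective g by move=> [x y] [x' y'] [/addIr -> /addIr ->].
pose A := seq_fset tt [seq g rs | rs <- rdual_supp w].
have -> : \sum_(rs <- rdual_supp w) f (rs.1 - a, rs.2 - b) = \sum_(pq <- A) f pq.
  rewrite (perm_big _ (seq_fset_perm _ _)) undup_id ?map_inj_uniq ?fset_uniq //.
  by rewrite big_map.
apply: sums_finite => -[p q] pqA; apply: h; apply: contra pqA => pqw.
rewrite seq_fsetE; apply/mapP; exists (p + a, q + b) => //.
by rewrite /g /= !addrK.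
Qed.

Lemma mseq_conf2 (c : conf R 2) (z : C) (u v : F) : val c = [tuple z; 0] ->
  z != 0 /\ ffa_m [tuple u; v] c = mseq [:: u; v] [:: z; 0].
Proof.
move=> ec; have ec' : tval (val c) = [:: z; 0] by rewrite ec.
split; last by rewrite -(mseq_tuple (erefl (val [tuple u; v])) (esym ec')).
have /andP[_] := valP c; have -> : uniq (val c) = uniq [:: z; 0] by rewrite -ec'.
by rewrite /= inE andbT.
Qed.

Lemma ffa_of_core : @ffa_dL _ F = @gradeL _ F -> @ffa_dR _ F = @gradeR _ F ->
  @ffa_DL _ F = shiftop 1 0 -> @ffa_DR _ F = shiftop 0 1 -> is_ffa F.
Proof.
move=> edL edR eDL eDR; case: (pF) => c1 c2 c3 c4 c5 c6 c7 c8 c9 c10; have cint := core_int cF.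
have YE (w : rdual gr) u v : ffa_Y w u v = fun t => pairing w (mseq [:: u; v] [:: t; 0]).
  by apply/funext => t; rewrite /ffa_Y corr_mseq.
have hY (w : rdual gr) u v (z : C) : z != 0 ->
    ddz (ffa_Y w u v) z = pairing w (mseq [:: shiftop 1 0 u; v] [:: z; 0]) /\
    ddzbar (ffa_Y w u v) z = pairing w (mseq [:: shiftop 0 1 u; v] [:: z; 0]).
  move=> z0; rewrite YE; have hw := wirt_first_slot w u v z0.
  by rewrite (ddz_wirt hw) (ddzbar_wirt hw).
split=> //.
- by rewrite edL; exact: gradeL_linear.
- by rewrite edR; exact: gradeR_linear.
- by move=> p q u Gu; rewrite edL (gradeL_homog Gu).
- by move=> p q u Gu; rewrite edR (gradeR_homog Gu).
- by rewrite eDL; exact: (shiftop_linear pF).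
- by rewrite eDR; exact: (shiftop_linear pF).
- move=> p q u Gu; have [->|u0] := eqVneq u 0; first by rewrite scaler0.
  have [k ->] := cint _ _ _ Gu u0.
  have -> : 'i%C * (2 * pi * k%:~R)%:C%C = k%:~R * ('i%C * (2 * pi)%:C%C) :> C.
    by rewrite rmorphM rmorph_int; ring.
  rewrite cexpMz (_ : cexp _ = 1) ?expr1z ?exp1rz ?scale1r //.
  rewrite /cexp; simpc => /=.
  by rewrite mulr_natl cos2pi sin2pi expR0; simpc.
- move=> w u v z c ec; have [z0 ->] := mseq_conf2 u v ec.
  rewrite !(mseq_conf2 _ _ ec).2 edL (hY _ _ _ _ z0).1 /pairing mulr_sumr -sumrB -big_split /=.
  apply: eq_bigr => rs _; rewrite -linearZ (grade_bracket _ _ rs z0).1 !linearB.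
  by rewrite /= subrK.
- move=> w u v z c ec; have [z0 ->] := mseq_conf2 u v ec.
  rewrite !(mseq_conf2 _ _ ec).2 edR (hY _ _ _ _ z0).2 /pairing mulr_sumr -sumrB -big_split /=.
  apply: eq_bigr => rs _; rewrite -linearZ (grade_bracket _ _ rs z0).2 !linearB.
  by rewrite /= subrK.
- move=> w u v z c ec; have [z0 ->] := mseq_conf2 u v ec.
  rewrite !(mseq_conf2 _ _ ec).2 eDL.
  have -> : pairing w (mseq [:: u; shiftop 1 0 v] [:: z; 0]) + pairing w (mseq [:: shiftop 1 0 u;
    v] [:: z; 0]) =
     \sum_(rs <- rdual_supp w) w (shiftop 1 0 (mseq [:: u; v] [:: z; 0] (rs.1 - 1, rs.2 - 0))).
    rewrite /pairing -big_split /=; apply: eq_bigr => -[r s] _.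
    by rewrite -linearD subr0 (shiftop_bracket _ _ r s z0).1.
  apply: sums_shift => -[p q] /= pq; apply: rdual_out pq _.
  by have := shiftop_homog pF 1 0 (mseq_homog pF [:: u; v] [:: z; 0] (p, q)).
- move=> w u v z c ec; have [z0 ->] := mseq_conf2 u v ec.
  rewrite !(mseq_conf2 _ _ ec).2 eDR.
  have -> : pairing w (mseq [:: u; shiftop 0 1 v] [:: z; 0]) + pairing w (mseq [:: shiftop 0 1 u;
    v] [:: z; 0]) =
     \sum_(rs <- rdual_supp w) w (shiftop 0 1 (mseq [:: u; v] [:: z; 0] (rs.1 - 0, rs.2 - 1))).
    rewrite /pairing -big_split /=; apply: eq_bigr => -[r s] _.
    by rewrite -linearD subr0 (shiftop_bracket _ _ r s z0).2.
  apply: sums_shift => -[p q] /= pq; apply: rdual_out pq _.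
  by have := shiftop_homog pF 0 1 (mseq_homog pF [:: u; v] [:: z; 0] (p, q)).
- by move=> w u v z c ec; have [z0 ->] := mseq_conf2 (ffa_DL u) v ec; rewrite (hY _ _ _ _ z0).1 eDL.
- by move=> w u v z c ec; have [z0 ->] := mseq_conf2 (ffa_DR u) v ec; rewrite (hY _ _ _ _ z0).2 eDR.
Qed.

End FullFieldAlgebraOfCore.

(** * Covariance of the correlators of a full field algebra *)

Section HomogeneousLimits.
Variable R : realType.
Local Notation C := R[i].

(** For [c < 0] a point with [c * x >= M] violates the bound, since [expR y >= 1 + y]. *)
Lemma expR_bounded_below (c X M : R) : (forall x, x < X -> expR (c * x) <= M) -> 0 <= c.
Proof.
move=> h; rewrite leNgt; apply/negP => c0.
pose x := Num.min (X - 1) (M / c).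
have xX : x < X by rewrite /x gt_min ltrBlDr ltrDl ltr01.
have cx : M <= c * x.
  have : x <= M / c by rewrite /x ge_min lexx orbT.
  by rewrite -(ler_nM2l c0) mulrCA divff ?mulr1 // lt_eqF.
have := h x xX; have := expR_ge1Dx (c * x); lra.
Qed.

Variables (h : C -> C) (a b : R) (l : C).
Hypothesis hl : lim0 h l.
Hypothesis hom : forall t z, z != 0 -> h (cexp t * z) = cexp (a%:C%C * t + b%:C%C * conjc t) * h z.

Let normc_dilation (x : R) (z : C) : z != 0 ->
  normc (h (cexp x%:C%C * z)) = expR ((a + b) * x) * normc (h z).
Proof.
move=> z0; rewrite hom // normcM' normc_cexp; congr (expR _ * _).
by simpc => /=; ring.
Qed.

Let dilation_small (d x : R) (z : C) : z != 0 -> 0 < d -> x < ln (d / normc z) ->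
  normc (cexp x%:C%C * z) < d.
Proof.
move=> z0 d0 hx; have n0 : 0 < normc z by rewrite normc_gt0.
rewrite normcM' normc_cexp -ltr_pdivlMr //=.
by rewrite -[ltRHS]lnK ?posrE ?divr_gt0 // ltr_expR.
Qed.

(** Dilations by [expR x], [x] to minus infinity, bring [z] close to 0, where [h] is bounded, and
    multiply the modulus of [h] by [expR ((a + b) * x)]. *)
Lemma homogeneous_bound z : z != 0 -> h z != 0 -> 0 <= a + b.
Proof.
move=> z0 hz; have [d d0 hd] := hl ltr01.
have n0 : 0 < normc (h z) by rewrite normc_gt0.
apply: (@expR_bounded_below _ (ln (d / normc z)) ((normc l + 1) / normc (h z))) => x hx.
rewrite ler_pdivlMr // -normc_dilation //.
have := hd _ (dilation_small z0 d0 hx).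
have := normcD_le (h (cexp x%:C%C * z) - l) l; rewrite subrK; lra.
Qed.

(** Near 0 the function is bounded and bounded away from 0, which gives [a + b = 0]. It is then
    constant along rays, hence equal to [l] off 0, and rotations give [a = b]. *)
Lemma homogeneous_limit : l != 0 -> a = 0 /\ b = 0.
Proof.
move=> l0; have nl : 0 < normc l by rewrite normc_gt0.
have [d d0 hd] := hl nl.
have z0 : (d / 2)%:C%C != 0 :> C by rewrite eq_complex /= eqxx andbT; lra.
have hz0 : h (d / 2)%:C%C != 0.
  apply/eqP => h0; have := hd (d / 2)%:C%C; rewrite h0 sub0r normcN' normcR ger0_norm; last by lra.
  by move=> H; have := H ltac:(lra); lra.
have ab : a + b = 0.
  apply/eqP; rewrite eq_le (homogeneous_bound z0 hz0) andbT -oppr_ge0.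
  have nl2 : 0 < normc l / 2 by lra.
  have [d' d'0 hd'] := hl nl2.
  apply: (@expR_bounded_below _ (ln (d' / normc (d / 2)%:C%C)) (normc (h (d / 2)%:C%C) / (normc l /
    2))) => x hx.
  rewrite mulNr expRN ler_pdivlMr // ler_pdivrMl ?expR_gt0 // -normc_dilation //.
  have := hd' _ (dilation_small z0 d'0 hx).
  have := normcD_le (l - h (cexp x%:C%C * (d / 2)%:C%C)) (h (cexp x%:C%C * (d / 2)%:C%C)).
  by rewrite subrK normcB; lra.
have hc z : z != 0 -> h z = l.
  move=> zz; apply/eqP; rewrite -subr_eq0 -normc_eq0; apply: contraT => e0.
  have e1 : 0 < normc (h z - l) by rewrite lt0r e0 normc_ge0.
  have [d' d'0 hd'] := hl e1.
  have := hd' _ (@dilation_small d' (ln (d' / normc z) - 1) z zz d'0 ltac:(lra)).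
  rewrite hom // (_ : a%:C%C * _ + _ = 0) ?cexp0 ?mul1r ?ltxx //.
  by simpc; rewrite -mulrDl ab mul0r; simpc.
have ph (t : R) : cexp ((a - b)%:C%C * 'i%C * t%:C%C) = 1.
  have c0 : cexp ('i%C * t%:C%C) * (d / 2)%:C%C != 0 by rewrite mulf_neq0 ?cexp_neq0.
  have := hom ('i%C * t%:C%C) z0; rewrite !hc // => /esym;
    rewrite -[X in _ = X]mul1r => /(mulIf l0) <-.
  by congr cexp; simpc; congr (_ +i* _)%C; ring.
have := cexp_line_trivial ph; simpc => -[] e; split; lra.
Qed.

End HomogeneousLimits.

(** * Integrality from the period of the exponential *)

Section Integrality.
Variable R : realType.

Lemma cexp_2pi_int (k : int) : cexp ('i%C * (2 * pi * k%:~R)%:C%C) = 1 :> R[i].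
Proof.
have -> : 'i%C * (2 * pi * k%:~R)%:C%C = k%:~R * ('i%C * (2 * pi)%:C%C) :> R[i].
  by rewrite rmorphM rmorph_int; ring.
rewrite cexpMz (_ : cexp _ = 1) ?expr1z ?exp1rz //.
rewrite /cexp; simpc => /=.
by rewrite mulr_natl cos2pi sin2pi expR0; simpc.
Qed.

(** The fractional part [y] satisfies [cos (2 pi y) = 1]. The arccosine inverts cos on [0, pi], so
    an angle beyond pi is first reflected to [2 pi - 2 pi y]. *)
Lemma cexp_period_int (x : R) : cexp ('i%C * (2 * pi * x)%:C%C) = 1 :> R[i] -> exists k : int,
  x = k%:~R.
Proof.
move=> h; pose y := x - (Num.floor x)%:~R.
have y0 : 0 <= y by rewrite subr_ge0 floor_le_tmp.
have y1 : y < 1 by have := floorD1_gt x; rewrite intrD /y; lra.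
have hy : cexp ('i%C * (2 * pi * y)%:C%C) = 1 :> R[i].
  rewrite /y mulrBr rmorphB mulrBr cexpD h mul1r cexpN.
  by rewrite cexp_2pi_int invr1.
have cy : cos (2 * pi * y) = 1.
  move: hy; rewrite /cexp; simpc => /=; rewrite expR0 => -[].
  by simpc.
have py := pi_gt0 R.
suff : y = 0 by rewrite /y => /eqP; rewrite subr_eq0 => /eqP ->; eexists.
have [le|gt] := lerP (2 * pi * y) pi.
  have := @cosK R (2 * pi * y); rewrite cy acos1 in_itv /= le mulr_ge0 ?mulr_ge0 ?(ltW py) // => /(_
    isT) /esym /eqP.
  by rewrite !mulf_eq0 pnatr_eq0 (gt_eqF py) /= => /eqP.
have : acos (cos (2 * pi - 2 * pi * y)) = 2 * pi - 2 * pi * y.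
  by apply: cosK; rewrite in_itv /=; apply/andP; split; nra.
have -> : cos (2 * pi - 2 * pi * y) = 1.
  by rewrite [2 * pi]mulr_natl cosB cos2pi sin2pi -mulr_natl cy mul1r mul0r addr0.
rewrite acos1; nra.
Qed.
End Integrality.

Section ComplexNumbers.
Variable R : realType.
Local Notation C := R[i].

Lemma normc_max (z : seq C) : z != [::] -> exists2 x, x \in z & forall y,
  y \in z -> normc y <= normc x.
Proof.
elim: z => // x z IH _; have [->|z0] := eqVneq z [::].
  by exists x; rewrite ?mem_head // => y; rewrite inE => /eqP ->.
have [m mz hm] := IH z0; have [xm|mx] := lerP (normc x) (normc m).
  by exists m; rewrite ?inE ?mz ?orbT // => y; rewrite inE => /orP[/eqP ->|/hm].
exists x; rewrite ?mem_head // => y; rewrite inE => /orP[/eqP -> //|/hm] h.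
exact: le_trans h (ltW mx).
Qed.

(** Strict convexity of the disc: after translation by a point [x] of maximal modulus, that point is
    strictly the farthest from 0. *)
Lemma normcD_lt (x y : C) : normc y <= normc x -> y != x -> normc (x + y) < normc (x + x).
Proof.
case: x y => a b [c d] + ne; have h : 0 < (a - c) ^+ 2 + (b - d) ^+ 2.
  rewrite lt0r addr_ge0 ?sqr_ge0 // andbT; apply: contra ne.
  rewrite paddr_eq0 ?sqr_ge0 // !sqrf_eq0 !subr_eq0 => /andP[/eqP -> /eqP ->] //.
rewrite /normc ler_sqrt ?addr_ge0 ?sqr_ge0 // => le.
have h2 : 0 <= (a + c) ^+ 2 + (b + d) ^+ 2 by rewrite addr_ge0 ?sqr_ge0.
have h3 : (a + c) ^+ 2 + (b + d) ^+ 2 < (a + a) ^+ 2 + (b + b) ^+ 2.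
  rewrite !expr2 in h h2 le *; lra.
by rewrite ltr_sqrt // (le_lt_trans h2).
Qed.

End ComplexNumbers.

(** * The core of a full field algebra *)

Section CoreOfFullFieldAlgebra.
Variable R : realType.
Local Notation C := R[i].
Variable F : ffa_data R.
Local Notation gr := (@ffa_gr _ F).
Hypothesis fF : is_ffa F.
Let pF := precore_of_ffa fF.
Let dG := pre_grading pF.
Local Notation one := (@ffa_one _ F).

Let linl (v : F) z pq := mseq2_linl pF v pq (erefl : size [:: z; 0] = 2).
Let linr (u : F) z pq := mseq2_linr pF u pq (erefl : size [:: z; 0] = 2).

(** Smoothness provides the derivatives of m_2 in its first point; the axioms identify them with
    insertions of D^L u and D^R u and place them in the brackets. *)
Lemma ffa_wirt (w : rdual gr) (u v : F) (z : C) : z != 0 -> exists A B,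
  [/\ wirt (fun t => pairing w (mseq [:: u; v] [:: t; 0])) z A B,
    A = pairing w (mseq [:: ffa_DL u; v] [:: z; 0]) /\ B = pairing w (mseq [:: ffa_DR u; v] [:: z;
      0]),
    pairing w (fun pq => ffa_dL (mseq [:: u; v] [:: z; 0] pq)) - pairing w (mseq [:: u;
      ffa_dL v] [:: z; 0])
      = z * A + pairing w (mseq [:: ffa_dL u; v] [:: z; 0]) &
    pairing w (fun pq => ffa_dR (mseq [:: u; v] [:: z; 0] pq)) - pairing w (mseq [:: u;
      ffa_dR v] [:: z; 0])
      = conjc z * B + pairing w (mseq [:: ffa_dR u; v] [:: z; 0])].
Proof.
move=> z0; have uz : uniq [:: z; 0] by rewrite /= inE z0.
have [c ec0] := @conf_ex _ 2 [:: z; 0] erefl isT uz.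
have ec : val c = [tuple z; 0] by apply: val_inj.
have cm u' v' := (mseq_conf2 (F := F) u' v' ec).2.
have YE : ffa_Y w u v = fun t => pairing w (mseq [:: u; v] [:: t; 0]).
  by apply/funext => t; rewrite /ffa_Y corr_mseq.
have [A0 [B0 [_ hw]]] := mseq_wirt pF w (erefl : size [:: u; v] = 2) (erefl : size [:: z;
  0] = 2) isT uz.
have {}hw : wirt (fun t => pairing w (mseq [:: u; v] [:: t; 0])) z (A0 [tuple 1; 0]) (B0 [tuple 1;
  0]).
  by apply/wirt_shift; apply: eq_wirt (hw [tuple 1; 0]) => // t; rewrite /= mulr1 mulr0 addr0.
exists (A0 [tuple 1; 0]), (B0 [tuple 1; 0]); split=> //.
- rewrite -!cm (ffa_D_derivL fF w u v ec) (ffa_D_derivR fF w u v ec) YE.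
  by rewrite (ddz_wirt hw) (ddzbar_wirt hw).
- by have := ffa_d_bracketL fF w u v ec; rewrite YE !cm (ddz_wirt hw).
- by have := ffa_d_bracketR fF w u v ec; rewrite YE !cm (ddzbar_wirt hw).
Qed.

Lemma ffa_euler (w : rdual gr) p q p' q' r s (u v : F) z : z != 0 ->
  gr (p, q) u -> gr (p', q') v -> rdual_supp w = [fset (r, s)]%fset ->
  wirt (fun t => pairing w (mseq [:: u; v] [:: t; 0])) z
    (pairing w (mseq [:: ffa_DL u; v] [:: z; 0])) (pairing w (mseq [:: ffa_DR u; v] [:: z; 0])) /\
  z * pairing w (mseq [:: ffa_DL u; v] [:: z; 0]) =
     (r - p - p')%:C%C * pairing w (mseq [:: u; v] [:: z; 0]) /\
  conjc z * pairing w (mseq [:: ffa_DR u; v] [:: z; 0]) =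
     (s - q - q')%:C%C * pairing w (mseq [:: u; v] [:: z; 0]).
Proof.
move=> z0 Gu Gv sw; have [A [B [hw [eA eB]]]] := ffa_wirt w u v z0.
have Gm := mseq_homog pF [:: u; v] [:: z; 0] (r, s).
rewrite -eA -eB !(pairing_at _ sw) (ffa_dLE fF Gu) (ffa_dLE fF Gv) (ffa_dRE fF Gu) (ffa_dRE fF Gv).
rewrite (ffa_dLE fF Gm) (ffa_dRE fF Gm).
rewrite !(linear_scal _ _ (linl _ _ _)) !(linear_scal _ _ (linr _ _ _)).
have wZ k x : w (k *: x) = k * w x by rewrite linearZ.
rewrite !wZ => hL hR; split; first by apply: eq_wirt hw.
by split; rewrite !rmorphB !mulrBl addrAC ?hL ?hR addrK.
Qed.

Lemma ffa_homogeneous p q p' q' r s (u v : F) (z t : C) : gr (p, q) u -> gr (p', q') v ->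
  mseq [:: u; v] [:: cexp t * z; 0] (r, s) =
  cexp ((r - p - p')%:C%C * t + (s - q - q')%:C%C * conjc t) *: mseq [:: u; v] [:: z; 0] (r, s).
Proof.
move=> Gu Gv; have [->|z0] := eqVneq z 0.
  by rewrite mulr0 mseq_degenerate /= ?inE ?eqxx // scaler0.
have sG : forall i, subspace (gr i) by have [] := dG.
apply: (homog_ext dG (pre_findim pF (r, s))); first exact: mseq_homog.
  by apply: subspace_scal => //; exact: mseq_homog.
move=> w sw; rewrite linearZ -!(pairing_at _ sw).
apply: (@euler_homogeneous _ (fun x => pairing w (mseq [:: u; v] [:: x; 0]))) => // x x0.
by have [h1 [h2 h3]] := ffa_euler x0 Gu Gv sw; do 2!eexists; split; first exact: h1.
Qed.

Lemma ffa_single_valued_int p q u : gr (p, q) u -> u != 0 -> exists k : int, p - q = k%:~R.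
Proof.
move=> Gu u0; apply: cexp_period_int; apply/eqP; rewrite -subr_eq0.
have /eqP := ffa_single_valued fF Gu; rewrite -subr_eq0 -[X in _ - X]scale1r -scalerBl scaler_eq0.
by rewrite (negPf u0) orbF.
Qed.

Lemma ffa_dL_grade : @ffa_dL _ F = @gradeL _ F.
Proof.
apply/funext; apply: (gmap_unique dG) => [pq a x y||[p q] u Gu].
- by rewrite scalerDr !scalerA mulrC.
- exact: ffa_dL_linear.
- exact: ffa_dLE Gu.
Qed.

Lemma ffa_dR_grade : @ffa_dR _ F = @gradeR _ F.
Proof.
apply/funext; apply: (gmap_unique dG) => [pq a x y||[p q] u Gu].
- by rewrite scalerDr !scalerA mulrC.
- exact: ffa_dR_linear.
- exact: ffa_dRE Gu.
Qed.

Lemma component_dL u p q : component gr (ffa_dL u) (p, q) = p%:C%C *: component gr u (p, q).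
Proof.
rewrite ffa_dL_grade; apply: (component_gmap dG (T := fun pq x => pq.1%:C%C *: x)).
  by move=> pq a x y; rewrite scalerDr !scalerA mulrC.
by move=> pq x Gx; apply: subspace_scal => //; have [] := dG.
Qed.

Lemma component_dR u p q : component gr (ffa_dR u) (p, q) = q%:C%C *: component gr u (p, q).
Proof.
rewrite ffa_dR_grade; apply: (component_gmap dG (T := fun pq x => pq.2%:C%C *: x)).
  by move=> pq a x y; rewrite scalerDr !scalerA mulrC.
by move=> pq x Gx; apply: subspace_scal => //; have [] := dG.
Qed.

(** A vacuum in the first slot does nothing, so m_2(1, 1; z, 0) is constant in z and the bracket
    leaves m_1(d 1; z) = 0 for nonzero z. Continuity at 0 gives d 1 = 0. *)
Lemma ffa_d_one : ffa_dL one = 0 /\ ffa_dR one = 0.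
Proof.
have d0 (x : F) : (forall (w : rdual gr) z, z != 0 -> pairing w (mseq [:: x] [:: z]) = 0) -> x = 0.
  move=> h; apply: (rdual_ext dG (pre_findim pF)) => w; rewrite raddf0.
  by apply/esym/(lim0_off (m1_continuous pF w x)) => t /h.
have m1E (x : F) z : z != 0 -> mseq [:: one; x] [:: z; 0] = component gr x.
  move=> z0; rewrite (mseq_swap pF) (component_eq dG (mseq_identity1 pF x)).
  by rewrite -(@mseq_identity _ _ pF [:: x] [:: 0] z) //= inE eq_sym z0.
have pE (w : rdual gr) x : pairing w (component gr x) = w x :=
  pairing_embeds w (embeds_component dG x).
split; apply: d0 => w z z0; have [A [B [hw _ hL hR]]] := ffa_wirt w one one z0;
  rewrite -(mseq_one1 pF _ z0).
(* The function is constant as long as [z + t] is not 0: quadratic bound 0 on the radius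
   [normc z]. *)
all: have w0 : wirt (fun t => pairing w (mseq [:: one; one] [:: t; 0])) z 0 0 by
  apply: (@wirt_quad _ _ _ _ _ 0 (normc z)); rewrite ?normc_gt0 // => t tz;
  rewrite !m1E ?subrr ?mul0r ?addr0 ?subr0 ?normc0' ?mul0r //;
  apply: contraTneq tz => /eqP; rewrite addrC addr_eq0 => /eqP ->; rewrite normcN' ltxx.
all: have [eA eB] := wirt_unique hw w0.
- move: hL; rewrite eA mulr0 add0r !m1E // pE => <-.
  rewrite (_ : (fun pq => _) = component gr (ffa_dL one)) ?pE ?subrr //.
  by apply/funext => -[p q]; rewrite component_dL (ffa_dLE fF (component_in dG _ _)).
- move: hR; rewrite eB mulr0 add0r !m1E // pE => <-.
  rewrite (_ : (fun pq => _) = component gr (ffa_dR one)) ?pE ?subrr //.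
  by apply/funext => -[p q]; rewrite component_dR (ffa_dRE fF (component_in dG _ _)).
Qed.

Lemma ffa_one_homog : gr (0, 0) one.
Proof.
have [dL0 dR0] := ffa_d_one; have [s [_ ->]] := component_supp dG one.
apply: subspace_sum => [|[p q]]; first by have [] := dG.
have Gx := component_in dG one (p, q).
have [->|x0] := eqVneq (component gr one (p, q)) 0; first exact: homog0.
suff [-> ->] : p = 0 /\ q = 0 by exact: component_in.
have := component_dL one p q; rewrite dL0; have := component_dR one p q; rewrite dR0.
rewrite (component_homog dG _ (homog0 dG (p, q))) eqxx => /esym/eqP + /esym/eqP.
rewrite !scaler_eq0 !(negPf x0) !orbF => /eqP [->] /eqP [->] //.
Qed.

Lemma ffa_m1_homogeneous p q r s (u : F) (z t : C) : gr (p, q) u ->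
  mseq [:: u] [:: cexp t * z] (r, s) =
  cexp ((r - p)%:C%C * t + (s - q)%:C%C * conjc t) *: mseq [:: u] [:: z] (r, s).
Proof.
move=> Gu; have [->|z0] := eqVneq z 0; last first.
  have ct0 : cexp t * z != 0 by rewrite mulf_neq0 ?cexp_neq0.
  by rewrite -!(mseq_one1 pF) // (ffa_homogeneous _ _ _ _ Gu ffa_one_homog) !subr0.
rewrite mulr0 -(component_eq dG (mseq_identity1 pF u)) (component_homog dG _ Gu).
by case: eqP => [[-> ->]|_]; rewrite ?scaler0 // !subrr !mul0r addr0 cexp0 scale1r.
Qed.

Lemma ffa_D_m1 p q r s (u : F) t : t != 0 -> gr (p, q) u ->
  t *: mseq [:: ffa_DL u] [:: t] (r, s) = (r - p)%:C%C *: mseq [:: u] [:: t] (r, s) /\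
  conjc t *: mseq [:: ffa_DR u] [:: t] (r, s) = (s - q)%:C%C *: mseq [:: u] [:: t] (r, s).
Proof.
move=> t0 Gu; have sG : forall i, subspace (gr i) by have [] := dG.
suff h (w : rdual gr) : rdual_supp w = [fset (r, s)]%fset ->
    t * w (mseq [:: ffa_DL u] [:: t] (r, s)) = (r - p)%:C%C * w (mseq [:: u] [:: t] (r, s)) /\
    conjc t * w (mseq [:: ffa_DR u] [:: t] (r, s)) = (s - q)%:C%C * w (mseq [:: u] [:: t] (r, s)).
  split; apply: (homog_ext dG (pre_findim pF (r, s))); try by apply: subspace_scal => //;
    exact: mseq_homog.
  - by move=> w /h [e _]; rewrite !linearZ.
  - by move=> w /h [_ e]; rewrite !linearZ.
move=> sw; have [_ ] := ffa_euler t0 Gu ffa_one_homog sw.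
by rewrite !(mseq_one1 pF) // !(pairing_at _ sw) !subr0.
Qed.

(** In degree (r, s), m_1(D^L u; t) is homogeneous of exponents (r - p - 1, s - q). Its value at 0
    is the component of D^L u, and a nonzero value forces both exponents to vanish. *)
Lemma ffa_D_homog p q u : gr (p, q) u -> gr (p + 1, q) (ffa_DL u) /\ gr (p, q + 1) (ffa_DR u).
Proof.
move=> Gu; have sG : forall i, subspace (gr i) by have [] := dG.
have conc (x : F) (a b : R) : (forall (w : rdual gr) r s, rdual_supp w = [fset (r, s)]%fset ->
    w x != 0 -> r = a /\ s = b) -> gr (a, b) x.
  move=> h; have [S [_ ->]] := component_supp dG x; apply: subspace_sum => // -[r s].
  have [->|x0] := eqVneq (component gr x (r, s)) 0; first exact: homog0.
  have [w [sw w0]] := homog_form dG (pre_findim pF (r, s)) (component_in dG x (r, s)) x0.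
  have wx : w x = w (component gr x (r, s)).
    by rewrite -(pairing_at _ sw) (pairing_embeds w (embeds_component dG x)).
  rewrite -wx in w0.
  by have [-> ->] := h w r s sw w0; exact: component_in.
have tw k (w : rdual gr) x : w (k *: x) = k * w x by rewrite linearZ.
split; apply: conc => w r s sw w0.
- have hom t z : z != 0 -> pairing w (mseq [:: ffa_DL u] [:: cexp t * z]) =
     cexp ((r - p - 1)%:C%C * t + (s - q)%:C%C * conjc t) * pairing w (mseq [:: ffa_DL u] [:: z]).
    move=> z0; have ct0 : cexp t * z != 0 by rewrite mulf_neq0 ?cexp_neq0.
    have e1 := congr1 w (ffa_D_m1 r s ct0 Gu).1; have e2 := congr1 w (ffa_D_m1 r s z0 Gu).1.
    rewrite !tw in e1 e2; rewrite !(pairing_at _ sw); apply: (mulfI ct0).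
    rewrite e1 (ffa_m1_homogeneous _ _ _ _ Gu) tw mulrCA -e2.
    have -> : cexp ((r - p)%:C%C * t + (s - q)%:C%C * conjc t) =
        cexp t * cexp ((r - p - 1)%:C%C * t + (s - q)%:C%C * conjc t).
      by rewrite -cexpD; congr cexp; rewrite !rmorphB /=; ring.
    by ring.
  have [] := homogeneous_limit (m1_continuous pF w (ffa_DL u)) hom w0; split; lra.
- have hom t z : z != 0 -> pairing w (mseq [:: ffa_DR u] [:: cexp t * z]) =
     cexp ((r - p)%:C%C * t + (s - q - 1)%:C%C * conjc t) * pairing w (mseq [:: ffa_DR u] [:: z]).
    move=> z0; have ct0 : cexp t * z != 0 by rewrite mulf_neq0 ?cexp_neq0.
    have cct0 : conjc (cexp t * z) != 0 by rewrite conjc_eq0.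
    have e1 := congr1 w (ffa_D_m1 r s ct0 Gu).2; have e2 := congr1 w (ffa_D_m1 r s z0 Gu).2.
    rewrite !tw in e1 e2; rewrite !(pairing_at _ sw); apply: (mulfI cct0).
    rewrite e1 (ffa_m1_homogeneous _ _ _ _ Gu) tw mulrCA -e2.
    have -> : cexp ((r - p)%:C%C * t + (s - q)%:C%C * conjc t) =
        conjc (cexp t) * cexp ((r - p)%:C%C * t + (s - q - 1)%:C%C * conjc t).
      by rewrite -cexp_conj -cexpD; congr cexp; rewrite !rmorphB /=; ring.
    have -> : conjc (cexp t * z) = conjc (cexp t) * conjc z by rewrite rmorphM.
    by rewrite mulrACA.
  have [] := homogeneous_limit (m1_continuous pF w (ffa_DR u)) hom w0; split; lra.
Qed.

(** Replacing [u] by D^L u raises p by 1 and keeps the matrix element nonzero as long as r differs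
    from p. The total exponent r - p + s - q cannot become negative, so this ends, and it can end
    only at r = p; likewise for q. *)
Lemma ffa_degrees p q (u : F) t r s : gr (p, q) u -> mseq [:: u] [:: t] (r, s) != 0 ->
  exists i j : nat, r = p + i%:R /\ s = q + j%:R.
Proof.
have [->|t0] := eqVneq t 0.
  move=> Gu; rewrite -(component_eq dG (mseq_identity1 pF u)) (component_homog dG _ Gu).
  have [e|_] := eqVneq (r, s) (p, q); last by rewrite eqxx.
  case: e => -> -> _; by exists 0%N, 0%N; rewrite !addr0.
have pos p' q' x : gr (p', q') x -> mseq [:: x] [:: t] (r, s) != 0 -> 0 <= (r - p') + (s - q').
  move=> Gx n0.
  have [w [sw w0]] := homog_form dG (pre_findim pF (r, s)) (mseq_homog pF _ _ _) n0.
  apply: (@homogeneous_bound _ _ _ _ _ (m1_continuous pF w x) _ t) => //.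
    by move=> y z z0; rewrite !(pairing_at _ sw) (ffa_m1_homogeneous _ _ _ _ Gx) linearZ.
  by rewrite (pairing_at _ sw).
move=> Gu n0; suff hL : exists i : nat, r - p = i%:R.
  suff hR : exists j : nat, s - q = j%:R.
    by have [i hi] := hL; have [j hj] := hR; exists i, j;
      rewrite -hi -hj ![_ + (_ - _)]addrC !subrK.
  have [n hn] : exists n : nat, (r - p) + (s - q) < n%:R.
    by exists (Num.truncn ((r - p) + (s - q))).+1; exact: truncnS_gt.
  clear hL; elim: n p q u Gu n0 hn => [|n IH] p q u Gu n0 hn; first by have := pos _ _ _ Gu n0; lra.
  have [->|a0] := eqVneq (s - q) 0; first by exists 0%N.
  have [_ G'] := ffa_D_homog Gu; have [j hj] : exists j : nat, s - (q + 1) = j%:R.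
    apply: (IH p (q + 1) (ffa_DR u)) => //; last by move: hn; rewrite -natr1; lra.
    have := (ffa_D_m1 r s t0 Gu).2; apply: contra_eq_neq => ->;
      rewrite scaler0 eq_sym scaler_eq0 negb_or n0 andbT.
    by rewrite eq_complex /= eqxx andbT.
  by exists j.+1; rewrite -natr1 -hj; ring.
have [n hn] : exists n : nat, (r - p) + (s - q) < n%:R.
  by exists (Num.truncn ((r - p) + (s - q))).+1; exact: truncnS_gt.
elim: n p q u Gu n0 hn => [|n IH] p q u Gu n0 hn; first by have := pos _ _ _ Gu n0; lra.
have [->|a0] := eqVneq (r - p) 0; first by exists 0%N.
have [G' _] := ffa_D_homog Gu; have [j hj] : exists j : nat, r - (p + 1) = j%:R.
  apply: (IH (p + 1) q (ffa_DL u)) => //; last by move: hn; rewrite -natr1; lra.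
  have := (ffa_D_m1 r s t0 Gu).1; apply: contra_eq_neq => ->;
    rewrite scaler0 eq_sym scaler_eq0 negb_or n0 andbT.
  by rewrite eq_complex /= eqxx andbT.
by exists j.+1; rewrite -natr1 -hj; ring.
Qed.

Definition scales (c : C) (v : seq F) (z : seq C) := forall r s,
  chi (- r%:C%C) (- s%:C%C) c *: mseq v z (r, s) = mseq (map (act c) v) [seq x / c | x <- z] (r, s).

Lemma ffa_act_one c : act c one = one.
Proof. by rewrite (act_homog dG c ffa_one_homog) oppr0 chi0 scale1r. Qed.

Lemma ffa_chi_cexp p q (u : F) t : gr (p, q) u -> u != 0 ->
  chi (- p%:C%C) (- q%:C%C) (cexp t) = cexp (- p%:C%C * t + - q%:C%C * conjc t).
Proof.
move=> Gu u0; have [k hk] := ffa_single_valued_int Gu u0; apply: (@chi_cexp _ _ _ _ (- k)).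
by rewrite opprK addrC -rmorphB /= -opprB hk rmorphN /= mulrNz rmorph_int.
Qed.

Lemma scales2 c (u v : F) z : c != 0 -> scales c [:: u; v] [:: z; 0].
Proof.
move=> c0 r s; rewrite /= mul0r.
have comb (k a : C) (A B X Y : F) : k *: A = X -> k *: B = Y -> k *: (a *: A + B) = a *: X + Y.
  by move=> <- <-; rewrite scalerDr !scalerA mulrC.
move: u; apply: (component_ind dG (0, 0)) => [[p q] u Gu|a x y IH1 IH2]; last first.
  by rewrite (act_linear dG) !linl; exact: comb.
move: v; apply: (component_ind dG (0, 0)) => [[p' q'] v Gv|a x y IH1 IH2]; last first.
  by rewrite (act_linear dG) !linr; exact: comb.
rewrite (act_homog dG _ Gu) (act_homog dG _ Gv) (linear_scal _ _ (linl _ _ _)) (linear_scal _ _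
  (linr _ _ _)).
rewrite -(clogK c0) -[_ / _]mulrC -cexpN (ffa_homogeneous _ _ _ _ Gu Gv) !scalerA.
set M := mseq _ _ _; have [->|M0] := eqVneq M 0; first by rewrite !scaler0.
have u0 : u != 0 by apply: contraNneq M0 => u0; rewrite /M u0 (linear0 (linl _ _ _)).
have v0 : v != 0 by apply: contraNneq M0 => v0; rewrite /M v0 (linear0 (linr _ _ _)).
rewrite (ffa_chi_cexp _ Gu u0) (ffa_chi_cexp _ Gv v0) (ffa_chi_cexp _ (mseq_homog pF _ _ _) M0)
  -!cexpD.
by congr (cexp _ *: _); rewrite !rmorphB !rmorphN /=; ring.
Qed.

Lemma scales1 c (u : F) z : c != 0 -> scales c [:: u] [:: z].
Proof.
move=> c0 r s; have [->|z0] := eqVneq z 0; last first.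
  have zc0 : z / c != 0 by rewrite mulf_neq0 ?invr_neq0.
  have := @scales2 c u one z c0 r s.
  by rewrite /= ffa_act_one mul0r !(mseq_one1 pF).
rewrite /= mul0r -!(component_eq dG (mseq_identity1 pF _)).
by rewrite component_act.
Qed.

(** The correlator at [z] is m_1 at [- t] with the translated correlator inserted, which holds for
    every [t] as m_1 has no other point. Covariance of both factors makes the two expansions agree
    term by term. *)
Lemma scales_translate (c t : C) (v : seq F) (z : seq C) : c != 0 -> size v = size z -> z != [::] ->
  uniq z ->
  scales c v [seq x + t | x <- z] -> scales c v z.
Proof.
move=> c0 sv z0 uz h r s; have sG : forall i, subspace (gr i) by have [] := dG.
apply: (homog_ext dG (pre_findim pF (r, s))); [by apply: subspace_scal => //;
  exact: mseq_homog|exact: mseq_homog|].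
move=> w sw; rewrite linearZ -!(pairing_at _ sw).
have expansion v' t' z' : size v' = size z' -> z' != [::] -> uniq z' ->
   sums_absolutely (fun pq => pairing w (mseq [:: mseq v' [seq x + t' |
     x <- z'] pq] [:: - t'])) (pairing w (mseq v' z')).
  move=> sv' z0' uz'; have uz1 : uniq [seq x + t' | x <- z'] by rewrite map_inj_uniq //;
    exact: addIr.
  have := @mseq_convergence _ _ pF 0 [:: 0] v' [:: - t'] [seq x + t' | x <- z'] isT erefl.
  rewrite size_map => /(_ sv'); have -> : [seq x + t' | x <- z'] != [::] by case: (z') z0'.
  move=> /(_ isT isT uz1); have hh : forall (x : C) (j : nat), x \in [seq x + t' |
    x <- z'] -> (j < 1)%N -> j != 0%N ->
    normc x < normc (- t' - nth 0 [:: - t'] j) by move=> x [|j].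
  move=> /(_ hh w); rewrite /splice /= !cats0 -map_comp.
  have -> : [seq - t' + (x + t') | x <- z'] = z' by rewrite -[RHS]map_id; apply: eq_map => x /=;
    ring.
  by [].
have uzc : uniq [seq x / c | x <- z] by rewrite map_inj_uniq //; apply: mulIf; rewrite invr_neq0.
have szc : size (map (act c) v) = size [seq x / c | x <- z] by rewrite !size_map.
have z0c : [seq x / c | x <- z] != [::] by case: (z) z0.
apply: sums_unique (sums_scale _ (expansion v t z sv z0 uz)) _.
apply: eq_sums (expansion _ (t / c) _ szc z0c uzc) => -[p q].
rewrite !(pairing_at _ sw).
have -> : [seq x + t / c | x <- [seq x / c | x <- z]] = [seq x / c | x <- [seq x + t | x <- z]].
  by rewrite -!map_comp; apply: eq_map => x /=; rewrite mulrDl.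
rewrite -h -(act_homog dG c (mseq_homog pF _ _ _)) -linearZ; congr (w _).
by have := @scales1 c (mseq v [seq x + t | x <- z] (p, q)) (- t) c0 r s; rewrite /= mulNr => <-.
Qed.

(** As [y] is the farthest from 0, the correlator is m_2 at [y] and 0 with the remaining one
    inserted at 0; covariance of both factors makes the expansions agree term by term. *)
Lemma scales_cons (c : C) (u : F) (v : seq F) (y : C) (z : seq C) : c != 0 -> size v = size z ->
  z != [::] -> uniq z ->
  (forall x, x \in z -> normc x < normc y) -> scales c v z -> scales c (u :: v) (y :: z).
Proof.
move=> c0 sv z0 uz hy h r s; have sG : forall i, subspace (gr i) by have [] := dG.
have y0 : y != 0.
  by case: z z0 hy {sv uz h} => // x z _ /(_ x (mem_head _ _)) hx; rewrite -normc_gt0;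
    apply: le_lt_trans hx; exact: normc_ge0.
apply: (homog_ext dG (pre_findim pF (r, s))); [by apply: subspace_scal => //;
  exact: mseq_homog|exact: mseq_homog|].
move=> w sw; rewrite linearZ -!(pairing_at _ sw).
have expansion u' v' y' z' : size v' = size z' -> z' != [::] -> uniq z' -> y' != 0 ->
   (forall x, x \in z' -> normc x < normc y') ->
   sums_absolutely (fun pq => pairing w (mseq [:: u'; mseq v' z' pq] [:: y';
     0])) (pairing w (mseq (u' :: v') (y' :: z'))).
  move=> sv' z0' uz' y0' hy'; have uy : uniq [:: y'; 0] by rewrite /= inE y0'.
  have := @mseq_convergence _ _ pF 1 [:: u'; 0] v' [:: y'; 0] z' isT erefl sv' z0' uy uz'.
  have hh : forall (x : C) (j : nat), x \in z' -> (j < 2)%N -> j != 1%N ->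
    normc x < normc (0 - nth 0 [:: y'; 0] j).
    by move=> x [|[|j]] // xz _ _; rewrite /= sub0r normcN'; exact: hy'.
  move=> /(_ hh w); rewrite /splice /= !cats0.
  have -> : [seq 0 + x | x <- z'] = z' by rewrite -[RHS]map_id; apply: eq_map => x /=;
    rewrite add0r.
  by [].
have uzc : uniq [seq x / c | x <- z] by rewrite map_inj_uniq //; apply: mulIf; rewrite invr_neq0.
have szc : size (map (act c) v) = size [seq x / c | x <- z] by rewrite !size_map.
have z0c : [seq x / c | x <- z] != [::] by case: (z) z0.
have y0c : y / c != 0 by rewrite mulf_neq0 ?invr_neq0.
have hyc x : x \in [seq x / c | x <- z] -> normc x < normc (y / c).
  by move=> /mapP[x' /hy hx ->]; rewrite !normcM' ltr_pM2r // normc_gt0 invr_neq0.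
apply: sums_unique (sums_scale _ (expansion u v y z sv z0 uz y0 hy)) _.
apply: eq_sums (expansion (act c u) _ _ _ szc z0c uzc y0c hyc) => -[p q].
rewrite !(pairing_at _ sw) -h -(act_homog dG c (mseq_homog pF _ _ _)) -linearZ; congr (w _).
by have := @scales2 c u (mseq v z (p, q)) y c0 r s; rewrite /= mul0r => <-.
Qed.

Lemma scales_perm c (l l' : seq (F * C)) : perm_eq l l' ->
  scales c (unzip1 l') (unzip2 l') -> scales c (unzip1 l) (unzip2 l).
Proof.
move=> p h r s; rewrite (mseq_permutation pF p) h.
pose f (x : F * C) := (act c x.1, x.2 / c).
have e1 k : map (act c) (unzip1 k) = unzip1 (map f k) by rewrite /unzip1 -!map_comp.
have e2 k : [seq x / c | x <- unzip2 k] = unzip2 (map f k) by rewrite /unzip2 -!map_comp.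
by rewrite !e1 !e2 (mseq_permutation pF (perm_map f p)).
Qed.

Lemma ffa_scaling (c : C) (v : seq F) (z : seq C) : c != 0 -> size v = size z -> scales c v z.
Proof.
move=> c0; have [n] := ubnP (size z); elim: n v z => // n IH v z sz sv.
have [/andP[z0 uz]|deg] := boolP ((z != [::]) && uniq z); last first.
  move=> r s; rewrite (mseq_degenerate _ deg) scaler0 mseq_degenerate //.
  by rewrite -size_eq0 size_map size_eq0 map_inj_uniq //; apply: mulIf; rewrite invr_neq0.
(* A point of maximal modulus is moved to the front and all points are translated by it, so that
   [normcD_lt] applies. *)
have [x xz hx] := normc_max z0.
have e1 : unzip1 (zip v z) = v by rewrite unzip1_zip // sv.
have e2 : unzip2 (zip v z) = z by rewrite unzip2_zip // sv.
have [[u x'] ux /= ex] : exists2 p, p \in zip v z & x = p.2 by apply/mapP; rewrite -/(unzip2 _) e2.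
subst x'; have pl := perm_to_rem ux; set l' := rem _ _ in pl.
have uz' : uniq (x :: unzip2 l') by rewrite -(perm_uniq (perm_map snd pl)) -/(unzip2 _) e2.
have sub y : y \in unzip2 l' -> y \in z.
  by move=> yl; rewrite -e2 (perm_mem (perm_map snd pl)) inE yl orbT.
suff h : scales c (u :: unzip1 l') (x :: unzip2 l').
  by have := scales_perm pl h; rewrite e1 e2.
have [l0|l0] := eqVneq (unzip2 l') [::].
  have -> : unzip1 l' = [::] by apply: size0nil; move: l0 => /(congr1 size); rewrite !size_map.
  by rewrite l0; exact: scales1.
have sl : size (unzip1 l') = size (unzip2 l') by rewrite !size_map.
have uxl : uniq [seq y + x | y <- unzip2 l'].
  by rewrite map_inj_uniq //; [move: uz' => /= /andP[]|exact: addIr].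
apply: (@scales_translate c x) => //=; first by rewrite sl.
have sl' : size (unzip1 l') = size [seq y + x | y <- unzip2 l'] by rewrite size_map.
have lx0 : [seq y + x | y <- unzip2 l'] != [::] by case: (unzip2 l') l0.
apply: (@scales_cons c u (unzip1 l') (x + x) _ c0 sl' lx0 uxl).
- move=> _ /mapP[y yl ->]; rewrite addrC; apply: normcD_lt; first exact: hx (sub _ yl).
  by apply: contraTneq yl => ->; move: uz' => /= /andP[].
apply: (IH _ _ _ sl'); rewrite size_map -ltnS; apply: leq_trans sz; rewrite ltnS.
by rewrite -e2 (perm_size (perm_map snd pl)).
Qed.

Lemma core_of_ffa : is_core F.
Proof.
split; first exact: pF.
- exact: ffa_single_valued_int.
- exact: ffa_one_homog.
- by move=> c u z p q c0 su; exact: ffa_scaling.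
- exact: ffa_degrees.
Qed.

(** At the point 1 and in degree (p + 1, q) the factor r - p of [ffa_D_m1] is 1, and m_1(D^L u; 1)
    reduces to D^L u. Through this the round trip returns the given operators. *)
Lemma ffa_DE : @ffa_DL _ F = shiftop 1 0 /\ @ffa_DR _ F = shiftop 0 1.
Proof.
have cF := core_of_ffa; have o0 : 1 != 0 :> C := oner_neq0 _.
have id1 p q x : gr (p, q) x -> mseq [:: x] [:: 1] (p, q) = x.
  by move=> Gx; have := shiftop00 cF x; rewrite (shiftopE pF _ _ Gx) !addr0.
split; apply/funext; apply: (linear_ext dG).
- exact: ffa_DL_linear.
- exact: (shiftop_linear pF).
- move=> [p q] u Gu; rewrite (shiftopE pF _ _ Gu) addr0.
  have := (ffa_D_m1 (p + 1) q o0 Gu).1; rewrite (id1 _ _ _ (ffa_D_homog Gu).1).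
  by rewrite (_ : p + 1 - p = 1) ?scale1r //; ring.
- exact: ffa_DR_linear.
- exact: (shiftop_linear pF).
- move=> [p q] u Gu; rewrite (shiftopE pF _ _ Gu) addr0.
  have := (ffa_D_m1 p (q + 1) o0 Gu).2; rewrite (id1 _ _ _ (ffa_D_homog Gu).2).
  by rewrite conjc1 (_ : q + 1 - q = 1) ?scale1r //; ring.
Qed.

End CoreOfFullFieldAlgebra.

(** * The operations of a Khat-algebra *)

Section Families.
Variable R : realType.
Local Notation C := R[i].
Variables (V : lmodType C) (I : choiceType) (G : I -> set V).

Lemma sums_embeds (g : V -> C) x y : scalar g -> embeds G x y ->
  sums_absolutely (fun i => g (x i)) (g y).
Proof.
move=> lg [_ [s [hs ->]]].
have g0 : g 0 = 0 by have := lg (-1) 0 0; rewrite scaleN1r addNr mulN1r addNr.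
have -> : g (\sum_(i <- s) x i) = \sum_(i <- s) g (x i).
  elim: (enum_fset s) => [|i r IH]; first by rewrite !big_nil.
  by rewrite !big_cons -[x i]scale1r lg mul1r IH scale1r.
by apply: sums_finite => i /hs ->.
Qed.

Lemma family_ext x y : direct_sum G -> (forall i, findim (G i)) ->
  (forall i, G i (x i)) -> (forall i, G i (y i)) ->
  (forall w : rdual G, pairing w x = pairing w y) -> x = y.
Proof.
move=> dG fd hx hy h; apply/funext => i; apply: (homog_ext dG (fd i)) => // w sw.
by rewrite -!(pairing_at _ sw).
Qed.

End Families.

Section Elementary.
Variable R : realType.
Local Notation C := R[i].
Variable n : nat.

Lemma elementary_add (k : C) (g g' : C -> n.-tuple C -> C) : elementary g -> elementary g' ->
  elementary (fun a s => k * g a s + g' a s).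
Proof.
move=> [L [c [al [be [r [t e]]]]]] [L' [c' [al' [be' [r' [t' e']]]]]].
exists (L + L')%N, (fun l => match fintype.split l with inl i => k * c i | inr i => c' i end),
  (fun l => match fintype.split l with inl i => al i | inr i => al' i end),
  (fun l => match fintype.split l with inl i => be i | inr i => be' i end),
  (fun l => match fintype.split l with inl i => r i | inr i => r' i end),
  (fun l => match fintype.split l with inl i => t i | inr i => t' i end) => a s s0.
rewrite e // e' // big_split_ord /= mulr_sumr; congr (_ + _).
  by apply: eq_bigr => i _; rewrite (unsplitK (inl i)) !mulrA.
by apply: eq_bigr => i _; rewrite (unsplitK (inr i)).
Qed.

Lemma elementary_lincomb (L : nat) (k : 'I_L -> C) (g : 'I_L -> C -> n.-tuple C -> C) :
  (forall l, elementary (g l)) -> elementary (fun a s => \sum_(l < L) k l * g l a s).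
Proof.
move=> h; elim: (index_enum _) => [|l r IH].
  by exists 0%N, (fun=> 0), (fun=> 0%N), (fun=> 0%N), (fun _ _ => 0), (fun _ _ => 0) => a s _;
    rewrite big_nil big_ord0.
have [L' [c [al [be [r' [t e]]]]]] := elementary_add (k l) (h l) IH.
by exists L', c, al, be, r', t => a s s0; rewrite -e // big_cons.
Qed.

End Elementary.

Section KhatAlgebra.
Variable R : realType.
Local Notation C := R[i].
Variable K : kalg_data R.
Hypothesis kK : is_kalg K.
Local Notation iso := (@isotypic R K).
Let dI := kalg_reducible kK.
Let fI := kalg_findim kK.
Let sI M : subspace (iso M). Proof. by have [] := dI. Qed.

(* nu at the sphere with points p, coordinate -1 / (w - a) at infinity and scalings s, which
   need not be in normal form; 0 when this is not a point of the operad. *)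
Definition nuq (p : seq C) (a : C) (s : seq C) (u : seq K) (M : weight R) : K :=
  if pselect (exists Q : Khat R (size p), represents Q (in_tuple p) a (ntup (size p) s)) is left h
  then kalg_nu (projT1 (cid h)) (ntup (size p) u) M else 0.

Lemma nuqE n (Q : Khat R n) (U : n.-tuple K) (p' s' : n.-tuple C) (p : seq C) a (s : seq C) (u : seq
  K) :
  represents Q p' a s' -> val p' = p -> val s' = s -> val U = u -> nuq p a s u = kalg_nu Q U.
Proof.
move=> hQ ep es eu; have e : size p = n by rewrite -ep size_tuple.
subst n; have {}ep : p' = in_tuple p by exact: val_inj.
have {}es : s' = ntup (size p) s by rewrite -es ntupK.
have {}eu : U = ntup (size p) u by rewrite -eu ntupK.
subst p' s' U; apply/funext => M; rewrite /nuq; case: pselect => [h|[]]; last by exists Q.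
by case: cid => Q' hQ' /=; rewrite (represents_uniq hQ' hQ).
Qed.

Lemma nuq_ex n (p s : seq C) (u : seq K) a : size p = n -> size s = n -> size u = n -> uniq p ->
  0 \notin s ->
  exists Q : Khat R n, represents Q (ntup n p) a (ntup n s) /\ nuq p a s u = kalg_nu Q (ntup n u).
Proof.
move=> sp ss su up s0.
have vp : tval (ntup n p) = p := val_ntup sp.
have vs : tval (ntup n s) = s := val_ntup ss.
have [||Q hQ] := @represents_ex _ n (ntup n p) a (ntup n s); rewrite ?vp ?vs //.
  by rewrite -[mem _]/(mem (tval (ntup n s))) vs.
exists Q; split=> //; exact: nuqE hQ vp vs (val_ntup su).
Qed.

Lemma nuq_degenerate p a s u : ~~ uniq p -> nuq p a s u = fun=> 0.
Proof.
move=> up; apply/funext => M; rewrite /nuq; case: pselect => [h|//]; exfalso; case: h => Q [e _ _].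
case/negP: up; have := kpts_uniq Q; rewrite e /= map_inj_uniq //; exact: addIr.
Qed.

Lemma nuq_homog p a s u M : iso M (nuq p a s u M).
Proof. by rewrite /nuq; case: pselect => [h|h]; [exact: (kalg_nu_homogeneous kK)|exact: (homog0
  dI)]. Qed.

Lemma nuq_lin p a s u1 u2 k x y M : size p = (size u1 + size u2).+1 ->
  nuq p a s (u1 ++ (k *: x + y) :: u2) M = k *: nuq p a s (u1 ++ x :: u2) M + nuq p a s (u1 ++ y ::
    u2) M.
Proof.
move=> sp; rewrite /nuq; case: pselect => [h|h]; last by rewrite scaler0 addr0.
have ilt : (size u1 < size p)%N by rewrite sp ltnS leq_addr.
have e v : ntup (size p) (u1 ++ v :: u2) = upd (ntup (size p) (u1 ++ 0 :: u2)) (Ordinal ilt) v.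
  have st w' : size (u1 ++ w' :: u2) = size p by rewrite size_cat /= addnS.
  by apply: val_inj; rewrite val_upd !val_ntup //= splice_cat.
by rewrite (e (_ + _)) (e x) (e y); exact: (kalg_nu_multilinear kK).
Qed.

(** Hides the case distinction in the choice of the normalising translation. *)
Lemma represents_shift n (Q : Khat R n) p a s : represents Q p a s ->
  exists t, [/\ kpts Q = map_tuple (fun x => x - t) p, ka Q = a - t & ks Q = s].
Proof. by move=> [e1 e2 e3]; eexists; split; [exact: e1|exact: e2|exact: e3]. Qed.

Lemma represents_translate n (Q : Khat R n) (p : n.-tuple C) a s t :
  represents Q p a s -> represents Q (map_tuple (fun x => x + t) p) (a + t) s.
Proof.
case: n Q p s => [|n] Q p s [e1 e2 e3]; split=> //.
- by rewrite [LHS]tuple0 [RHS]tuple0.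
- by rewrite e2 !subrr.
- rewrite e1; apply: val_inj => /=; rewrite -map_comp.
  have -> : last 0 [seq x + t | x <- p] = last 0 p + t.
    by case: (p) => -[|x q] //= _; rewrite (last_map (fun x => x + t)).
  by apply: eq_map => x /=; rewrite opprD addrACA subrr addr0.
- rewrite e2 /=.
  have -> : last 0 [seq x + t | x <- p] = last 0 p + t.
    by case: (p) => -[|x q] //= _; rewrite (last_map (fun x => x + t)).
  by rewrite opprD addrACA subrr addr0.
Qed.

Lemma nuq_translate p a s u t : size s = size p -> size u = size p -> 0 \notin s ->
  nuq [seq x + t | x <- p] (a + t) s u = nuq p a s u.
Proof.
move=> ss su s0; have [up|up] := boolP (uniq p); last first.
  by rewrite (nuq_degenerate _ _ _ up) nuq_degenerate // map_inj_uniq //; exact: addIr.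
have [Q [hQ ->]] := nuq_ex a erefl ss su up s0.
apply: (nuqE (represents_translate t hQ)); rewrite ?val_ntup //=.
by rewrite -[X in map _ X]/(val (ntup _ _)) val_ntup.
Qed.

(** Sewing without normal forms: the translations that normalise the two spheres cancel in all
    differences of points. *)
Lemma nuq_sewing (i : nat) (u v : seq K) (p : seq C) a (s p' : seq C) b (s' : seq C) :
  (i < size p)%N -> size u = size p -> size s = size p -> size v = size p' -> size s' = size p' ->
  uniq p -> uniq p' -> 0 \notin s -> 0 \notin s' ->
  (forall x j, x \in p' -> (j < size p)%N -> j != i ->
    normc (x - b) < normc (nth 0 s i) * normc (nth 0 p j - nth 0 p i)) ->
  forall w : rdual iso, sums_absolutely
    (fun M => pairing w (nuq p a s (splice i u [:: nuq p' b s' v M])))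
    (pairing w (nuq (splice i p [seq nth 0 p i + (x - b) / nth 0 s i | x <- p']) a
       (splice i s [seq nth 0 s i * x | x <- s']) (splice i u v))).
Proof.
move=> ip su ss sv ss' up up' s0 s0' h w.
have vp : tval (ntup (size p) p) = p := val_ntup erefl.
have vs : tval (ntup (size p) s) = s := val_ntup ss.
have vp' : tval (ntup (size p') p') = p' := val_ntup erefl.
have vs' : tval (ntup (size p') s') = s' := val_ntup ss'.
have vu : tval (ntup (size p) u) = u := val_ntup su.
have vv : tval (ntup (size p') v) = v := val_ntup sv.
have [P [hP _]] := nuq_ex a erefl ss su up s0.
have [Q [hQ eQ]] := nuq_ex b erefl ss' sv up' s0'.
have [t [ePp ePa ePs]] := represents_shift hP; have [t' [eQp eQa eQs]] := represents_shift hQ.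
have tP (j : 'I_(size p)) : tnth (kpts P) j = nth 0 p j - t by rewrite ePp tnth_map (tnth_nth 0) vp.
have dP (j k : 'I_(size p)) : tnth (kpts P) j - tnth (kpts P) k = nth 0 p j - nth 0 p k.
  by rewrite !tP opprB addrA subrK.
have dQ x : x - t' - (b - t') = x - b by rewrite opprB addrA subrK.
have eP : tnth (ks P) (Ordinal ip) = nth 0 s i by rewrite ePs (tnth_nth 0) vs.
have PQ : sewable P (Ordinal ip) Q.
  move=> k j ji; rewrite eP dP -normrM ltcE_normc normcM' eQp eQa tnth_map dQ.
  rewrite (tnth_nth 0 (ntup _ _)) vp'; apply: h => //; exact: mem_nth.
have [S [hS _]] := sewing_exists PQ.
have := kalg_nu_sewing kK PQ hS (ntup (size p) u) (ntup (size p') v) w.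
have vPp : tval (kpts P) = [seq x - t | x <- p] by rewrite ePp /= vp.
have vQp : tval (kpts Q) = [seq x - t' | x <- p'] by rewrite eQp /= vp'.
pose P' := splice i p [seq nth 0 p i + (x - b) / nth 0 s i | x <- p'].
have e1 : val (splice_tuple (Ordinal ip) (kpts P)
      (map_tuple (fun xi => tnth (kpts P) (Ordinal ip) + (xi - ka Q) / tnth (ks P) (Ordinal ip))
        (kpts Q))) =
    [seq x - t | x <- P'].
  change (splice i (tval (kpts P)) [seq tnth (kpts P) (Ordinal ip) + (xi - ka Q) / tnth (ks P)
    (Ordinal ip) |
    xi <- tval (kpts Q)] = [seq x - t | x <- P']).
  rewrite vPp vQp eP tP eQa /P' /splice !map_cat map_take map_drop -!map_comp.
  by congr (_ ++ _ ++ _); apply: eq_map => x /=; rewrite dQ addrAC.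
have e2 : val (splice_tuple (Ordinal ip) (ks P) (map_tuple (fun c => tnth (ks P) (Ordinal ip) * c)
  (ks Q))) =
    splice i s [seq nth 0 s i * x | x <- s'].
  by rewrite /= eP ePs eQs /= vs vs'.
have e3 : val (splice_tuple (Ordinal ip) (ntup (size p) u) (ntup (size p') v)) = splice i u v.
  by rewrite /= vu vv.
have ni0 : nth 0 s i != 0 by apply: contraNneq s0 => <-; apply: mem_nth; rewrite ss.
(* The sewn sphere differs from the stated one by the translation that normalised [P]. *)
rewrite -(nuqE hS e1 e2 e3) ePa nuq_translate.
- apply: eq_sums => M; congr pairing; rewrite -eQ.
  by have := nuqE hP vp vs (val_upd (ntup (size p) u) (Ordinal ip) (nuq p' b s' v M));
    rewrite vu => ->.
- by rewrite /P' !size_splice_seq ?size_map ?ss ?ss'.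
- by rewrite /P' !size_splice_seq ?size_map ?su ?sv.
- rewrite /splice !mem_cat !negb_or; apply/and3P; split.
  + by apply: contra s0; exact: mem_take.
  + by apply/negP => /mapP[c cs /esym/eqP]; rewrite mulf_eq0 (negPf ni0) => /eqP c0;
      rewrite c0 (negPf s0') in cs.
  + by apply: contra s0; exact: mem_drop.
Qed.

Lemma nuq_perm (a : C) (l l' : seq (K * (C * C))) : perm_eq l l' -> 0 \notin unzip2 (unzip2 l) ->
  nuq (unzip1 (unzip2 l)) a (unzip2 (unzip2 l)) (unzip1 l) =
  nuq (unzip1 (unzip2 l')) a (unzip2 (unzip2 l')) (unzip1 l').
Proof.
move=> ll' s0; have s0' : 0 \notin unzip2 (unzip2 l').
  by rewrite -(perm_mem (perm_map snd (perm_map snd ll'))).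
have pu := perm_uniq (perm_map fst (perm_map snd ll')).
have [up|up] := boolP (uniq (unzip1 (unzip2 l'))); last first.
  by rewrite (nuq_degenerate _ _ _ up) nuq_degenerate // pu.
have /tuple_permP [s es] : perm_eq l (in_tuple l') by [].
have permE (T : Type) (f : K * (C * C) -> T) (U : (size l').-tuple T) : val U = map f l' ->
    val (permute s U) = map f l.
  move=> eU; have -> : U = map_tuple f (in_tuple l') by apply: val_inj.
  by rewrite es /= -map_comp; apply: eq_map => j /=; rewrite tnth_map.
have [sz1 sz2 sz3] : [/\ size (unzip1 (unzip2 l')) = size l', size (unzip2 (unzip2 l')) = size l' &
   size (unzip1 l') = size l'] by rewrite !size_map.
have [Q [hQ ->]] := nuq_ex a sz1 sz2 sz3 up s0'.
have [t [e1 e2 e3]] := represents_shift hQ.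
have v1 : val (kpts Q) = [seq (x.2.1 - t) | x <- l'].
  have vn : tval (ntup (size l') (unzip1 (unzip2 l'))) = unzip1 (unzip2 l') := val_ntup sz1.
  by rewrite e1 /= vn -!map_comp.
have v2 : val (ks Q) = [seq x.2.2 | x <- l'] by rewrite e3 val_ntup // /unzip2 -map_comp.
have p1 := permE _ _ _ v1; have p2 := permE _ _ _ v2.
have p3 := permE _ (fun x => x.1) (ntup (size l') (unzip1 l')) (val_ntup sz3).
have [||Q2 hQ2] := @represents_ex _ _ (permute s (kpts Q)) (ka Q) (permute s (ks Q)).
- have -> : uniq (permute s (kpts Q)) = uniq (val (kpts Q)); last exact: kpts_uniq.
  by apply: perm_uniq; apply/tuple_permP; exists s.
- have -> : (0 \notin permute s (ks Q)) = (0 \notin val (permute s (ks Q))) by [].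
  by rewrite p2; move: s0; rewrite /unzip2 -map_comp.
have := nuqE hQ2 p1 p2 p3.
rewrite (kalg_nu_equivariant kK _ hQ2) => <-; rewrite e2.
have -> : [seq x.2.1 - t | x <- l] = [seq x - t | x <- unzip1 (unzip2 l)] by rewrite /unzip1 /unzip2
  -!map_comp.
have -> : [seq x.2.2 | x <- l] = unzip2 (unzip2 l) by rewrite /unzip2 -map_comp.
by rewrite nuq_translate ?size_map.
Qed.

Lemma nuq_rescaling (c : Cx R) u : embeds iso (nuq [:: 0] 0 [:: val c] [:: u]) (kalg_act c u).
Proof.
have hr : represents (rescaling c) [tuple 0] 0 [tuple val c].
  split=> //; first by apply: val_inj; rewrite val_kpts /= subrr.
  by rewrite /= subrr.
by rewrite (@nuqE 1 _ [tuple u] _ _ _ _ _ _ hr) //; exact: kalg_nu_rescaling.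
Qed.

Lemma act_weight (c : Cx R) M u : iso M u ->
  kalg_act c u = chi (- (val M).1) (- (val M).2) (val c) *: u.
Proof. by move=> h; rewrite h. Qed.

Lemma pairing_nuq_lin (w : rdual iso) p a s u1 u2 : size p = (size u1 + size u2).+1 ->
  scalar (fun x => pairing w (nuq p a s (u1 ++ x :: u2))).
Proof.
move=> sp k x y; rewrite /pairing mulr_sumr -big_split; apply: eq_bigr => M _.
by rewrite nuq_lin // linearP.
Qed.

(** The sphere is sewn into the one puncture of the rescaling sphere, which is always possible as
    there is no other puncture. Tested in weight [M], the sum over weights has one term. *)
Lemma act_nuq (c : Cx R) p a s u M : size s = size p -> size u = size p -> uniq p -> 0 \notin s ->
  kalg_act c (nuq p a s u M) = nuq [seq (x - a) / val c | x <- p] 0 [seq val c * y | y <- s] u M.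
Proof.
move=> ss su up s0.
have cs0 : 0 \notin [:: val c] by rewrite inE eq_sym (valP c).
apply: (homog_ext dI (fI M)).
- by rewrite (act_weight _ (nuq_homog _ _ _ _ _)); apply: (subspace_scal _ (sI M));
    exact: nuq_homog.
- exact: nuq_homog.
move=> w sw.
have := @nuq_sewing 0 [:: 0] u [:: 0] 0 [:: val c] p a s isT erefl erefl su ss isT up cs0 s0.
have hh : forall (x : C) (j : nat), x \in p -> (j < 1)%N -> j != 0%N ->
    normc (x - a) < normc (nth 0 [:: val c] 0) * normc (nth 0 [:: 0] j - nth 0 [:: 0] 0) by move=> x
      [|j].
move=> /(_ hh w); rewrite /splice /= !cats0 => H.
have {}H := eq_sums (fun N => pairing_embeds w (nuq_rescaling c (nuq p a s u N))) H.
have := sums_finite_eq (A := [fset M]%fset) _ H; rewrite big_seq_fset1 => <-.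
  by rewrite (pairing_at _ sw); congr (w (nuq _ _ _ _ _)); apply: eq_map => x; rewrite add0r.
move=> N; rewrite inE => NM; have wN : w (nuq p a s u N) = 0.
  by apply: (@rdual_out _ _ _ _ w N); [rewrite sw inE|exact: nuq_homog].
by rewrite (act_weight _ (nuq_homog _ _ _ _ _)) linearZ /= wN mulr0.
Qed.

(** The rescaling sphere of [c] is sewn into a slot of scaling 1; its only point is the origin, so
    the sewing condition says that the punctures are distinct. *)
Lemma nuq_scaling_slot (p1 : seq C) (x : C) (p2 : seq C) (a : C) (s1 : seq C) (c : Cx R) (s2 : seq
  C)
    (u1 : seq K) (y : K) (u2 : seq K) : size s1 = size p1 -> size u1 = size p1 ->
  size s2 = size p2 -> size u2 = size p2 -> 0 \notin s1 -> 0 \notin s2 ->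
  nuq (p1 ++ x :: p2) a (s1 ++ val c :: s2) (u1 ++ y :: u2) =
  nuq (p1 ++ x :: p2) a (s1 ++ 1 :: s2) (u1 ++ kalg_act c y :: u2).
Proof.
move=> ss1 su1 ss2 su2 s10 s20; have [up|up] := boolP (uniq (p1 ++ x :: p2)); last first.
  by rewrite !(nuq_degenerate _ _ _ up).
have cs0 : 0 \notin [:: val c] by rewrite inE eq_sym (valP c).
have sp : size (p1 ++ x :: p2) = (size u1 + size u2).+1 by rewrite size_cat /= addnS su1 su2.
apply: (family_ext dI fI); try by move=> M; exact: nuq_homog.
move=> w; have e1 : size (u1 ++ 0 :: u2) = size (p1 ++ x :: p2) by rewrite !size_cat /= su1 su2.
have e2 : size (s1 ++ 1 :: s2) = size (p1 ++ x :: p2) by rewrite !size_cat /= ss1 ss2.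
have i1 : (size p1 < size (p1 ++ x :: p2))%N by rewrite sp su1 ltnS leq_addr.
have s0 : 0 \notin s1 ++ 1 :: s2 by rewrite mem_cat inE !negb_or s10 s20 eq_sym oner_neq0.
have := @nuq_sewing _ _ [:: y] _ a _ [:: 0] 0 [:: val c] i1 e1 e2 erefl erefl up isT s0 cs0.
have n1 : nth 0 (s1 ++ 1 :: s2) (size p1) = 1 by rewrite -ss1 nth_cat ltnn subnn.
have n2 : nth 0 (p1 ++ x :: p2) (size p1) = x by rewrite nth_cat ltnn subnn.
have hh : forall (t : C) (j : nat), t \in [:: 0] -> (j < size (p1 ++ x :: p2))%N -> j != size p1 ->
    normc (t - 0) < normc (nth 0 (s1 ++ 1 :: s2) (size p1)) * normc (nth 0 (p1 ++ x :: p2) j - nth 0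
      (p1 ++ x :: p2) (size p1)).
  move=> t j; rewrite inE => /eqP -> js ji; rewrite subrr normc0' n1 normc1 mul1r.
  by rewrite normc_gt0 subr_eq0 (nth_uniq 0 js i1 up).
move=> /(_ hh w); rewrite /= n1 n2 subrr mul0r addr0 mul1r -{1}su1 -{2}ss1 !splice_cat.
rewrite -[X in splice X _ [:: y]]su1 splice_cat => H.
have {}H := eq_sums (fun M => congr1 (fun v => pairing w (nuq _ a _ v)) (splice_cat u1 u2 0 _)) H.
apply: (sums_unique H); exact: (sums_embeds (pairing_nuq_lin w a _ sp) (nuq_rescaling c y)).
Qed.

Definition tact (c : C) (u : K) : K := oapp (fun d : Cx R => kalg_act d u) 0 (insub c).

Lemma tactE (c : Cx R) u : tact (val c) u = kalg_act c u.
Proof. by rewrite /tact valK. Qed.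

Lemma Cx_ex (c : C) : c != 0 -> exists d : Cx R, val d = c.
Proof. by move=> c0; exists (exist _ c c0). Qed.

Lemma tact_weight c M u : c != 0 -> iso M u -> tact c u = chi (- (val M).1) (- (val M).2) c *: u.
Proof. by move=> /Cx_ex[d <-] h; rewrite tactE (act_weight d h). Qed.

Lemma nuq_scaling (p : seq C) (a : C) (s : seq C) (u : seq K) : size s = size p ->
  size u = size p -> 0 \notin s ->
  nuq p a s u = nuq p a (nseq (size p) 1) [seq tact x.1 x.2 | x <- zip s u].
Proof.
(* The scalings are replaced from left to right; [p1] and [u1] are the slots already treated. *)
suff h p1 u1 : size u1 = size p1 -> size s = size p -> size u = size p -> 0 \notin s ->
    nuq (p1 ++ p) a (nseq (size p1) 1 ++ s) (u1 ++ u) =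
    nuq (p1 ++ p) a (nseq (size p1) 1 ++ nseq (size p) 1) (u1 ++ [seq tact x.1 x.2 | x <- zip s u]).
  exact: (h [::] [::] erefl).
elim: p s u p1 u1 => [|x p IH] [|c s] [|y u] // p1 u1 su1 [ss] [su];
  rewrite inE negb_or eq_sym => /andP[c0 s0].
have [d ed] := Cx_ex c0.
have n1 (k : nat) : 0 \notin nseq k (1 : C) by rewrite mem_nseq negb_and [0 == 1]eq_sym oner_neq0
  orbT.
rewrite -ed (nuq_scaling_slot _ _ _ _ _ su1 ss su (n1 _) s0) ?size_nseq //= tactE.
have nS (k : nat) (l : seq C) : nseq k.+1 1 ++ l = nseq k 1 ++ 1 :: l by elim: k => //= k <-.
have := IH s u (rcons p1 x) (rcons u1 (kalg_act d y));
  rewrite !size_rcons su1 => /(_ erefl ss su s0).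
by rewrite !cat_rcons !nS.
Qed.

Lemma weight0_proof : `[< exists k : int, ((0, 0) : C * C).1 - ((0, 0) : C * C).2 = k%:~R >].
Proof. by apply/asboolP; exists 0; rewrite subrr. Qed.

Definition weight0 : weight R := exist _ (0, 0) weight0_proof.

Definition kone : K := nuq [::] 0 [::] [::] weight0.

(** Rescaling fixes the sphere without positive punctures, and by [chi_inj] only weight 0 has the
    trivial character. *)
Lemma nuq_nil_off M : M != weight0 -> nuq [::] 0 [::] [::] M = 0.
Proof.
move=> M0; apply/eqP; apply: contraT => x0; case/eqP: M0.
have [k hk] := weight_int M; apply: val_inj.
have : (- (val M).1, - (val M).2) = (0, 0).
  apply: (chi_inj (k' := 0) hk); first by rewrite subrr.
  move=> c /Cx_ex[d <-]; have := @act_nuq d [::] 0 [::] [::] M erefl erefl isT isT.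
  rewrite (act_weight d (nuq_homog _ _ _ _ _)) /= chi0 => /eqP.
  by rewrite -subr_eq0 -[X in _ - X]scale1r -scalerBl scaler_eq0 (negPf x0) orbF subr_eq0 => /eqP.
by case: (val M) => m n [/eqP + /eqP]; rewrite !oppr_eq0 => /eqP -> /eqP ->.
Qed.

(** The sphere without positive punctures is sewn into the slot; its only nonzero component is in
    weight 0. *)
Lemma nuq_insert_one (p1 : seq C) (x : C) (p2 : seq C) (a : C) (s1 : seq C) (c : C) (s2 : seq C)
    (u1 u2 : seq K) : size s1 = size p1 -> size u1 = size p1 ->
  size s2 = size p2 -> size u2 = size p2 -> uniq (p1 ++ x :: p2) -> 0 \notin s1 ++ c :: s2 ->
  nuq (p1 ++ x :: p2) a (s1 ++ c :: s2) (u1 ++ kone :: u2) = nuq (p1 ++ p2) a (s1 ++ s2) (u1 ++ u2).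
Proof.
move=> ss1 su1 ss2 su2 up s0.
have sp : size (p1 ++ x :: p2) = (size u1 + size u2).+1 by rewrite size_cat /= addnS su1 su2.
apply: (family_ext dI fI); try by move=> M; exact: nuq_homog.
move=> w; have e1 : size (u1 ++ 0 :: u2) = size (p1 ++ x :: p2) by rewrite !size_cat /= su1 su2.
have e2 : size (s1 ++ c :: s2) = size (p1 ++ x :: p2) by rewrite !size_cat /= ss1 ss2.
have i1 : (size p1 < size (p1 ++ x :: p2))%N by rewrite sp su1 ltnS leq_addr.
have := @nuq_sewing _ _ [::] _ a _ [::] 0 [::] i1 e1 e2 erefl erefl up isT s0 isT.
move=> /(_ (fun _ _ h => False_ind _ (notF h)) w); rewrite /= -{1}su1 -{2}ss1 -{2}su1 !splice_cat.
move=> H; have {}H := eq_sums (fun M => congr1 (fun v => pairing w (nuq _ a _ v)) (splice_cat u1 u2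
  0 _)) H.
have H0 := sums_embeds (pairing_nuq_lin w a (s1 ++ c :: s2) sp) (embeds_homog sI (nuq_homog [::] 0
  [::] [::] weight0)).
apply: sums_unique H0 _; apply: eq_sums H => M.
by case: eqP => [->|/eqP h] //; rewrite (nuq_nil_off h).
Qed.

(** * Consequences of smoothness: real weights and natural degrees *)

Hypothesis kS : is_smooth_kalg K.

(** For n = 1 no points z_i remain, so the smooth factors [h] are constants. *)
Lemma nu1_elementary (w : rdual iso) u : exists (L : nat) (k : 'I_L -> C) (alpha beta : 'I_L ->
  nat) (r t : 'I_L -> R),
  forall (x a c : C), c != 0 -> pairing w (nuq [:: x] a [:: c] [:: u]) =
  \sum_l k l * (a - x) ^+ alpha l * conjc (a - x) ^+ beta l * (cpow c (r l)%:C%C * cpowbar c (t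
    l)%:C%C).
Proof.
have [L [g [h [hg _ hf]]]] := skalg_smooth kS [tuple u] w.
have [L' [k [al [be [r [t e]]]]]] : elementary (fun a s => \sum_(l < L) h l [tuple] * g l a s).
  exact: elementary_lincomb.
exists L', k, al, be, (fun l => r l ord0), (fun l => t l ord0) => x a c c0.
have s0 : 0 \notin [:: c] by rewrite inE eq_sym.
have [Q [hQ ->]] := @nuq_ex 1 [:: x] [:: c] [:: u] a erefl erefl erefl isT s0.
have eu : ntup 1 [:: u] = [tuple u] by apply: val_inj; rewrite val_ntup.
have [_ e2 e3] := hQ; have es : tval (ks Q) = [:: c] by rewrite e3 -[tval _]/(val _) val_ntup.
rewrite eu hf; transitivity (\sum_(l < L) h l [tuple] * g l (ka Q) (ks Q)).
  by apply: eq_bigr => l _; rewrite mulrC; congr (h l _ * _); rewrite tuple0.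
have s0' : 0 \notin ks Q by change (is_true (0 \notin tval (ks Q))); rewrite es.
rewrite (e _ _ s0'); apply: eq_bigr => l _; rewrite big_ord1 (tnth_nth 0) es /=.
by have -> : ka Q = a - x by rewrite e2 -[tval _]/(val _) val_ntup.
Qed.

Lemma clog_expR (x : R) : clog (cexp x%:C%C) = x%:C%C.
Proof.
have n : normc (expR x)%:C%C = expR x by rewrite normcR gtr0_norm ?expR_gt0.
have -> : cexp x%:C%C = (expR x)%:C%C := cexp_real x.
rewrite /clog /Arg n expRK [Im _]/= lexx [Re _]/= divff ?acos1 //.
by rewrite gt_eqF ?expR_gt0.
Qed.

Lemma conjcR (x : R) : conjc x%:C%C = x%:C%C.
Proof. by rewrite /conjc /= oppr0. Qed.

(** The dilations [expR (j * x)] act on [u] by the powers of one number, which smoothness writes as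
    combinations of powers of positive numbers; [power_sum_root] makes it one of them. So m_1 + m_2
    is real, and m_1 - m_2 is an integer. *)
Lemma weight_real M u : iso M u -> u != 0 -> Im (val M).1 = 0 /\ Im (val M).2 = 0.
Proof.
move=> Mu u0; have [w [sw w0]] := homog_form dI (fI M) Mu u0.
have [L [k [al [be [r [t hf]]]]]] := nu1_elementary w u.
have [m hm] := weight_int M; have := fun d => act_weight d Mu.
move: hm; move: (val M).1 (val M).2 => m1 m2 hm hact.
have e (x : R) (j : nat) : w u * cexp (- (m1 + m2) * x%:C%C) ^+ j =
    \sum_l (k l * (0 - 0) ^+ al l * conjc (0 - 0) ^+ be l) * cexp ((r l + t l)%:C%C * x%:C%C) ^+ j.
  have c0 : cexp (j%:R * x)%:C%C != 0 :> C := cexp_neq0 _.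
  have [d ed] := Cx_ex c0.
  have := hf 0 0 _ c0; rewrite -{1}ed (pairing_embeds w (nuq_rescaling d u)) hact linearZ /= ed.
  rewrite (chi_cexp _ hm) conjcR mulrC => H.
  rewrite -cexpMn (_ : j%:R * _ = - m1 * (j%:R * x)%:C%C + - m2 * (j%:R * x)%:C%C); last first.
    by rewrite rmorphM rmorph_nat; ring.
  rewrite H; apply: eq_bigr => l _; congr (_ * _).
  rewrite /cpow /cpowbar clog_expR conjcR -cexpD -cexpMn; congr cexp.
  by rewrite rmorphD rmorphM rmorph_nat; ring.
have hI : Im (- (m1 + m2)) = 0.
  apply: cexp_ge0_real => x; have [l hl] := power_sum_root w0 (e x).
  exists (expR ((r l + t l) * x)); rewrite expR_gt0; split=> //.
  by rewrite hl -cexp_real rmorphM.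
have hd : Im (- m1 - - m2) = 0 by rewrite hm -(rmorph_int (real_complex R)).
move: m1 m2 hI hd {hm hact e} => -[a b] [c d] /=; lra.
Qed.

Lemma real_weight_some M u : iso M u -> u != 0 -> exists pq, real_weight M = Some pq.
Proof.
move=> Mu u0; have [h1 h2] := weight_real Mu u0.
by rewrite /real_weight h1 h2 eqxx; eexists.
Qed.

Lemma nuq1_linear t s M : linear (fun v => nuq [:: t] 0 s [:: v] M).
Proof. by move=> k x y; exact: (@nuq_lin _ _ _ [::] [::]). Qed.

(** The matrix element [f] is a polynomial in [x] and its conjugate by smoothness, and homogeneous
    of exponents (r - p, s - q) by rescaling. Along the powers of one rescaling [cexp tau],
    [power_sum_root] finds a monomial with the same multiplier. *)
Lemma kalg_degrees (p q r s : R) M N u t : val M = (p%:C%C, q%:C%C) -> val N = (r%:C%C,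
  s%:C%C) -> iso M u ->
  nuq [:: t] 0 [:: 1] [:: u] N != 0 -> exists i j : nat, r = p + i%:R /\ s = q + j%:R.
Proof.
move=> eM eN Mu n0; have [w [sw w0]] := homog_form dI (fI N) (nuq_homog _ _ _ _ _) n0.
pose f x := w (nuq [:: x] 0 [:: 1] [:: u] N); rewrite -/(f t) in w0.
have [L [k [al [be [rr [tt hf]]]]]] := nu1_elementary w u.
have fE x : f x = \sum_l k l * (- x) ^+ al l * conjc (- x) ^+ be l.
  rewrite /f -(pairing_at _ sw) hf ?oner_neq0 //; apply: eq_bigr => l _.
  rewrite sub0r (_ : cpow _ _ * _ = chi (rr l)%:C%C (tt l)%:C%C 1) // chi1 mulr1 //.
have [m hm] := weight_int M; have [m' hm'] := weight_int N.
have fS x tau : f (cexp tau * x) = cexp ((r - p)%:C%C * tau + (s - q)%:C%C * conjc tau) * f x.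
  have [d ed] := Cx_ex (cexp_neq0 (- tau)).
  have s0 : 0 \notin [:: 1 : C] by rewrite inE eq_sym oner_neq0.
  have sd0 : 0 \notin [:: val d * 1] by rewrite inE eq_sym mulr1 (valP d).
  have := @act_nuq d [:: x] 0 [:: 1] [:: u] N erefl erefl isT s0.
  have e1 : nuq [:: (x - 0) / val d] 0 [:: val d * 1] [:: u] = nuq [:: cexp tau * x] 0 [:: 1] [::
    chi (- (val M).1) (- (val M).2) (val d) *: u].
    rewrite (@nuq_scaling [:: (x - 0) / val d] 0 [:: val d * 1] [:: u] erefl erefl sd0) /= mulr1
      -/(val d) tactE (act_weight d Mu).
    have ex : (x - 0) / val d = cexp tau * x by rewrite subr0 ed cexpN invrK mulrC.
    exact: (congr1 (fun y => nuq [:: y] 0 [:: 1] [:: _]) ex).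
  rewrite (act_weight d (nuq_homog _ _ _ _ _)) [map _ [:: x]]/= [map _ [:: 1]]/= -/(val d) e1.
  rewrite (linear_scal _ _ (nuq1_linear _ _ _)) => /(congr1 w); rewrite !linearZ /= -/(val d) ed.
  rewrite (chi_cexp _ hm) (chi_cexp _ hm') -/(f x) -/(f (cexp tau * x)) eM eN /= => H.
  apply: (mulfI (cexp_neq0 (- p%:C%C * - tau + - q%:C%C * conjc (- tau)))).
  rewrite -H mulrA -cexpD; congr (cexp _ * _).
  by rewrite !rmorphB !rmorphN /=; ring.
(* [tau] makes the multiplier determine the exponents: its real part 1 compares the sums, its
   imaginary part [2 pi / S] the differences, and [S > |del l|] excludes a full turn. *)
pose del l := (r - p) - (s - q) - ((al l)%:R - (be l)%:R).
pose S := 1 + \sum_l `|del l|; pose tau : C := (1 +i* (2 * pi / S))%C.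
have S0 : 0 < S by rewrite ltr_pwDl // sumr_ge0.
have e (j : nat) : f t * cexp ((r - p)%:C%C * tau + (s - q)%:C%C * conjc tau) ^+ j =
    \sum_l (k l * (- t) ^+ al l * conjc (- t) ^+ be l) * cexp ((al l)%:R * tau + (be l)%:R * conjc
      tau) ^+ j.
  have := fS t (j%:R * tau); rewrite fE => H.
  rewrite mulrC -cexpMn (_ : j%:R * _ = (r - p)%:C%C * (j%:R * tau) + (s - q)%:C%C * conjc (j%:R *
    tau)); last first.
    by rewrite rmorphM rmorph_nat; ring.
  have cM (y z : C) : conjc (y * z) = conjc y * conjc z by rewrite rmorphM.
  rewrite -H; apply: eq_bigr => l _.
  have -> : cexp ((al l)%:R * tau + (be l)%:R * conjc tau) ^+ j =
      cexp (j%:R * tau) ^+ al l * conjc (cexp (j%:R * tau)) ^+ be l.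
    rewrite -cexp_conj -!cexpMn -cexpD; congr cexp.
    by rewrite cM rmorph_nat; ring.
  move: (cexp (j%:R * tau)) => E; rewrite -mulrN cM !exprMn; ring.
have [l hl] := power_sum_root w0 e.
pose a := r - p - (al l)%:R; pose b := s - q - (be l)%:R.
have h1 : cexp ((a + b) +i* ((a - b) * (2 * pi / S)))%C = 1.
  rewrite -(divff (cexp_neq0 ((al l)%:R * tau + (be l)%:R * conjc tau))) -{1}hl -cexpN -cexpD;
    congr cexp.
  rewrite -[(al l)%:R](rmorph_nat (real_complex R)) -[(be l)%:R](rmorph_nat (real_complex R)) /tau
    /a /b.
  by simpc; congr (_ +i* _)%C; ring.
have ab : a + b = 0.
  by apply: expR_inj; rewrite expR0 -(normc1 R) -h1 normc_cexp.
have [z hz] : exists z : int, (a - b) / S = z%:~R.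
  apply: cexp_period_int; rewrite -h1 ab; congr cexp.
  by simpc; congr (_ +i* _)%C; rewrite mulrCA mulrA.
have dl : a - b = del l by rewrite /a /b /del; ring.
have z0 : z = 0.
  have : `|z%:~R : R| < 1.
    rewrite -hz normrM normfV (gtr0_norm S0) ltr_pdivrMr // mul1r dl /S (bigD1 l) //=.
    by rewrite addrCA ltrDl ltr_pwDl // sumr_ge0.
  by rewrite -intr_norm -[1]/(1%:~R) ltr_int; lia.
move: hz; rewrite z0 => /eqP; rewrite mulf_eq0 invr_eq0 (gt_eqF S0) orbF => /eqP ab'.
by exists (al l), (be l); rewrite /a /b in ab ab'; split; lra.
Qed.

End KhatAlgebra.

(** * From Khat-algebras to correlators *)

Section FullFieldAlgebraOfKhatAlgebra.
Variable R : realType.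
Local Notation C := R[i].
Variable K : kalg_data R.
Local Notation iso := (@isotypic R K).

Definition kgr : R * R -> set K := regrade iso (@weight_of R).

Definition kcorr n (u : n.-tuple K) (c : conf R n) (pq : R * R) : K :=
  oapp (nuq (val (val c)) 0 (nseq n 1) (val u)) 0 (weight_of pq).

Definition ffa_build (V : lmodType C) (gr : R * R -> set V)
    (m : forall n, n.-tuple V -> conf R n -> R * R -> V) (one : V) : ffa_data R :=
  let F := @FFAData R V gr m one id id id id in
  @FFAData R V gr m one (@gradeL R F) (@gradeR R F) (@shiftop R F 1 0) (@shiftop R F 0 1).

Definition ffa_of_kalg : ffa_data R := ffa_build kgr kcorr (kone K).

Local Notation F := ffa_of_kalg.

Hypothesis kK : is_kalg K.
Hypothesis kS : is_smooth_kalg K.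
Let dI := kalg_reducible kK.
Let fI := kalg_findim kK.

Lemma weight_of_pbij pq (M : weight R) : weight_of pq = Some M <-> real_weight M = Some pq.
Proof. by split=> /weight_pbij. Qed.

Lemma real_weight_none M : real_weight M = None -> forall u, iso M u -> u = 0.
Proof.
move=> e u Mu; apply/eqP; apply: contraT => u0.
by have [pq] := real_weight_some kK kS Mu u0; rewrite e.
Qed.

Lemma kgr_direct_sum : direct_sum kgr.
Proof. exact: (regrade_direct_sum weight_of_pbij dI real_weight_none). Qed.

Lemma kgr_homog (x : weight R -> K) : (forall M, iso M (x M)) -> forall pq,
  kgr pq (oapp x 0 (weight_of pq)).
Proof. exact: regrade_homog. Qed.

Lemma kgrE pq M : weight_of pq = Some M -> kgr pq = iso M.
Proof. by rewrite /kgr /regrade => ->. Qed.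

Lemma kgr_none pq u : weight_of pq = None -> kgr pq u -> u = 0.
Proof. by rewrite /kgr /regrade => ->. Qed.

Lemma val_weight_of pq (M : weight R) : weight_of pq = Some M -> val M = (pq.1%:C%C, pq.2%:C%C).
Proof. by move=> /weight_of_pbij /real_weightP. Qed.

Lemma rdual_kgr (w : rdual kgr) : exists w' : rdual iso, w' =1 w /\
  forall x, (forall M, iso M (x M)) -> pairing w (fun pq => oapp x 0 (weight_of pq)) = pairing w' x.
Proof.
have [w' e] := rdual_regrade weight_of_pbij real_weight_none w; exists w'; split=> // x hx.
exact: (pairing_regrade weight_of_pbij real_weight_none hx e).
Qed.

(** The empty list is an exception: there [nuq] is the nullary operation and [mseq] is 0. *)
Lemma kalg_mseq (u : seq K) (z : seq C) pq : size u = size z -> z != [::] ->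
  mseq (F := F) u z pq = oapp (nuq z 0 (nseq (size z) 1) u) 0 (weight_of pq).
Proof.
move=> su z0; have [uz|uz] := boolP (uniq z); last first.
  rewrite mseq_degenerate ?negb_and ?uz ?orbT // nuq_degenerate //.
  by case: (weight_of pq).
have [c ec] := conf_ex (erefl (size z)) z0 uz.
rewrite (@mseqE _ F _ u c z (esym ec)).
rewrite -[LHS]/(kcorr (ntup (size z) u) c pq) /kcorr.
have vu : val (ntup (size z) u) = u := val_ntup su.
by rewrite vu ec.
Qed.

Lemma tact_linear c : linear (@tact R K c).
Proof.
rewrite /tact; case: insub => [d|] /= a x y; last by rewrite scaler0 addr0.
exact: kalg_act_linear.
Qed.

(** The action rebuilt from the grading is the given one: both are the same character on a real
    weight, and other weights carry the zero space. *)
Lemma act_tact c u : c != 0 -> act (F := F) c u = tact c u.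
Proof.
move=> c0; apply: (linear_ext dI (S := @act R F c) (T := @tact R K c)).
- exact: (@act_linear R F kgr_direct_sum).
- exact: tact_linear.
move=> M x Mx; rewrite (tact_weight c0 Mx).
case E : (real_weight M) => [[p q]|]; last first.
  by rewrite (real_weight_none E Mx) scaler0 (linear0 (@act_linear R F kgr_direct_sum c)).
have eM := E; move/real_weightP: E => E; move/weight_of_pbij: eM => eM.
have Gx : @ffa_gr R F (p, q) x by rewrite -[ffa_gr _ _]/(kgr (p, q) x) (kgrE eM).
by rewrite (@act_homog R F kgr_direct_sum c _ _ _ Gx) E.
Qed.

Lemma last_tnth n (z : n.+1.-tuple C) : last 0 z = tnth z ord_max.
Proof. by rewrite (tnth_nth 0) (last_nth 0) size_tuple /=; case: z => -[|x z]. Qed.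

Lemma elementary_smooth_at_one n (D : set (n.-tuple C)) (k : nat) (g : C -> k.-tuple C ->
  C) (f : n.-tuple C -> C) :
  open_coords D -> elementary g -> smooth_on D f ->
    smooth_on D (fun z => g (f z) [tuple of nseq k 1]).
Proof.
move=> oD [L [c [al [be [r [t e]]]]]] sf.
have n1 : 0 \notin [tuple of nseq k (1 : C)].
  by change (is_true (0 \notin nseq k (1 : C))); rewrite mem_nseq negb_and [0 == 1]eq_sym oner_neq0
    orbT.
pose P l := \prod_(j < k) (cpow (tnth [tuple of nseq k (1 : C)] j) (r l j)%:C%C *
                     cpowbar (tnth [tuple of nseq k (1 : C)] j) (t l j)%:C%C).
have H : smooth_on D (fun z => \sum_(l < L) c l * f z ^+ al l * conjc (f z) ^+ be l * P l).
  apply: (smooth_on_sum oD) => l; apply: (smooth_on_mul oD); last exact: smooth_on_cst.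
  apply: (smooth_on_mul oD).
    by apply: (smooth_on_mul oD); [exact: smooth_on_cst|exact: smooth_on_exp].
  by apply: (smooth_on_exp oD); exact: smooth_on_conj.
by apply: (eq_smooth_on oD) H => z _; rewrite (e _ _ n1).
Qed.

(** Passage to the normal form: subtract the last point and drop it. *)
Definition to_last_mx n : 'M[R]_(n.+1, n) :=
  \matrix_(i, j) ((i == j :> nat)%:R - (i == ord_max)%:R).

Lemma to_last_mxE n (z : n.+1.-tuple C) (j : 'I_n) :
  tnth (mulmx_tuple (to_last_mx n) z) j = tnth z (widen_ord (leqnSn n) j) - last 0 z.
Proof.
rewrite tnth_mktuple last_tnth.
under eq_bigr => i _ do rewrite mxE rmorphB /= mulrBl.
rewrite sumrB; congr (_ - _).
  rewrite (bigD1 (widen_ord (leqnSn n) j)) //= eqxx rmorph1 mul1r big1 ?addr0 // => i ij.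
  by rewrite (_ : (i == j :> nat) = false) ?rmorph0 ?mul0r //; apply/negbTE; rewrite -val_eqE in ij.
rewrite (bigD1 ord_max) //= eqxx rmorph1 mul1r big1 ?addr0 // => i ij.
by rewrite (negPf ij) rmorph0 mul0r.
Qed.

Lemma rcons_to_last n (z : n.+1.-tuple C) :
  rcons (mulmx_tuple (to_last_mx n) z) 0 = [seq x - last 0 z | x <- z].
Proof.
apply: (@eq_from_nth _ 0); rewrite size_rcons size_map !size_tuple // => j jn.
rewrite nth_rcons size_tuple (nth_map 0) ?size_tuple //; case: ltngtP => jn'.
- by have := to_last_mxE z (Ordinal jn'); rewrite !(tnth_nth 0) /= => ->.
- by move: jn; rewrite ltnS leqNgt jn'.
- by rewrite last_tnth (tnth_nth 0) jn' subrr.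
Qed.

(** The normal form of the sphere has points z_i - z_n, [a = - z_n] and scalings 1. Each [g] is
    polynomial in [a] and its conjugate and each [h] is smooth in the differences, all of them
    linear in the points. *)
Lemma kcorr_smooth n (u : n.-tuple F) (w : rdual (@ffa_gr R F)) :
  smooth_on [set z : n.-tuple C | (0 < n)%N && uniq z] (ffa_corr w u).
Proof.
have oD := @open_coords_conf R n.
case: n u oD => [|n] u oD.
  by apply: (eq_smooth_on oD) (smooth_on_cst oD 0) => z; rewrite /mkset.
have [w' [ew hw]] := rdual_kgr w.
have [L [g [h [hg hh hf]]]] := skalg_smooth kS u w'.
have H : smooth_on [set z : n.+1.-tuple C | (0 < n.+1)%N && uniq z]
    (fun z => \sum_(l < L) g l (- last 0 z) [tuple of nseq n.+1 1] * h l (mulmx_tuple (to_last_mx n)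
      z)).
  apply: (smooth_on_sum oD) => l; apply: (smooth_on_mul oD).
    apply: (elementary_smooth_at_one (f := fun z => - last 0 z)) => //.
    have := smooth_on_mul oD (smooth_on_cst oD (-1)) (smooth_on_coord oD ord_max).
    by apply: (eq_smooth_on oD) => z _; rewrite last_tnth mulN1r.
  have := smooth_on_mulmx (to_last_mx n) (open_append0 (R := R) (n := n)) (hh l).
  have -> // : [set z | [set z : n.-tuple C | uniq (rcons z 0)] (mulmx_tuple (to_last_mx n) z)] =
     [set z : n.+1.-tuple C | (0 < n.+1)%N && uniq z].
  apply/funext => z; change (is_true (uniq (rcons (mulmx_tuple (to_last_mx n) z) 0)) = is_true (uniq
    z)).
  by rewrite rcons_to_last map_inj_uniq //; exact: addIr.
apply: (eq_smooth_on oD) H => z uz; rewrite corr_mseq.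
have {}uz : uniq (tval z) := uz.
have z0 : tval z != [::] by rewrite -size_eq0 size_tuple.
have n1 : 0 \notin nseq n.+1 (1 : C) by rewrite mem_nseq negb_and [0 == 1]eq_sym oner_neq0 orbT.
have su : size (tval u) = size (tval z) by rewrite !size_tuple.
have -> : pairing w (mseq u z) = pairing w' (nuq z 0 (nseq n.+1 1) u).
  rewrite -hw; last by move=> M; exact: nuq_homog.
  by congr pairing; apply/funext => pq; rewrite kalg_mseq // size_tuple.
have [Q [hQ ->]] := @nuq_ex R K n.+1 z (nseq n.+1 1) u 0 (size_tuple z) (size_nseq _ _) (size_tuple
  u) uz n1.
have [e1 e2 e3] := hQ; rewrite ntupK hf.
have ez : ntup n.+1 z = z := ntupK z.
have es : ntup n.+1 (nseq n.+1 (1 : C)) = [tuple of nseq n.+1 1] by apply: val_inj;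
  rewrite val_ntup ?size_nseq.
apply: eq_bigr => l _; rewrite e2 e3 ez es sub0r; congr (_ * h l _).
apply: val_inj; have := val_kpts Q; rewrite e1 ez /=.
rewrite -rcons_to_last => /eqP; rewrite eqseq_rcons => /andP[/eqP -> _] //.
Qed.

Lemma ones_neq0 n : 0 \notin nseq n (1 : C).
Proof. by rewrite mem_nseq negb_and [0 == 1]eq_sym oner_neq0 orbT. Qed.

Lemma kcorr_multilinear n (z : conf R n) : multilinear (fun u : n.-tuple F => @ffa_m R F n u z).
Proof.
move=> u j a x y pq; rewrite -![ffa_m _ _ _]/(kcorr _ z pq) /kcorr.
case: (weight_of pq) => [M|] /=; last by rewrite scaler0 addr0.
have e v : tval (upd u j v) = take j u ++ v :: drop j.+1 u := val_upd _ _ _.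
rewrite !e; apply: (nuq_lin kK).
by rewrite size_tuple size_take size_drop size_tuple ltn_ord; have := ltn_ord j; lia.
Qed.

Lemma kcorr_identity1 (u : F) (z : conf R 1) : val z = [tuple 0] ->
  embeds (@ffa_gr R F) (@ffa_m R F 1 [tuple u] z) u.
Proof.
move=> ez; have := embeds_regrade weight_of_pbij real_weight_none (nuq_rescaling kK (Cx1 R) u).
by rewrite (kalg_act1 kK) -[embeds _ _ _]/(embeds kgr _ _) /ffa_m /= /kcorr ez.
Qed.

Lemma kcorr_identity n (u : n.-tuple F) (z : conf R n) (z' : conf R n.+1) zn :
  val z' = [tuple of rcons (val z) zn] ->
  @ffa_m R F n.+1 [tuple of rcons u (@ffa_one R F)] z' = @ffa_m R F n u z.
Proof.
move=> ez; apply/funext => pq.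
rewrite -[LHS]/(kcorr _ z' pq) -[RHS]/(kcorr u z pq) /kcorr ez; congr (oapp _ _ _).
have /andP[_ uz] := valP z'; have {}uz : uniq (rcons (val (val z)) zn) by move: uz; rewrite ez.
rewrite -[val [tuple of rcons u _]]/(rcons u (kone K)) -[val [tuple of rcons (val z) zn]]/(rcons
  (val (val z)) zn).
have -> : nseq n.+1 (1 : C) = nseq n 1 ++ [:: 1] by rewrite -[n.+1]addn1 nseqD.
have := @nuq_insert_one R K kK (val (val z)) zn [::] 0 (nseq n 1) 1 [::] u [::].
rewrite size_nseq !size_tuple cats1 => /(_ erefl erefl erefl erefl uz).
rewrite !cats0 [u ++ _]cats1 => -> //; rewrite mem_cat inE negb_or ones_neq0 eq_sym oner_neq0 //.
Qed.

Lemma nth_ones n i : (i < n)%N -> nth 0 (nseq n (1 : C)) i = 1.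
Proof. by move=> h; rewrite nth_nseq h. Qed.

Lemma splice_ones i m n : (i < m)%N -> splice i (nseq m (1 : C)) (nseq n 1) = nseq (m + n).-1 1.
Proof.
move=> h; have e k : all (pred1 (1 : C)) (nseq k 1) by rewrite all_nseq /= eqxx orbT.
have : all (pred1 (1 : C)) (splice i (nseq m (1 : C)) (nseq n 1)).
  rewrite /splice !all_cat e /=; apply/andP; split.
    by apply/allP => x /mem_take xm; exact: (allP (e m)).
  by apply/allP => x /mem_drop xm; exact: (allP (e m)).
by move/all_pred1P => ->; rewrite size_splice_seq !size_nseq.
Qed.

Lemma kcorr_convergence k l (i : 'I_k) (u : k.-tuple F) (v : l.-tuple F)
      (z : conf R k) (zeta : conf R l) (z' : conf R (k + l).-1) :
    let zi := tnth (val z) i in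
    (forall (s : 'I_l) (j : 'I_k), j != i ->
      `|tnth (val zeta) s| < `|zi - tnth (val z) j|) ->
    val z' = splice_tuple i (val z) (map_tuple (fun x => zi + x) (val zeta)) ->
    forall w : rdual (@ffa_gr R F),
    sums_absolutely
      (fun pq : R * R => pairing w (@ffa_m R F k (upd u i (@ffa_m R F l v zeta pq)) z))
      (pairing w (@ffa_m R F _ (splice_tuple i u v) z')).
Proof.
move=> zi h ez w; have [w' [ew hw]] := rdual_kgr w.
have ilt : (i < size (val (val z)))%N by rewrite size_tuple.
have /andP[_ uz] := valP z; have /andP[_ uze] := valP zeta.
have nzi : nth 0 (val (val z)) i = zi by rewrite /zi (tnth_nth 0).
have hh : forall (x : C) (j : nat), x \in val (val zeta) -> (j < size (val (val z)))%N -> j != i ->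
    normc (x - 0) < normc (nth 0 (nseq k 1) i) * normc (nth 0 (val (val z)) j - nth 0 (val (val z))
      i).
  move=> x j /tnthP[s ->]; rewrite size_tuple => jk ji.
  have := h s (Ordinal jk); rewrite -val_eqE /= => /(_ ji).
  by rewrite ltcE_normc subr0 nth_ones // normc1 mul1r nzi -[normc (_ - zi)]normcB (tnth_nth 0 _
    (Ordinal jk)).
have := @nuq_sewing R K kK i u v (val (val z)) 0 (nseq k 1) (val (val zeta)) 0 (nseq l 1) ilt.
have [su1 sv1] : size (tval u) = size (val (val z)) /\
  size (tval v) = size (val (val zeta)) by rewrite !size_tuple.
have [sz1 sz2] : size (nseq k (1 : C)) = size (val (val z)) /\
  size (nseq l (1 : C)) = size (val (val zeta)).
  by rewrite (size_tuple (val z)) (size_tuple (val zeta)) !size_nseq.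
move=> /(_ su1 sz1 sv1 sz2 uz uze (ones_neq0 _) (ones_neq0 _) hh w').
rewrite nzi !nth_ones // map_nseq mulr1 splice_ones //.
have -> : [seq zi + (x - 0) / 1 | x <- val (val zeta)] = [seq zi + x | x <- val (val zeta)].
  by apply: eq_map => x; rewrite subr0 divr1.
move=> H; have {}H := sums_pbij weight_of_pbij _ H.
have -> : pairing w (@ffa_m R F _ (splice_tuple i u v) z') =
   pairing w' (nuq (splice i (val (val z)) [seq zi + x |
     x <- val (val zeta)]) 0 (nseq (k + l).-1 1) (splice i u v)).
  rewrite -hw; last by move=> M; exact: nuq_homog.
  by congr pairing; apply/funext => pq; rewrite -[LHS]/(kcorr _ z' pq) /kcorr ez.
have sl : scalar (fun x => pairing w' (nuq (val (val z)) 0 (nseq k 1) (splice i u [:: x]))).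
  by apply: (pairing_nuq_lin kK); rewrite size_take size_drop !size_tuple ltn_ord;
    have := ltn_ord i; lia.
have z0 : pairing w' (nuq (val (val z)) 0 (nseq k 1) (splice i u [:: 0])) = 0.
  by have := sl (-1) 0 0; rewrite scaler0 addr0 mulN1r addNr.
apply: eq_sums (H _) => [pq|M hM]; last first.
  by rewrite (real_weight_none hM (nuq_homog kK _ _ _ _ _)).
have -> : pairing w (@ffa_m R F k (upd u i (@ffa_m R F l v zeta pq)) z) =
   pairing w' (nuq (val (val z)) 0 (nseq k 1) (splice i u [:: kcorr v zeta pq])).
  rewrite -hw; last by move=> M; exact: nuq_homog.
  congr pairing; apply/funext => pq'; rewrite -[LHS]/(kcorr _ z pq') /kcorr.
  by rewrite val_upd.
by rewrite /kcorr; case: (weight_of pq) => [M|] //=; rewrite z0.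
Qed.

Lemma kcorr_permutation n (s : 'S_n) (u : n.-tuple F) (z z' : conf R n) :
    val z' = permute s (val z) -> @ffa_m R F n (permute s u) z' = @ffa_m R F n u z.
Proof.
move=> ez; apply/funext => pq; rewrite -[LHS]/(kcorr _ z' pq) -[RHS]/(kcorr u z pq) /kcorr ez.
congr (oapp _ _ _).
pose l := [tuple (tnth u j, (tnth (val z) j, 1 : C)) | j < n].
have sl : perm_eq (permute s l) l by apply/tuple_permP; exists s.
have el : val l = [seq (tnth u j, (tnth (val z) j, 1 : C)) | j <- enum 'I_n] by [].
have ep : val (permute s l) = [seq (tnth u (s j), (tnth (val z) (s j), 1 : C)) | j <- enum 'I_n].
  by apply: eq_map => j; rewrite tnth_mktuple.
have e1 : unzip1 (val l) = u by rewrite el /unzip1 -map_comp; exact: map_tnth_enum.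
have e2 : unzip1 (unzip2 (val l)) = tval (val z).
  rewrite el /unzip1 /unzip2 -2!map_comp; exact: (map_tnth_enum (val z)).
have one (t : 'I_n -> K * (C * C)) : (forall j, (t j).2.2 = 1) ->
    unzip2 (unzip2 [seq t j | j <- enum 'I_n]) = nseq n 1.
  by move=> ht; rewrite -[in RHS](size_enum_ord n); elim: (enum 'I_n) => //= j r ->; rewrite ht.
have e3 : unzip2 (unzip2 (val l)) = nseq n 1 by rewrite el; apply: one.
have e4 : unzip2 (unzip2 (val (permute s l))) = nseq n 1 by rewrite ep; apply: one.
have e5 : unzip1 (val (permute s l)) = permute s u by rewrite ep /unzip1 -map_comp.
have e6 : unzip1 (unzip2 (val (permute s l))) = permute s (val z).
  by rewrite ep /unzip1 /unzip2 -2!map_comp.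
have := nuq_perm kK 0 sl; rewrite -[X in _ \notin X]/(unzip2 (unzip2 (val (permute s l)))) e4 => /(_
  (ones_neq0 _)).
by rewrite -[tval l]/(val l) -[tval (permute s l)]/(val (permute s l)) e1 e2 e3 e5 e6.
Qed.

(** Rescaling multiplies every scaling of the sphere by [c], and [nuq_scaling] turns the scalings
    into the action on the vectors. *)
Lemma kcorr_scaling c (u : seq F) z p q : c != 0 -> size u = size z ->
    chi (- p%:C%C) (- q%:C%C) c *: mseq u z (p, q) =
      mseq (map (act c) u) (map (fun x => x / c) z) (p, q).
Proof.
move=> c0 su; have [->|z0] := eqVneq z [::].
  by rewrite /= !mseq_degenerate // scaler0.
have zc0 : [seq x / c | x <- z] != [::] by case: (z) z0.
have suc : size (map (act (F := F) c) u) = size [seq x / c | x <- z] by rewrite !size_map.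
rewrite (kalg_mseq _ su z0) (kalg_mseq _ suc zc0) size_map.
case E : (weight_of (p, q)) => [M|] /=; last by rewrite scaler0.
have [uz|uz] := boolP (uniq z); last first.
  rewrite (nuq_degenerate _ _ _ uz) scaler0 nuq_degenerate // map_inj_uniq //.
  by apply: mulIf; rewrite invr_neq0.
have eM := val_weight_of E; have [d ed] := Cx_ex c0.
have := @act_nuq R K kK d z 0 (nseq (size z) 1) u M (size_nseq _ _) su uz (ones_neq0 _).
rewrite (act_weight d (nuq_homog kK _ _ _ _ _)) eM ed /= => ->.
have -> : [seq (x - 0) / c | x <- z] = [seq x / c | x <- z] by apply: eq_map => x; rewrite subr0.
rewrite map_nseq mulr1 (@nuq_scaling R K kK) ?size_nseq ?size_map //; last first.
  by rewrite mem_nseq negb_and eq_sym c0 orbT.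
congr (nuq _ _ _ _ M); rewrite -su; elim: (u) => //= x v ->; by rewrite act_tact.
Qed.

Lemma precore_of_kalg : is_precore F.
Proof.
split.
- exact: kgr_direct_sum.
- exact: regrade_findim fI.
- have [N hN] := skalg_lower kS; exists N => p q h u.
  rewrite -[ffa_gr _ _]/(kgr (p, q) u); case E : (weight_of (p, q)) => [M|]; last exact: kgr_none.
  by rewrite (kgrE E); apply: hN; rewrite (val_weight_of E).
- by move=> n u z pq; apply: kgr_homog => M; exact: nuq_homog.
- exact: kcorr_multilinear.
- exact: kcorr_smooth.
- exact: kcorr_identity1.
- exact: kcorr_identity.
- exact: kcorr_convergence.
- exact: kcorr_permutation.
Qed.

Lemma core_of_kalg : is_core F.
Proof.
split; first exact: precore_of_kalg.
- move=> p q u; rewrite -[ffa_gr _ _]/(kgr (p, q) u); case E : (weight_of (p, q)) => [M|];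
    last first.
    by move/(kgr_none E) => ->; rewrite eqxx.
  move=> _ _; have /asboolP [k hk] := valP M; exists k.
  by move: hk; rewrite (val_weight_of E) /= -rmorphB -(rmorph_int (real_complex R)) => -[].
- rewrite -[ffa_gr _ _]/(kgr (0, 0) (kone K)).
  have E : weight_of (0, 0) = Some (weight0 R).
    by apply/weight_of_pbij/real_weightP.
  by rewrite (kgrE E); exact: nuq_homog.
- exact: kcorr_scaling.
- move=> p q u t r s; rewrite -[ffa_gr _ _]/(kgr (p, q) u); case E : (weight_of (p, q)) => [M|];
    last first.
    move/(kgr_none E) => ->; rewrite (kalg_mseq _ (erefl : size [:: 0] = size [:: t]) isT).
    by case: (weight_of (r, s)) => [N|] /=; rewrite ?(linear0 (nuq1_linear kK _ _ _)) eqxx.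
  rewrite (kgrE E) (kalg_mseq _ (erefl : size [:: u] = size [:: t]) isT) => Mu.
  case E' : (weight_of (r, s)) => [N|] /=; last by rewrite eqxx.
  exact: (kalg_degrees kK kS (val_weight_of E) (val_weight_of E') Mu).
Qed.

Lemma ffa_of_kalgP : is_ffa F.
Proof. exact: (ffa_of_core core_of_kalg). Qed.

End FullFieldAlgebraOfKhatAlgebra.

(** * The isomorphism of categories *)

Section RoundTrips.
Variable R : realType.
Local Notation C := R[i].

(** The correlators retain nu at [a = 0] and scalings 1; [nuq_translate] and [nuq_scaling] recover
    it on every sphere. *)
Lemma kalg_ffa_kalg (K : kalg_data R) : is_kalg K -> is_smooth_kalg K ->
  kalg_of_ffa (ffa_of_kalg K) = K.
Proof.
move=> kK kS; transitivity (@KAlgData R K (@kalg_act R K) (@kalg_nu R K)); last by case: (K).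
have actE c u : c != 0 -> act (F := ffa_of_kalg K) c u = tact c u := act_tact kK kS u.
congr KAlgData; first by apply/funext => c; apply/funext => u; rewrite actE ?tactE //;
  exact: (valP c).
apply: functional_extensionality_dep => n; apply/funext => Q; apply/funext => u; apply/funext => M.
(* A point of the operad is its own normal form: the normalising translation is 0. *)
have hQ : represents Q (kpts Q) (ka Q) (ks Q).
  have t0 : (if n is 0 then ka Q else last 0 (kpts Q)) = 0.
    case: n Q u => [|n] Q u; first by have /and3P[_ _ /eqP] := khatP Q.
    have e : tval (kpts Q) = rcons (kz Q) 0 := val_kpts Q.
    by rewrite e last_rcons.
  split=> //; rewrite t0 ?subr0 //.
  by apply: val_inj; rewrite /= -[LHS]map_id; apply: eq_map => x; rewrite subr0.
have <- : nuq (kpts Q) (ka Q) (ks Q) u M = kalg_nu Q u M by rewrite (nuqE hQ erefl erefl erefl).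
have nu0 : real_weight M = None -> nuq (kpts Q) (ka Q) (ks Q) u M = 0.
  by move=> e; exact: (real_weight_none kK kS e (nuq_homog kK _ _ _ _ _)).
rewrite -[LHS]/(oapp (nuseq (F := ffa_of_kalg K) u (kpts Q) (ka Q) (ks Q)) 0 (real_weight M)).
case E : (real_weight M) => [pq|]; last by rewrite nu0.
rewrite oapp_some.
have EM : weight_of pq = Some M by apply/weight_of_pbij.
(* The nullary operation is recovered from its component [kone], the others being 0 by
   [nuq_nil_off]. *)
have [e|z0] := eqVneq (tval (kpts Q)) [::].
  rewrite nuseq_nil //; have n0 : n = 0%N by rewrite -(size_tuple (kpts Q)) e.
  subst n; rewrite e [tval (ks Q)]size0nil ?size_tuple // [tval u]size0nil ?size_tuple //.
  have -> : ka Q = 0 by have /and3P[_ _ /eqP] := khatP Q.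
  case: eqP => [e0|ne].
    have -> // : M = weight0 R.
    by apply: val_inj; move/real_weightP : E => ->; rewrite e0.
  rewrite (nuq_nil_off kK) //; apply/eqP => eM; apply: ne.
  have : Some pq = Some (0, 0) by rewrite -E eM /real_weight /= eqxx.
  by case.
have [ss su] : size (tval (ks Q)) = size (tval (kpts Q)) /\
  size (tval u) = size (tval (kpts Q)) by rewrite !size_tuple.
have /and3P[_ s0 _] := khatP Q.
have sp : size [seq x - ka Q | x <- tval (kpts Q)] = size (tval (kpts Q)) := size_map _ _.
have sa : size (actseq (F := ffa_of_kalg K) (ks Q) u) = size (tval (kpts Q)).
  by rewrite /actseq size_map size_zip ss su minnn.
have st : size [seq tact x.1 x.2 | x <- zip (ks Q) u] = size (tval (kpts Q)).
  by rewrite size_map size_zip ss su minnn.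
have za : [seq x - ka Q | x <- tval (kpts Q)] != [::] by rewrite -size_eq0 sp size_eq0.
rewrite nuseq_mseq // (kalg_mseq _ (etrans sa (esym sp)) za) sp EM oapp_some.
rewrite (nuq_scaling kK _ ss su s0) -(@nuq_translate R K _ (ka Q) _ _ (- ka Q) (size_nseq _ _) st
  (ones_neq0 _ _)) subrr.
  congr (nuq _ _ _ _ M); rewrite /actseq.
  have {}s0 : 0 \notin tval (ks Q) := s0.
  move: (tval (ks Q)) (tval u) s0; elim=> [|c s IH] [|x v] //=;
    rewrite inE negb_or eq_sym => /andP[c0 s0].
  by rewrite IH // actE.
Qed.

(** Degrees without a weight are lost on the way and come back as 0, which is what they carry; the
    operators come back because they are determined by the other fields. *)
Lemma ffa_kalg_ffa (F : ffa_data R) : is_ffa F -> ffa_of_kalg (kalg_of_ffa F) = F.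
Proof.
move=> fF; have cF := core_of_ffa fF; have kK := kalg_of_core cF.
set K := kalg_of_ffa F in kK *.
have egr : @kgr R K = @ffa_gr R F.
  apply/funext => pq; apply/funext => u; rewrite /kgr {1}/regrade isotypicE //.
  case E : (weight_of pq) => [M|] /=; first by move/weight_of_pbij: E => /regrade_some ->.
  apply/propext; split=> [->|]; first exact: (homog0 (pre_grading (core_pre cF))).
  exact: (weight_of_int cF E).
have em : @kcorr R K = @ffa_m R F.
  apply: functional_extensionality_dep => n; apply/funext => u; apply/funext => c;
    apply/funext => pq.
  rewrite /kcorr; have /andP[n0 uz] := valP c.
  have z0 : tval (val c) != [::] by rewrite -size_eq0 size_tuple -lt0n.
  have [Q [hQ ->]] := @nuq_ex R K n (val (val c)) (nseq n 1) u 0 (size_tuple _) (size_nseq _ _)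
    (size_tuple u) uz (ones_neq0 _ _).
  case E : (weight_of pq) => [M|]; last by rewrite (weight_of_int cF E (pre_homogeneous (core_pre
    cF) u c pq)).
  move/weight_of_pbij: E => E; rewrite oapp_some kalg_nuE E oapp_some ntupK (nuseq_represents _ hQ).
  rewrite val_ntup ?size_tuple // nuseq_mseq // val_ntup ?size_nseq //.
  have -> : [seq x - 0 | x <- val (val c)] = val (val c) by rewrite -[RHS]map_id;
    apply: eq_map => x; rewrite subr0.
  have -> : actseq (nseq n 1) u = u.
    rewrite -{1}(size_tuple u) /actseq; elim: (tval u) => //= x v ->; by rewrite (act1 cF).
  by rewrite mseqT.
have eo : kone K = @ffa_one R F.
  have n0 : 0 \notin ([::] : seq C) by [].
  have [Q [hQ e]] := @nuq_ex R K 0 [::] [::] [::] 0 erefl erefl erefl isT n0.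
  rewrite /kone e kalg_nuE.
  have -> : real_weight (weight0 R) = Some (0, 0) by apply/real_weightP.
  by rewrite oapp_some (nuseq_nil _ _ _ _ (kpts0 Q)) eqxx.
have [eL eR] := ffa_DE fF.
have e : @FFAData R F (@ffa_gr R F) (@ffa_m R F) (@ffa_one R F) (@gradeL R F) (@gradeR R F)
    (@shiftop R F 1 0) (@shiftop R F 0 1) = F.
  by rewrite -(ffa_dL_grade fF) -(ffa_dR_grade fF) -eL -eR; case: (F).
by rewrite /ffa_of_kalg egr em eo; exact: e.
Qed.

End RoundTrips.

(** * Morphisms *)

Section Morphisms.
Variable R : realType.
Local Notation C := R[i].

Lemma mseq_morphism (F1 F2 : ffa_data R) (f : F1 -> F2) : linear f ->
  (forall n (u : n.-tuple F1) (z : conf R n) pq, f (ffa_m u z pq) = ffa_m (map_tuple f u) z pq) ->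
  forall u z pq, f (mseq u z pq) = mseq (map f u) z pq.
Proof.
move=> lf hf u z pq; have f0 : f 0 = 0 by exact: linear0.
rewrite /mseq; case: insub => [c|] //=; rewrite hf; congr (ffa_m _ c pq).
apply: eq_from_tnth => j; rewrite tnth_map !tnth_mktuple.
have [h|h] := ltnP j (size u); first by rewrite (nth_map 0).
by rewrite !nth_default ?size_map.
Qed.

(** Preserving the grading means commuting with the rescalings, and [kalg_nu] is built from these,
    the correlators and the vacuum. *)
Lemma skalg_morphism_of_ffa (F1 F2 : ffa_data R) (c1 : is_core F1) (c2 : is_core F2) (f : F1 ->
  F2) :
  linear f -> (forall pq u, ffa_gr pq u -> ffa_gr pq (f u)) ->
  (forall n (u : n.-tuple F1) (z : conf R n) pq, f (ffa_m u z pq) = ffa_m (map_tuple f u) z pq) ->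
  f (ffa_one F1) = ffa_one F2 ->
  (forall c u, f (act c u) = act c (f u)) /\
  (forall n (Q : Khat R n) (u : n.-tuple F1) M,
    f (kalg_nu (k := kalg_of_ffa F1) Q u M) = kalg_nu (k := kalg_of_ffa F2) Q (map_tuple f u) M).
Proof.
move=> lf gf mf onef.
have hact c u : f (act c u) = act c (f u).
  apply: (linear_ext (pre_grading (core_pre c1)) (S := fun u => f (act c u)) (T :=
    fun u => act c (f u))).
  - by move=> a x y; rewrite (act_linear (pre_grading (core_pre c1))) lf.
  - by move=> a x y; rewrite lf (act_linear (pre_grading (core_pre c2))).
  move=> [p q] x Gx; rewrite (act_homog (pre_grading (core_pre c1)) _ Gx) (act_homog (pre_grading
    (core_pre c2)) _ (gf _ _ Gx)).
  exact: linear_scal.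
split=> // n Q u M; rewrite !kalg_nuE; case: (real_weight M) => [pq|] /=; last exact: linear0.
have [e|z0] := eqVneq (tval (kpts Q)) [::].
  by rewrite !nuseq_nil //; case: eqP => _ //; exact: linear0.
rewrite !nuseq_mseq // mseq_morphism //; congr mseq.
rewrite /actseq -map_comp; elim: (tval (ks Q)) (tval u) => [|d s IH] [|x v] //=.
by rewrite IH hact.
Qed.

Lemma nuq_morphism (K1 K2 : kalg_data R) (f : K1 -> K2) : linear f ->
  (forall n (Q : Khat R n) (u : n.-tuple K1) M, f (kalg_nu Q u M) = kalg_nu Q (map_tuple f u) M) ->
  forall p a s u M, f (nuq p a s u M) = nuq p a s (map f u) M.
Proof.
move=> lf hf p a s u M; rewrite /nuq; case: pselect => [h|h]; last exact: linear0.
rewrite hf; congr (kalg_nu _ _ M); apply: eq_from_tnth => j; rewrite tnth_map !tnth_mktuple.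
have [k|k] := ltnP j (size u); first by rewrite (nth_map 0).
by rewrite !nth_default ?size_map //; exact: linear0.
Qed.

(** Equivariance gives preservation of the grading, and compatibility with m_1 gives that with D^L
    and D^R. *)
Lemma ffa_morphism_of_skalg (K1 K2 : skalg R) (f : K1 -> K2) : is_skalg_morphism f ->
  is_ffa_morphism (F1 := FFA (ffa_of_kalgP (skalg_axioms K1) (skalg_smooth_axioms K1)))
    (F2 := FFA (ffa_of_kalgP (skalg_axioms K2) (skalg_smooth_axioms K2))) f.
Proof.
case=> lf hact hnu.
have c1 := core_of_kalg (skalg_axioms K1) (skalg_smooth_axioms K1).
have c2 := core_of_kalg (skalg_axioms K2) (skalg_smooth_axioms K2).
have gf pq (u : K1) : kgr pq u -> kgr pq (f u).
  case E : (weight_of pq) => [M|]; last by move/(kgr_none E) ->; rewrite (linear0 lf);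
    exact: (homog0 (pre_grading (core_pre c2))).
  rewrite !(kgrE _ E) => Mu c; rewrite -hact Mu; exact: linear_scal.
have mf n (u : n.-tuple K1) (z : conf R n) pq : f (kcorr u z pq) = kcorr (map_tuple f u) z pq.
  rewrite /kcorr; case: (weight_of pq) => [M|] /=; last exact: linear0.
  exact: nuq_morphism.
have sf i j u : f (@shiftop R (ffa_of_kalg K1) i j u) = @shiftop R (ffa_of_kalg K2) i j (f u).
  have p1 := core_pre c1; have p2 := core_pre c2.
  apply: (linear_ext (pre_grading (core_pre c1)) (S :=
    fun u => f (@shiftop R (ffa_of_kalg K1) i j u))
     (T := fun u => @shiftop R (ffa_of_kalg K2) i j (f u))).
  - by move=> a x y; rewrite (shiftop_linear p1) lf.
  - by move=> a x y; rewrite lf (shiftop_linear p2).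
  move=> [p q] x Gx; rewrite (shiftopE p1 _ _ Gx) (shiftopE p2 _ _ (gf _ _ Gx)).
  exact: (@mseq_morphism (ffa_of_kalg K1) (ffa_of_kalg K2) f lf mf).
split=> //.
- by rewrite -[LHS]/(f (kone K1)) /kone (nuq_morphism lf hnu).
- by move=> u; exact: sf.
- by move=> u; exact: sf.
Qed.

End Morphisms.

(** * The two functors and their composites *)

Section Isomorphism.
Variable R : realType.
Local Notation C := R[i].

Lemma ffa_eq (A B : ffa R) : ffa_dat A = ffa_dat B -> A = B.
Proof. by case: A B => [A pA] [B pB] /= e; subst B; rewrite (Prop_irrelevance pA pB). Qed.

Lemma skalg_eq (A B : skalg R) : skalg_dat A = skalg_dat B -> A = B.
Proof.
case: A B => [A pA qA] [B pB qB] /= e; subst B.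
by rewrite (Prop_irrelevance pA pB) (Prop_irrelevance qA qB).
Qed.

Definition skalg_of_ffa (F : ffa R) : skalg R :=
  SKAlg (kalg_of_core (core_of_ffa (ffa_axioms F))) (smooth_kalg_of_core (core_of_ffa (ffa_axioms
    F))).

Definition ffa_of_skalg (K : skalg R) : ffa R :=
  FFA (ffa_of_kalgP (skalg_axioms K) (skalg_smooth_axioms K)).

Lemma skalg_of_ffa_hom (F1 F2 : ffa R) (f : ffa_hom F1 F2) :
  is_skalg_morphism (F1 := skalg_of_ffa F1) (F2 := skalg_of_ffa F2) (proj1_sig f).
Proof.
case: f => f [lf gf mf onef _ _] /=.
have [h1 h2] := skalg_morphism_of_ffa (core_of_ffa (ffa_axioms F1)) (core_of_ffa (ffa_axioms F2)) lf
  gf mf onef.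
by split=> // c u; exact: h1.
Qed.

Definition to_skalg : functor (ffa_category R) (skalg_category R).
Proof.
refine (@Functor (ffa_category R) (skalg_category R) skalg_of_ffa
  (fun A B f => exist _ (proj1_sig f) (skalg_of_ffa_hom f)) _ _).
- by move=> A; exact: skalg_hom_eq.
- by move=> A B E g f; exact: skalg_hom_eq.
Defined.

Definition to_ffa : functor (skalg_category R) (ffa_category R).
Proof.
refine (@Functor (skalg_category R) (ffa_category R) ffa_of_skalg
  (fun A B f => exist _ (proj1_sig f) (ffa_morphism_of_skalg (proj2_sig f))) _ _).
- by move=> A; exact: ffa_hom_eq.
- by move=> A B E g f; exact: ffa_hom_eq.
Defined.

(** Arrows between propositionally equal records are compared through their underlying maps. The
    premise ranges over all equalities of carriers, so [erefl] can be substituted once the carriers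
    are convertible. *)
Lemma ffa_arrow_eq (A' A B' B : ffa R) (eA : A' = A) (eB : B' = B) (h' : ffa_hom A' B') (h : ffa_hom
  A B) :
  (forall (p : ffa_carrier A' = ffa_carrier A) (q : ffa_carrier B' = ffa_carrier B) x,
    eq_rect _ (fun V : lmodType C => V) (proj1_sig h' x) _ q =
    proj1_sig h (eq_rect _ (fun V : lmodType C => V) x _ p)) ->
  existT _ A' (existT _ B' h') = existT _ A (existT _ B h) :> arrow (ffa_category R).
Proof.
subst A' B' => e; suff -> : h' = h by []; apply: ffa_hom_eq; apply/funext => x.
exact: (e erefl erefl x).
Qed.

Lemma skalg_arrow_eq (A' A B' B : skalg R) (eA : A' = A) (eB : B' = B) (h' : skalg_hom A' B') (h :
  skalg_hom A B) :
  (forall (p : kalg_carrier A' = kalg_carrier A) (q : kalg_carrier B' = kalg_carrier B) x,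
    eq_rect _ (fun V : lmodType C => V) (proj1_sig h' x) _ q =
    proj1_sig h (eq_rect _ (fun V : lmodType C => V) x _ p)) ->
  existT _ A' (existT _ B' h') = existT _ A (existT _ B h) :> arrow (skalg_category R).
Proof.
subst A' B' => e; suff -> : h' = h by []; apply: skalg_hom_eq; apply/funext => x.
exact: (e erefl erefl x).
Qed.

End Isomorphism.

Theorem theorem1p17 (R : realType) :
  isomorphic_categories (ffa_category R) (skalg_category R).
Proof.
have TS : cancel (fobj (to_skalg R)) (fobj (to_ffa R)).
  by move=> F; apply: ffa_eq; exact: (ffa_kalg_ffa (ffa_axioms F)).
have ST : cancel (fobj (to_ffa R)) (fobj (to_skalg R)).
  by move=> K; apply: skalg_eq; exact: (kalg_ffa_kalg (skalg_axioms K) (skalg_smooth_axioms K)).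
exists (to_skalg R), (to_ffa R); split=> //.
- move=> [A [B h]]; apply: (ffa_arrow_eq (TS A) (TS B)) => p q x.
  (* The round trip keeps the carrier and the underlying map by conversion, so both transports
     reduce to the identity. *)
  rewrite (Prop_irrelevance p (erefl (ffa_carrier A))) (Prop_irrelevance q (erefl (ffa_carrier B))).
  by [].
- move=> [A [B h]]; apply: (skalg_arrow_eq (ST A) (ST B)) => p q x.
  rewrite (Prop_irrelevance p (erefl (kalg_carrier A))) (Prop_irrelevance q (erefl (kalg_carrier
    B))).
  by [].
Qed.
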